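(* Let $M$ be a hyperbolic $3$-manifold with two cusps, and for coprime integers $p_1,q_1$ let $M(p_1,q_1)$ be the Dehn-filled $3$-manifold obtained from $M$ by $(p_1,q_1)$-surgery on the first cusp. Let $a_i$ be the $i$-th Taylor coefficient of $l_2$ in terms of $m_2$ for the geometric factor of the $A$-polynomial of $M$ with respect to the second cusp (first end remaining a cusp), and let $a_i^{p_1,q_1}$ be the corresponding $i$-th Taylor coefficient for $M(p_1,q_1)$, i.e. $$l_2=l_2^0+a_1(m_2-m_2^0)+\tfrac{a_2}{2}(m_2-m_2^0)^2+\tfrac{a_3}{6}(m_2-m_2^0)^3+\cdots$$ when the first end of $M$ remains a cusp, and $$l_2=l_2^0+a_1^{p_1,q_1}(m_2-m_2^0)+\tfrac{a_2^{p_1,q_1}}{2}(m_2-m_2^0)^2+\tfrac{a_3^{p_1,q_1}}{6}(m_2-m_2^0)^3+\cdots$$ when the first end is Dehn-filled along the slope $(p_1,q_1)$ (with $|p_1|+|q_1|$ large). Then $$a_i^{p_1,q_1}\to a_i\quad\text{as } |p_1|+|q_1|\to\infty,\qquad i=1,2,3.$$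
   Context: $M$ is an orientable $3$-manifold admitting a complete hyperbolic structure of finite volume with exactly two cusps, with fixed meridian–longitude pairs $\mathcal M_1,\mathcal L_1$ and $\mathcal M_2,\mathcal L_2$ for its ends. It is assumed that $M$ can be obtained from an ideally triangulated hyperbolic manifold (with $\nu$ ideal tetrahedra) by Dehn filling some of its ends. Let $\mathbf z^0\in\mathbb C^\nu$ be the tetrahedral shape parameters of the complete structure on $M$, and let $\mathcal V\subset\mathbb C^\nu$ be the set of points near $\mathbf z^0$ satisfying the gluing consistency relations; it is the image of a holomorphic embedding $\iota:V\to\mathbb C^\nu$ of an open set $V\subset\mathbb C^2$, and its points parametrize the (generally incomplete) hyperbolic structures on $M$ near the complete one. Let $\rho_0:\pi_1(M)\to\mathrm{SL}_2(\mathbb C)$ be a lift of a holonomy representation of the complete structure, and let $m_i^0,l_i^0\in\{1,-1\}$ be the eigenvalues of $\rho_0(\mathcal M_i),\rho_0(\mathcal L_i)$. For $\mathbf z\in\mathcal V$ let $\rho$ be the nearby lift of the corresponding holonomy representation; $m_i,l_i$ ($i=1,2$) denote eigenvalues of $\rho(\mathcal M_i),\rho(\mathcal L_i)$ (for a common eigenvector), chosen so that $(m_1,l_1,m_2,l_2)$ is a holomorphic function on $\mathcal V$ with value $(m_1^0,l_1^0,m_2^0,l_2^0)$ at $\mathbf z^0$. ''The first end remains a cusp'' means restricting to the points where $m_1=m_1^0$ and $l_1=l_1^0$; near $\mathbf z^0$, on this set $l_2$ is a holomorphic function of $m_2$ near $m_2^0$, giving the first expansion. ''The first end is Dehn-filled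 along the slope $(p_1,q_1)$'' means restricting to the points satisfying $$p_1\log\frac{m_1}{m_1^0}+q_1\log\frac{l_1}{l_1^0}=\pi\sqrt{-1}$$ (principal branch of $\log$ near $1$). For $|p_1|+|q_1|$ large, near the point of this set (close to $\mathbf z^0$) at which $(m_2,l_2)=(m_2^0,l_2^0)$, which corresponds to the complete one-cusped hyperbolic structure on $M(p_1,q_1)$, $l_2$ is a holomorphic function of $m_2$, giving the second expansion. These relations between $m_2$ and $l_2$ are the geometric factors of the respective $A$-polynomials. The limit is over coprime pairs of integers $(p_1,q_1)$. *)

(* Defs.v *)
From HB Require Import structures.
From Stdlib Require Import Relation_Operators.
From mathcomp Require Import all_boot all_order all_fingroup all_algebra.
From mathcomp Require Import complex.
From mathcomp Require Import all_classical all_reals all_analysis.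

Set Implicit Arguments.
Unset Strict Implicit.
Unset Printing Implicit Defensive.

Import Order.TTheory GRing.Theory Num.Theory numFieldNormedType.Exports.

Local Open Scope classical_set_scope.
Local Open Scope complex_scope.
Local Open Scope ring_scope.

Definition word := seq 'I_4.

(* [nbr t f] is the tetrahedron glued to face [f] (the face opposite to vertex
  [f]) of [t], and [glu t f] sends the vertices of [t] to those of [nbr t f];
  it matches the three vertices other than [f] along the common face and sends
  [f] to the vertex opposite to that face.  Since every tetrahedron carries
  the same orientation, a gluing respects the orientations when [glu t f] is
  odd. *)

Record triangulation (nu : nat) := Triangulation {
  nbr : 'I_nu -> 'I_4 -> 'I_nu;
  glu : 'I_nu -> 'I_4 -> 'S_4;
  glu_odd : forall t f, odd_perm (glu t f);
  nbrK : forall t f, nbr (nbr t f) (glu t f f) = t;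
  gluK : forall t f, glu (nbr t f) (glu t f f) = ((glu t f)^-1)%g;
  no_fold : forall t f, (nbr t f, glu t f f) <> (t, f);
  tri_connected : forall t t', exists w : word, foldl nbr t w = t' }.

Section Combinatorics.
Variables (nu : nat) (T : triangulation nu).

(* A word is a path in the dual graph: the list of the faces to be crossed.
   [rev_word t w] is the reverse of the path [w] starting at [t]. *)
Fixpoint rev_word (t : 'I_nu) (w : word) : word :=
  if w is f :: w' then rcons (rev_word (nbr T t f) w') (glu T t f f) else [::].

Definition word_exp (t : 'I_nu) (w : word) (n : int) : word :=
  match n with
  | Posz k => flatten (nseq k w)
  | Negz k => flatten (nseq k.+1 (rev_word t w))
  end.

(* [(t, a, b)] with [a != b] stands for the edge of [t] common to the faces
   [a] and [b], to be turned around by leaving [t] through [a]; the next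
   tetrahedron is entered through [glu T t a a] and left through
   [glu T t a b]. *)
Definition around (s : 'I_nu * 'I_4 * 'I_4) : 'I_nu * 'I_4 * 'I_4 :=
  let: (t, a, b) := s in (nbr T t a, glu T t a b, glu T t a a).

Definition edge_word (s : 'I_nu * 'I_4 * 'I_4) (n : nat) : word :=
  [seq (iter i around s).1.2 | i <- iota 0 n].

(* Null-homotopic loops at [t]: backtracking, and turning around an edge. *)
Definition null_tri (t : 'I_nu) (r : word) : Prop :=
  (exists f, r = [:: f; glu T t f f]) \/
  (exists a b n,
     [/\ a != b, iter n around (t, a, b) = (t, a, b) & r = edge_word (t, a, b) n]).

(* The corner [(t, v)] is the triangle cut off by the vertex [v] of [t]; the
   corners triangulate the links of the ideal vertices. *)
Definition corner_step (c : 'I_nu * 'I_4) (f : 'I_4) : 'I_nu * 'I_4 :=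
  (nbr T c.1 f, glu T c.1 f c.2).

Fixpoint link_path (c : 'I_nu * 'I_4) (w : word) : bool :=
  if w is f :: w' then (f != c.2) && link_path (corner_step c f) w' else true.

Definition null_link (c : 'I_nu * 'I_4) (r : word) : Prop :=
  (exists2 f, f != c.2 & r = [:: f; glu T c.1 f f]) \/
  (exists a b n,
     [/\ a != b, a != c.2 & b != c.2] /\
     iter n around (c.1, a, b) = (c.1, a, b) /\ r = edge_word (c.1, a, b) n).

End Combinatorics.

(* Homotopy of paths: insertion and removal of elementary null loops. *)
Definition elementary_homotopy (S : Type) (step : S -> 'I_4 -> S)
    (null : S -> word -> Prop) (s : S) (u v : word) : Prop :=
  exists w1 r w2,
    [/\ null (foldl step s w1) r, u = w1 ++ r ++ w2 & v = w1 ++ w2].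

Definition homotopic (S : Type) (step : S -> 'I_4 -> S)
    (null : S -> word -> Prop) (s : S) : word -> word -> Prop :=
  clos_refl_sym_trans word (elementary_homotopy step null s).

Record peripheral (nu : nat) := Peripheral {
  corner : 'I_nu * 'I_4;
  mer : word;
  lon : word }.

Section Ends.
Variables (nu : nat) (T : triangulation nu).
Implicit Type e : peripheral nu.

Definition link_loop (c : 'I_nu * 'I_4) (w : word) : Prop :=
  link_path T c w /\ foldl (corner_step T) c w = c.

Definition slope_word e (p q : int) : word :=
  word_exp T (corner e).1 (mer e) p ++ word_exp T (corner e).1 (lon e) q.

(* The loop [w], based at the end of the path [p] starting at [t], carried
   back to [t]. *)
Definition based_loop (t : 'I_nu) (p w : word) : word :=
  p ++ w ++ rev_word T t p.

(* The fundamental group of the link is free abelian with basis [mer], [lon];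
   equivalently the link is a torus and [mer], [lon] generate its first
   homology. *)
Definition meridian_longitude e : Prop :=
  let c := corner e in
  let eqv := homotopic (corner_step T) (null_link T) c in
  [/\ link_loop c (mer e), link_loop c (lon e),
      eqv (mer e ++ lon e) (lon e ++ mer e),
      forall w, link_loop c w -> exists p q, eqv w (slope_word e p q) &
      forall p q, eqv (slope_word e p q) [::] -> p = 0 /\ q = 0].

End Ends.

(* The ends of the triangulated manifold are indexed by ['I_2 + 'I_k]: the
   first two stay cusps, and the [j]-th of the others is filled along
   [slope j]. *)
Record dehn_filling (nu k : nat) := DehnFilling {
  tri :> triangulation nu;
  ends : 'I_2 + 'I_k -> peripheral nu;
  slope : 'I_k -> int * int;
  ends_torus : forall e, meridian_longitude tri (ends e);
  ends_all : forall c : 'I_nu * 'I_4, exists! e,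
    exists2 w, link_path tri (corner (ends e)) w &
               foldl (corner_step tri) (corner (ends e)) w = c;
  slope_coprime : forall j, coprimez (slope j).1 (slope j).2 }.

Section Geometry.
Variable R : realType.
(* [R[i]^o] is [R[i]] seen as a normed module over itself, which gives it its
   topology. *)
Local Notation C := (R[i]^o).

(* The tetrahedron of shape [z] has its vertices 0, 1, 2, 3 at
   oo, 0, 1, z, given here in homogeneous coordinates. *)
Definition ideal_vertex (z : C) (v : 'I_4) : 'cV[C]_2 :=
  \col_(i < 2) nth 0 (nth [::] [:: [:: 1; 0]; [:: 0; 1]; [:: 1; 1]; [:: z; 1]] v) i.

(* The modulus attached to the edge [{a, b}] and to the opposite edge: [z] for
   01 and 23, [1 / (1 - z)] for 02 and 13, [1 - 1 / z] for 03 and 12. *)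
Definition edge_modulus (z : C) (a b : 'I_4) : C :=
  if (a + b == 3)%N then 1 - z^-1
  else if odd (a + b) then z else (1 - z)^-1.

(* Action of SL2(C) on the upper half-space [{(x, y, t) | 0 < t}]
   (Poincare extension). *)
Definition half_space_act (g : 'M[C]_2) (x : R * R * R) : R * R * R :=
  let a := g 0 0 in let b := g 0 1 in let c := g 1 0 in let d := g 1 1 in
  let zeta : C := x.1.1 +i* x.1.2 in
  let t := x.2 in
  let sq (u : C) : R := complex.Re u ^+ 2 + complex.Im u ^+ 2 in
  let den := sq (c * zeta + d) + sq c * t ^+ 2 in
  let num := (a * zeta + b) * conjc (c * zeta + d) + a * conjc c * (t ^+ 2)%:C in
  (complex.Re num / den, complex.Im num / den, t / den).

(* Equality to 1 in PSL2(C). *)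
Definition trivial_psl (g : 'M[C]_2) : Prop := g = 1%:M \/ g = - 1%:M.

Definition parabolic (g : 'M[C]_2) : Prop :=
  ~ trivial_psl g /\ \tr g ^+ 2 = 4.

Section Holonomy.
Variables (nu k : nat) (M : dehn_filling nu k).
(* [F] selects the ends that are actually filled: [pred0] yields the
   triangulated manifold itself and [predT] the filled manifold. *)
Variable F : pred 'I_k.
Implicit Type z : 'rV[C]_nu.

(* [g] moves the standard copy of [nbr M t f] next to that of [t], across the
   face [f]; it is determined up to sign. *)
Definition face_pairing z (t : 'I_nu) (f : 'I_4) (g : 'M[C]_2) : Prop :=
  \det g = 1 /\
  forall v, v != f -> exists c : C,
    g *m ideal_vertex (z 0 (nbr M t f)) (glu M t f v)
      = c *: ideal_vertex (z 0 t) v.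

(* The two lifts to SL2(C) of the holonomy of a path. *)
Fixpoint holonomy z (t : 'I_nu) (w : word) (g : 'M[C]_2) : Prop :=
  if w is f :: w' then
    exists g1 g2, [/\ face_pairing z t f g1, holonomy z (nbr M t f) w' g2 &
                      g = g1 *m g2]
  else trivial_psl g.

Definition filling_word (j : 'I_k) : word :=
  slope_word M (ends M (inr j)) (slope M j).1 (slope M j).2.

Definition null_fill (t : 'I_nu) (r : word) : Prop :=
  null_tri M t r \/
  exists2 j, F j & t = (corner (ends M (inr j))).1 /\ r = filling_word j.

(* The gluing consistency relations: around the edges, and along the
   meridians of the attached solid tori. *)
Definition gluing_variety : set 'rV[C]_nu :=
  [set z : 'rV[C]_nu | [/\ forall t, z 0 t != 0 /\ z 0 t != 1,
      forall s : 'I_nu * 'I_4 * 'I_4, s.1.2 != s.2 ->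
        \prod_(e <- fingraph.orbit (around M) s) edge_modulus (z 0 e.1.1) e.1.2 e.2 = 1 &
      forall j, F j ->
        holonomy z (corner (ends M (inr j))).1 (filling_word j) 1%:M]].

Definition loop (t : 'I_nu) (w : word) : Prop := foldl (nbr M) t w = t.

(* The homotopy classes of loops at [t] form the fundamental group. *)
Definition loop_homotopic (t : 'I_nu) : word -> word -> Prop :=
  homotopic (nbr M) null_fill t.

Definition holonomy_group z (t : 'I_nu) : set 'M[C]_2 :=
  [set g | exists2 w, loop t w & holonomy z t w g].

Definition unfilled (e : 'I_2 + 'I_k) : bool :=
  if e is inr j then ~~ F j else true.

(* [z] is the shape of a complete hyperbolic structure of finite volume whose
   cusps are the unfilled ends: its holonomy is an isomorphism from the
   fundamental group onto a discrete torsion-free subgroup of PSL2(C) of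
   finite covolume, the unfilled ends giving parabolic subgroups of rank
   two. *)
Definition complete_structure z (t : 'I_nu) : Prop :=
  [/\ gluing_variety z,
      forall w, loop t w -> holonomy z t w 1%:M -> loop_homotopic t w [::],
      (\forall g \near (1%:M : 'M[C]_2), holonomy_group z t g -> g = 1%:M) /\
      (forall g n, holonomy_group z t g -> trivial_psl (g ^+ n.+1) ->
         trivial_psl g),
      exists D : set (R * R * R),
        [/\ measurable D, D `<=` [set x | 0 < x.2],
            forall x, 0 < x.2 -> exists g y,
              [/\ holonomy_group z t g, D y & x = half_space_act g y] &
            (\int[(@lebesgue_measure R \x @lebesgue_measure R)
                  \x @lebesgue_measure R]_(x in D) (x.2 ^- 3)%:E < +oo)%E] &
      forall e p q g, unfilled e -> (p, q) <> (0, 0) ->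
        holonomy z (corner (ends M e)).1 (slope_word M (ends M e) p q) g ->
        parabolic g].

(* [r] is a representation of the fundamental group in SL2(C) lifting the
   holonomy of [z]. *)
Definition holonomy_lift z (t : 'I_nu) (r : word -> 'M[C]_2) : Prop :=
  [/\ forall u v, loop t u -> loop t v -> r (u ++ v) = r u *m r v,
      forall u v, loop t u -> loop t v -> loop_homotopic t u v -> r u = r v &
      forall u, loop t u -> holonomy z t u (r u)].

End Holonomy.

Definition holomorphic_embedding (n nu : nat) (V : set 'rV[C]_n)
    (f : 'rV[C]_n -> 'rV[C]_nu) : Prop :=
  [/\ open V,
      forall x, V x -> differentiable f x,
      forall x, V x -> injective ('d f x),
      {in V &, injective f} &
      forall x A, V x -> nbhs x A ->
        exists2 B, nbhs (f x) B & forall y, V y -> B (f y) -> A y].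

Definition cexp (u : C) : C :=
  (expR (complex.Re u))%:C * (cos (complex.Im u) +i* sin (complex.Im u)).

Definition principal_log (w u : C) : Prop :=
  cexp u = w /\ - pi < complex.Im u <= pi.

(* The points of [calV] where the end with eigenvalues [(m, l)] remains a
   cusp, respectively is filled along the slope [(p, q)]. *)
Definition cusp_locus (nu : nat) (calV : set 'rV[C]_nu) (m l : 'rV[C]_nu -> C)
    (z0 : 'rV[C]_nu) : set 'rV[C]_nu :=
  [set z | [/\ calV z, m z = m z0 & l z = l z0]].

Definition filled_locus (nu : nat) (calV : set 'rV[C]_nu)
    (m l : 'rV[C]_nu -> C) (z0 : 'rV[C]_nu) (p q : int) : set 'rV[C]_nu :=
  [set z | calV z /\ exists u v,
     [/\ principal_log (m z / m z0) u, principal_log (l z / l z0) v &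
         u *~ p + v *~ q = 0 +i* pi]].

(* On [S] near [z], [l] is the holomorphic function [phi] of [m]: [m] is a
   holomorphic parameter on [S] near [z], and [l = phi m]. *)
Definition local_expansion (nu : nat) (S : set 'rV[C]_nu)
    (m l : 'rV[C]_nu -> C) (z : 'rV[C]_nu) (phi : C -> C) : Prop :=
  (\forall x \near (m z : C), derivable phi x 1) /\
  exists gam : C -> 'rV[C]_nu,
    [/\ gam (m z) = z,
        \forall x \near (m z : C), differentiable gam x,
        \forall x \near (m z : C),
          [/\ S (gam x), m (gam x) = x & l (gam x) = phi x] &
        \forall z' \near z, S z' -> z' = gam (m z')].

(* Coprime pairs (p, q) with |p| + |q| -> oo. *)
Definition coprime_infty : set_system (int * int) :=
  [set A | exists N : nat, forall p q : int,
    coprimez p q -> (N <= absz p + absz q)%N -> A (p, q)].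

Global Instance coprime_infty_filter : ProperFilter coprime_infty.
Proof.
apply: Build_ProperFilter_ex.
  move=> A [N AN]; exists (1, N%:Z); apply: AN; first by rewrite /coprimez gcd1z.
  by rewrite absz_nat leq_addl.
split=> [|A B [N AN] [N' BN]|A B AB [N AN]]; first by exists 0%N.
- exists (maxn N N') => p q pq; rewrite geq_max => /andP[h1 h2].
  by split; [exact: AN | exact: BN].
- by exists N => p q pq h; apply/AB/AN.
Qed.

End Geometry.

(* Main.v *)
(* Let u and v be the logarithms of m_1 / m_1^0 and l_1 / l_1^0, and g the
   function m_2 - m_2^0.  The holonomies of the first end commute, so
   l_1 - 1 / l_1 = b (m_1 - 1 / m_1) with b continuous; hence v = tau u + o(u) near
   z^0, where tau is the cusp shape, and tau is not real because the peripheral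
   subgroup is discrete.  The filling equation p u + q v = pi i therefore reads
   u + K (v - tau u) = pi i / (p + q tau), where K = q / (p + q tau) stays bounded
   and the right-hand side tends to 0.  As v - tau u = o(u), the maps
   (u + K (v - tau u), g) are invertible on a common neighbourhood of z^0 with a
   common Lipschitz constant, as soon as (u, g) has an invertible differential;
   so the filled curves converge uniformly to the cusp curve u = 0, and Cauchy
   estimates give the convergence of all Taylor coefficients of l_2.

   If the differential of (u, g) were not invertible, then u would vanish to some
   order n > 1 along the curve g = 0, and each filled locus would meet this
   curve in several points near z^0.  But l_2 = l_2^0 on this curve, because
   l_2 - 1 / l_2 vanishes where m_2 = m_2^0, so this contradicts the uniqueness of
   the complete structure on M(p, q). *)

Require Import Defs.
From HB Require Import structures.
From Stdlib Require Import Relation_Operators.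
From mathcomp Require Import all_boot all_order all_fingroup all_algebra.
From mathcomp Require Import complex ring lra.
From mathcomp Require Import all_classical all_reals all_analysis.

Set Implicit Arguments.
Unset Strict Implicit.
Unset Printing Implicit Defensive.

Import Order.TTheory GRing.Theory Num.Theory numFieldNormedType.Exports.

Local Open Scope classical_set_scope.
Local Open Scope complex_scope.
Local Open Scope ring_scope.

(** * Complex derivatives *)

(** The data only say that [l_2] is a function of [m_2] on each locus; that [u] and [m_2] form local
    coordinates has to be won. The section [gam] of [m_2] forces a nonzero differential of [m_2],
    whence a chart [(t, y)] with [t] along its kernel. On the curve [g = 0], [u] is not identically
    0, because the cusp locus is a graph over [m_2]; so it is [t ^ n] times a unit, and so is
    [u + K (v - tau u)], with a unit whose value at 0 does not depend on [K]. If [n > 1] and [w] is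
    an n-th root of unity, [t] and [w t] carry nearly equal values, and a contraction uniform in [K]
    corrects [w t] into a second solution. Along the slopes [K] stays bounded but need not converge.
    Strict differentiability replaces convergence: [v - tau u] has zero strict differential at the
    origin, so all maps of the family share their differential there, with a common error.
    Strictness rests on the continuity of partial derivatives, hence on Cauchy estimates, derived
    here from Goursat's theorem in the coordinate [log (z - a)]. *)

Section ComplexModulus.
Variable R : realType.

Lemma half_gt0 (e : R) : 0 < e -> 0 < e / 2.
Proof. by move=> e0; rewrite divr_gt0. Qed.

Lemma div2_gt0 (e K : R) : 0 < e -> 0 < K -> 0 < e / (2 * K).
Proof. by move=> e0 K0; rewrite divr_gt0// mulr_gt0. Qed.

Local Notation C := R[i].
Implicit Types z w : C.

(* The modulus as a real number: [`|z|] lives in [R[i]]. *)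
Definition nm z : R := Normc.normc z.

Lemma normE z : `|z| = (nm z)%:C.
Proof. by []. Qed.

Lemma nmM z w : nm (z * w) = nm z * nm w.
Proof. exact: Normc.normcM. Qed.

Lemma nmV z : nm z^-1 = (nm z)^-1.
Proof. exact: Normc.normcV. Qed.

Lemma nmD z w : nm (z + w) <= nm z + nm w.
Proof. exact: le_normcD. Qed.

Lemma nmN z : nm (- z) = nm z.
Proof. exact: normcN. Qed.

Lemma nmB z w : nm (z - w) <= nm z + nm w.
Proof. by rewrite -(nmN w) nmD. Qed.

Lemma nmBC z w : nm (z - w) = nm (w - z).
Proof. by rewrite -nmN opprB. Qed.

Lemma nm0 : nm 0 = 0.
Proof. exact: Normc.normc0. Qed.

Lemma nm1 : nm 1 = 1.
Proof. exact: Normc.normc1. Qed.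

Lemma nm_ge0 z : 0 <= nm z.
Proof. by case: z => a b; rewrite /nm /= sqrtr_ge0. Qed.

Lemma nm_eq0 z : (nm z == 0) = (z == 0).
Proof.
by apply/eqP/eqP => [|->]; [exact: Normc.eq0_normc | exact: nm0].
Qed.

Lemma nm_gt0 z : (0 < nm z) = (z != 0).
Proof. by rewrite lt_def nm_ge0 andbT nm_eq0. Qed.

Lemma nmX z n : nm (z ^+ n) = nm z ^+ n.
Proof. by elim: n => [|n ih]; rewrite ?expr0 ?nm1// !exprS nmM ih. Qed.

Lemma nm_real (r : R) : nm r%:C = `|r|.
Proof. by rewrite /nm /= expr0n /= addr0 sqrtr_sqr. Qed.

Lemma nm_i : nm 'i%C = 1.
Proof. by rewrite /nm /= expr0n /= add0r expr1n sqrtr1. Qed.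

Lemma Re_le_nm z : `|complex.Re z| <= nm z.
Proof. by rewrite -lecR; exact: normc_ge_Re. Qed.

Lemma Im_le_nm z : `|complex.Im z| <= nm z.
Proof.
case: z => a b; rewrite /nm /= -sqrtr_sqr ler_sqrt ?addr_ge0 ?sqr_ge0//.
by rewrite lerDr sqr_ge0.
Qed.

Lemma nm_le_ReIm z : nm z <= `|complex.Re z| + `|complex.Im z|.
Proof.
rewrite {1}(complexE z) (le_trans (nmD _ _))// nmM nm_i mul1r !nm_real.
exact: lexx.
Qed.

Lemma nmD3 z w v : nm (z + w + v) <= nm z + nm w + nm v.
Proof. by rewrite (le_trans (nmD _ _))// lerD2r nmD. Qed.

Lemma nm_subl z w : nm z <= nm w + nm (z - w).
Proof. by rewrite -{1}(subrK w z) addrC nmD. Qed.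

Lemma nm_natr n : nm n%:R = n%:R.
Proof.
by rewrite -(rmorph_nat (real_complex R)) nm_real ger0_norm.
Qed.

Lemma Im_add z w : complex.Im (z + w) = complex.Im z + complex.Im w.
Proof. by case: z; case: w. Qed.

Lemma Re_sub z w : complex.Re (z - w) = complex.Re z - complex.Re w.
Proof. by case: z; case: w. Qed.

Lemma Im_sub z w : complex.Im (z - w) = complex.Im z - complex.Im w.
Proof. by case: z; case: w. Qed.

Lemma nm_small z : (forall e, 0 < e -> nm z <= e) -> z = 0.
Proof.
move=> h; apply/eqP; apply: contraT; rewrite -nm_gt0 => z0.
by have := h (nm z / 2) (half_gt0 z0); lra.
Qed.

(** Balls of [R[i]^o] have radii in [R[i]], where being positive includes being real; hence real
    radii suffice. *)
Lemma near_nmP (x : R[i]^o) (P : R[i] -> Prop) :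
  (\forall y \near x, P y) <->
  exists2 d : R, 0 < d & forall y, nm (y - x) < d -> P y.
Proof.
split=> [/nbhs_ballP [[d dI] /=]|[d d0 h]].
  rewrite ltcE /= => /andP[/eqP -> d0] h; exists d => // y xy; apply: h.
  by rewrite /ball /= normE nmBC ltcR.
apply/nbhs_ballP; exists d%:C => /=; first by rewrite ltcR.
by move=> y; rewrite /ball /= normE ltcR => xy; apply: h; rewrite nmBC.
Qed.

End ComplexModulus.

Arguments nm : simpl never.

Section Derivative.
Variable R : realType.
Local Notation C := R[i].
Implicit Types (f g : C -> C) (x a b : C).

(** The division-free form of the limit: [h = 0] is no exception, and errors are added and composed
    with real constants only. *)
Definition cder f x a := forall e : R, 0 < e -> exists2 d : R, 0 < d &
  forall h, nm h < d -> nm (f (x + h) - f x - a * h) <= e * nm h.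

Lemma cderP f x a :
  cder f x a <-> is_derive (x : R[i]^o) 1 (f : R[i]^o -> R[i]^o) a.
Proof.
have qE h : h != 0 -> h^-1 * (f (h * 1 + x) - f x) - a =
    (f (x + h) - f x - a * h) / h.
  by move=> h0; rewrite mulr1 [h + x]addrC; field.
split=> H.
- have lim : (fun h : R[i]^o => h^-1 *: (f (h *: 1 + x) - f x : R[i]^o))
      @ (0 : R[i]^o)^' --> (a : R[i]^o).
    apply/cvgrPdist_le => /= -[e eI]; rewrite ltcE /= => /andP[/eqP -> e0].
    have [d d0 hd] := H _ e0.
    rewrite /dnbhs near_withinE; apply/near_nmP; exists d => // h; rewrite subr0 => hd' h0.
    rewrite normE nmBC qE// lecR nmM nmV ler_pdivrMr ?nm_gt0//.
    exact: hd.
  apply: DeriveDef; first by apply/cvg_ex; exists a.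
  exact/cvg_lim.
- move=> e e0; have [dv dE] := H.
  have : (fun h : R[i]^o => h^-1 *: (f (h *: 1 + x) - f x : R[i]^o))
      @ (0 : R[i]^o)^' --> (a : R[i]^o) by rewrite -dE; exact: dv.
  move=> /cvgrPdist_le /(_ e%:C); rewrite ltcR => /(_ e0); rewrite /dnbhs near_withinE => /near_nmP.
  move=> [d d0 hd]; exists d => // h hd'.
  have [->|h0] := eqVneq h 0; first by rewrite addr0 mulr0 !subrr nm0 mulr0.
  have := hd h; rewrite subr0 => /(_ hd' h0).
  by rewrite normE nmBC qE// lecR nmM nmV ler_pdivrMr ?nm_gt0.
Qed.

Lemma cder_cst (c : C) x : cder (fun=> c) x 0.
Proof. by apply/cderP; exact: is_derive_cst. Qed.

Lemma cder_id x : cder id x 1.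
Proof. by apply/cderP; exact: is_derive_id. Qed.

Lemma cderD f g x a b : cder f x a -> cder g x b ->
  cder (fun z => f z + g z) x (a + b).
Proof. by move=> /cderP fa /cderP gb; apply/cderP; exact: is_deriveD. Qed.

Lemma cderM f g x a b : cder f x a -> cder g x b ->
  cder (fun z => f z * g z) x (a * g x + f x * b).
Proof.
move=> ha hb; refine (proj2 (cderP _ _ _) _).
have fa := proj1 (cderP f x a) ha.
have gb := proj1 (cderP g x b) hb.
rewrite [X in is_derive _ _ _ X](_ : _ = f x *: (b : R[i]^o) + g x *: (a : R[i]^o)).
  exact: is_deriveM.
by rewrite addrC [a * _]mulrC.
Qed.

Lemma cderZ f x a (c : C) : cder f x a -> cder (fun z => c * f z) x (c * a).
Proof.
by move=> h; have := cderM (cder_cst c x) h; rewrite mul0r add0r.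
Qed.

Lemma cderN f x a : cder f x a -> cder (fun z => - f z) x (- a).
Proof. by move=> /cderP fa; apply/cderP; exact: is_deriveN. Qed.

Lemma cderB f g x a b : cder f x a -> cder g x b ->
  cder (fun z => f z - g z) x (a - b).
Proof. by move=> fa gb; apply: cderD => //; exact: cderN. Qed.

Lemma cder_cont f x a : cder f x a -> forall e : R, 0 < e ->
  exists2 d : R, 0 < d & forall y, nm (y - x) < d -> nm (f y - f x) < e.
Proof.
move=> H e e0; have [d d0 hd] := H 1 ltr01.
have na := nm_ge0 a.
exists (Num.min d (e / (2 + nm a))); first by rewrite lt_min d0 divr_gt0//; lra.
move=> y; rewrite lt_min => /andP[/hd]; rewrite [x + _]addrC subrK => h1.
rewrite ltr_pdivlMr; last lra.
move=> h2; have := nm_subl (f y - f x) (a * (y - x)); rewrite nmM => h3.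
have := nm_ge0 (y - x); nra.
Qed.

Lemma cderV f x a : f x != 0 -> cder f x a ->
  cder (fun z => (f z)^-1) x (- a / f x ^+ 2).
Proof.
move=> fx0 fa; have /cderP [dv dE] := fa.
apply/cderP; apply: DeriveDef; first exact: derivableV.
rewrite deriveV// dE /GRing.scale /=.
by rewrite mulNr mulrC -mulNr.
Qed.

Lemma cder_eq f g x a : (exists2 d : R, 0 < d &
    forall y, nm (y - x) < d -> f y = g y) -> cder f x a -> cder g x a.
Proof.
move=> [d d0 fg] H e e0; have [d' d'0 h] := H e e0.
exists (Num.min d d'); first by rewrite lt_min d0.
move=> k; rewrite lt_min => /andP[kd kd']; rewrite -!fg ?subrr ?nm0//; first exact: h.
by rewrite addrC addKr.
Qed.

Lemma cder_ext f g x a : f =1 g -> cder f x a -> cder g x a.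
Proof. by move=> fg; apply: cder_eq; exists 1. Qed.

Lemma cder_unique f x a b : cder f x a -> cder f x b -> a = b.
Proof. by move=> /cderP [_ <-] /cderP [_ <-]. Qed.

Lemma cderXn n x : cder (fun z => z ^+ n) x (n%:R * x ^+ n.-1).
Proof.
elim: n => [|n ih].
  by rewrite mul0r; apply: cder_ext (cder_cst 1 x) => z; rewrite expr0.
have := cderM (cder_id x) ih; rewrite mul1r => H.
apply: (@cder_ext (fun z => z * z ^+ n)); first by move=> z; rewrite exprS.
suff -> : n.+1%:R * x ^+ n.+1.-1 = x ^+ n + x * (n%:R * x ^+ n.-1) by [].
by case: n {ih H} => [|n]; rewrite /= ?expr0 ?exprS -?[n.+2]addn1 ?natrD; ring.
Qed.

End Derivative.

(** * Differentiability in two complex variables *)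

Section Frechet.
Variable R : realType.
Local Notation C := R[i].
Implicit Types (f g : C -> C -> C) (x y a b : C).

(** Joint differentiability survives composition with curves and charts; the existence of both
    partial derivatives alone would not. *)
Definition cder2 f x y a b := forall e : R, 0 < e -> exists2 d : R, 0 < d &
  forall h k, nm h < d -> nm k < d ->
  nm (f (x + h) (y + k) - f x y - a * h - b * k) <= e * (nm h + nm k).

Lemma cder2_cont f x y a b : cder2 f x y a b -> forall e : R, 0 < e ->
  exists2 d : R, 0 < d & forall x' y', nm (x' - x) < d -> nm (y' - y) < d ->
  nm (f x' y' - f x y) < e.
Proof.
move=> H e e0; have [d d0 hd] := H 1 ltr01.
have na := nm_ge0 a; have nb := nm_ge0 b.
exists (Num.min d (e / (2 * (2 + nm a + nm b)))).
  by rewrite lt_min d0 divr_gt0//; lra.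
move=> x' y'; rewrite !lt_min => /andP[h1 h1'] /andP[h2 h2'].
have := hd _ _ h1 h2; rewrite ![_ + (_ - _)]addrC !subrK => h3.
move: h1' h2'; rewrite !ltr_pdivlMr; try lra.
move=> h1' h2'.
have := nm_subl (f x' y' - f x y) (a * (x' - x) + b * (y' - y)).
have := nmD (a * (x' - x)) (b * (y' - y)).
rewrite opprD addrA !nmM => h4 h5.
have := nm_ge0 (x' - x); have := nm_ge0 (y' - y); nra.
Qed.

Lemma cder2_x f x y a b : cder2 f x y a b -> cder (f ^~ y) x a.
Proof.
move=> H e e0; have [d d0 hd] := H e e0; exists d => // h hh.
by have := hd h 0 hh; rewrite nm0 !addr0 mulr0 subr0; exact.
Qed.

Lemma cder2_y f x y a b : cder2 f x y a b -> cder (f x) y b.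
Proof.
move=> H e e0; have [d d0 hd] := H e e0; exists d => // k hk.
by have := hd 0 k; rewrite nm0 !addr0 mulr0 subr0 add0r; exact.
Qed.

Lemma cder2_fst x y : cder2 (fun x _ => x) x y 1 0.
Proof.
move=> e e0; exists 1 => // h k _ _.
rewrite (_ : _ - _ = 0) ?nm0; last by ring.
by rewrite mulr_ge0 ?addr_ge0 ?nm_ge0// ltW.
Qed.

Lemma cder2_snd x y : cder2 (fun _ y => y) x y 0 1.
Proof.
move=> e e0; exists 1 => // h k _ _.
rewrite (_ : _ - _ = 0) ?nm0; last by ring.
by rewrite mulr_ge0 ?addr_ge0 ?nm_ge0// ltW.
Qed.

Lemma cder2D f g x y a b a' b' : cder2 f x y a b -> cder2 g x y a' b' ->
  cder2 (fun x y => f x y + g x y) x y (a + a') (b + b').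
Proof.
move=> F G e e0.
have [d d0 hd] := F (e / 2) (half_gt0 e0).
have [d' d'0 hd'] := G (e / 2) (half_gt0 e0).
exists (Num.min d d'); first by rewrite lt_min d0.
move=> h k; rewrite !lt_min => /andP[h1 h2] /andP[k1 k2].
have := hd _ _ h1 k1; have := hd' _ _ h2 k2.
set u := (X in nm X <= _ -> _) => hu; set v := (X in nm X <= _ -> _) => hv.
rewrite (_ : _ - _ = u + v); last by rewrite /u /v; ring.
have := nmD u v; lra.
Qed.

Lemma cder2_cst c x y : cder2 (fun _ _ => c) x y 0 0.
Proof.
move=> e e0; exists 1 => // h k _ _.
rewrite (_ : _ - _ = 0) ?nm0; last by ring.
by rewrite mulr_ge0 ?addr_ge0 ?nm_ge0// ltW.
Qed.

Lemma cder2_comp (F : C -> C) f x y a b c : cder2 f x y a b -> cder F (f x y) c ->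
  cder2 (fun x y => F (f x y)) x y (c * a) (c * b).
Proof.
move=> H1 H2 e e0.
have na := nm_ge0 a; have nb := nm_ge0 b; have nc := nm_ge0 c.
(* [K] is a local Lipschitz constant of [f], valid once the error factor of [f] is at most 1; hence
   the minimum with 1 below. *)
pose K := 1 + nm a + nm b.
have K0 : 0 < K by rewrite /K; lra.
have [d d0 hd] := H2 (e / (2 * K)) (div2_gt0 e0 K0).
have e10 : 0 < Num.min 1 (e / (2 * (1 + nm c))).
  by rewrite lt_min ltr01 div2_gt0//; lra.
have [d1 d10 hd1] := H1 _ e10.
have [d2 d20 hd2] := cder2_cont H1 d0.
exists (Num.min d1 d2); first by rewrite lt_min d10.
move=> h k; rewrite !lt_min => /andP[h1 h2] /andP[k1 k2].
have := hd2 (x + h) (y + k); rewrite ![_ + _ - _]addrC !addKr => /(_ h2 k2) /hd.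
rewrite [f x y + _]addrC subrK.
set D := f (x + h) (y + k) - f x y => hF.
have := hd1 _ _ h1 k1; rewrite -/D => hD.
have nh := nm_ge0 h; have nk := nm_ge0 k.
have DK : nm D <= K * (nm h + nm k).
  have := nm_subl D (a * h + b * k); rewrite opprD addrA.
  have := nmD (a * h) (b * k); rewrite !nmM => q1 q2.
  have : Num.min 1 (e / (2 * (1 + nm c))) <= 1 by rewrite ge_min lexx.
  rewrite /K; nra.
rewrite [X in nm X <= _](_ : _ = (F (f (x + h) (y + k)) - F (f x y) - c * D) +
   c * (D - a * h - b * k)); last by rewrite /D; ring.
apply: (le_trans (nmD _ _)); rewrite nmM.
have q1 : nm c * nm (D - a * h - b * k) <= e / 2 * (nm h + nm k).
  apply: (@le_trans _ _ ((1 + nm c) * (e / (2 * (1 + nm c)) * (nm h + nm k)))).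
    apply: ler_pM; rewrite ?nm_ge0//; first lra.
    by apply: (le_trans hD); rewrite ler_wpM2r ?addr_ge0// ge_min lexx orbT.
  by rewrite le_eqVlt; apply/orP; left; apply/eqP; field; lra.
have q2 : e / (2 * K) * nm D <= e / 2 * (nm h + nm k).
  apply: (@le_trans _ _ (e / (2 * K) * (K * (nm h + nm k)))).
    by rewrite ler_wpM2l// divr_ge0//; lra.
  by rewrite le_eqVlt; apply/orP; left; apply/eqP; field; lra.
lra.
Qed.

Lemma cder2Z c f x y a b : cder2 f x y a b ->
  cder2 (fun x y => c * f x y) x y (c * a) (c * b).
Proof.
move=> H; apply: (cder2_comp (F := fun z => c * z)) => //.
by have := cderZ c (cder_id (f x y)); rewrite mulr1.
Qed.

Lemma cder2B f g x y a b a' b' : cder2 f x y a b -> cder2 g x y a' b' ->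
  cder2 (fun x y => f x y - g x y) x y (a - a') (b - b').
Proof.
move=> F G; have := cder2D F (cder2Z (-1) G); rewrite !mulN1r.
by congr cder2; apply/funext => u; apply/funext => v; rewrite mulN1r.
Qed.

Lemma cder2_curve f (p q : C -> C) t a b p' q' : cder2 f (p t) (q t) a b ->
  cder p t p' -> cder q t q' -> cder (fun t => f (p t) (q t)) t (a * p' + b * q').
Proof.
move=> H P Q e e0.
have na := nm_ge0 a; have nb := nm_ge0 b.
have np := nm_ge0 p'; have nq := nm_ge0 q'.
pose K := 2 + nm p' + nm q'.
have K0 : 0 < K by rewrite /K; lra.
have [d d0 hd] := H (e / (2 * K)) (div2_gt0 e0 K0).
pose e1 := Num.min 1 (e / (2 * (1 + nm a + nm b))).
have e10 : 0 < e1 by rewrite lt_min ltr01 divr_gt0//; lra.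
have e11 : e1 <= 1 by rewrite ge_min lexx.
have [d1 d10 hd1] := P _ e10.
have [d2 d20 hd2] := Q _ e10.
have [d3 d30 hd3] := cder_cont P d0.
have [d4 d40 hd4] := cder_cont Q d0.
exists (Num.min (Num.min d1 d2) (Num.min d3 d4)); first by rewrite !lt_min d10 d20 d30.
move=> h; rewrite !lt_min => /andP[/andP[h1 h2] /andP[h3 h4]].
have := hd (p (t + h) - p t) (q (t + h) - q t).
have tE : t + h - t = h by ring.
move=> /(_ (hd3 _ _) (hd4 _ _)); rewrite !tE => /(_ h3 h4).
rewrite ![_ t + (_ - _)]addrC !subrK.
have := hd1 _ h1; have := hd2 _ h2.
set dp := p (t + h) - p t; set dq := q (t + h) - q t => hq hp hf.
have nh := nm_ge0 h.
have p1 : nm dp <= (1 + nm p') * nm h.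
  by have := nm_subl dp (p' * h); rewrite nmM; nra.
have q1 : nm dq <= (1 + nm q') * nm h.
  by have := nm_subl dq (q' * h); rewrite nmM; nra.
set rf := f _ _ - _ - _ - _ in hf.
rewrite [X in nm X <= _](_ : _ = rf + a * (dp - p' * h) + b * (dq - q' * h)); last first.
  by rewrite /rf /dp /dq; ring.
apply: (le_trans (nmD3 _ _ _)); rewrite !nmM.
have s1 : nm rf <= e / 2 * nm h.
  apply: (le_trans hf).
  apply: (@le_trans _ _ (e / (2 * K) * (K * nm h))).
    by rewrite ler_wpM2l ?divr_ge0//; rewrite /K; [lra|lra|nra].
  by rewrite le_eqVlt; apply/orP; left; apply/eqP; field; lra.
have s2 : (nm a + nm b) * (e1 * nm h) <= e / 2 * nm h.
  rewrite mulrA ler_wpM2r//.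
  apply: (@le_trans _ _ ((1 + nm a + nm b) * (e / (2 * (1 + nm a + nm b))))).
    by apply: ler_pM; [lra|exact: ltW|lra|rewrite ge_min lexx orbT].
  by rewrite le_eqVlt; apply/orP; left; apply/eqP; field; lra.
nra.
Qed.

Lemma cder_comp (f g : C -> C) x a b : cder g x b -> cder f (g x) a ->
  cder (fun z => f (g z)) x (a * b).
Proof.
move=> G F.
(* [f] is read as a function of two variables that ignores the second. *)
have F2 : cder2 (fun z _ => f z) (g x) x (a * 1) (a * 0).
  by apply: (cder2_comp (f := fun z _ => z)) => //; exact: cder2_fst.
by have := cder2_curve F2 G (cder_id x); rewrite !mulr1 mulr0 addr0.
Qed.

End Frechet.

(** * Complex integration of functions of a real variable *)

Section RealVariable.
Variable R : realType.
Local Notation C := R[i].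
Local Notation mu := (@lebesgue_measure R).

Lemma is_derive_epsP (F : R -> R) (x a : R) :
  (forall e : R, 0 < e -> exists2 d : R, 0 < d &
    forall k, `|k| < d -> `|F (x + k) - F x - k * a| <= e * `|k|) <->
  is_derive x 1 F a.
Proof.
have qE h : h != 0 -> h^-1 * (F (h * 1 + x) - F x) - a =
    (F (x + h) - F x - h * a) / h.
  by move=> h0; rewrite mulr1 [h + x]addrC; field.
split=> H.
- have lim : (fun h : R => h^-1 *: (F (h *: 1 + x) - F x : R)) @ (0 : R)^' --> a.
    apply/cvgrPdist_le => /= e e0.
    have [d d0 hd] := H _ e0.
    rewrite /dnbhs near_withinE; apply/nbhs_ballP; exists d => //= h.
    rewrite /ball /= sub0r normrN => hd' h0.
    rewrite distrC qE// normrM normfV ler_pdivrMr ?normr_gt0//.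
    exact: hd.
  apply: DeriveDef; first by apply/cvg_ex; exists a.
  exact/cvg_lim.
- move=> e e0; have [dv dE] := H.
  have : (fun h : R => h^-1 *: (F (h *: 1 + x) - F x : R)) @ (0 : R)^' --> a.
    by rewrite -dE; exact: dv.
  move=> /cvgrPdist_le /(_ e e0); rewrite /dnbhs near_withinE => /nbhs_ballP.
  move=> [d /= d0 hd]; exists d => // h hd'.
  have [->|h0] := eqVneq h 0; first by rewrite addr0 mul0r !subrr normr0 mulr0.
  have := hd h; rewrite /ball /= sub0r normrN => /(_ hd' h0).
  by rewrite distrC qE// normrM normfV ler_pdivrMr ?normr_gt0.
Qed.

(** The fundamental theorem is applied on segments. Subtracting the value at 0 makes the primitive
    independent of the left end, which may therefore move with [x]. *)
Lemma real_primitive (f : R -> R) : continuous f ->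
  exists F : R -> R, forall x : R, is_derive x 1 F (f x).
Proof.
move=> cf.
have fi a b : mu.-integrable `[a, b] (EFin \o f).
  apply: continuous_compact_integrable; first exact: segment_compact.
  by apply: continuous_subspaceT => x; exact: cf.
pose G (c x : R) := (\int[mu]_(t in `[c, x]) f t)%R.
have GE c d x y : c <= d -> d <= x -> d <= y -> G c x - G c y = G d x - G d y.
  move=> cd dx dy.
  have key c' x' : c' <= d -> d <= x' ->
      G c' x' - G c' d = (\int[mu]_(t in `]d, x']) f t)%R.
    by move=> ? ?; apply: Rintegral_itvB; [exact: fi|rewrite bnd_simp|rewrite bnd_simp].
  have := key c x cd dx; have := key c y cd dy.
  have := key d x (lexx _) dx; have := key d y (lexx _) dy; lra.
pose F x := G (- (`|x| + 1)) x - G (- (`|x| + 1)) 0.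
have FE c x : c <= - (`|x| + 1) -> F x = G c x - G c 0.
  move=> h; rewrite (GE _ (- (`|x| + 1)))//.
    by have := ler_norm (- x); rewrite normrN; lra.
exists F => x.
(* One less than the left end used in [F x], so that the same [c] serves for every [x + k] with [k]
   smaller than 1. *)
pose c := - (`|x| + 2).
have ltcx : c < x by rewrite /c; have := ler_norm (- x); rewrite normrN; lra.
have [dG G'] := @continuous_FTC1_closed _ f c x (x + 1) ltac:(by rewrite ltrDl) (fi _ _) ltcx (cf x).
have dGx : is_derive x 1 (G c) (f x).
  by apply: DeriveDef; [exact: dG | rewrite -derive1E G'].
apply/is_derive_epsP => e e0.
have [d d0 hd] := proj2 (is_derive_epsP _ _ _) dGx _ e0.
exists (Num.min d 1); first by rewrite lt_min d0 ltr01.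
move=> k; rewrite lt_min => /andP[kd k1].
rewrite (FE c (x + k)); last by have := ler_normD x k; rewrite /c; lra.
rewrite (FE c x); last by rewrite /c; lra.
have := hd _ kd; congr (`| _ | <= _); ring.
Qed.

Definition rcont (h : R -> C) := forall x (e : R), 0 < e ->
  exists2 d : R, 0 < d & forall y, `|y - x| < d -> nm (h y - h x) < e.

Definition rder (H : R -> C) (x : R) (a : C) := forall e : R, 0 < e ->
  exists2 d : R, 0 < d & forall k : R, `|k| < d ->
    nm (H (x + k) - H x - k%:C * a) <= e * `|k|.

Lemma rder_proj (H : R -> C) x a (c : C) : rder H x a ->
  is_derive x 1 (fun t => complex.Re (c * H t)) (complex.Re (c * a)).
Proof.
move=> hH; apply/is_derive_epsP => e e0.
have nc := nm_ge0 c.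
have [d d0 hd] := hH (e / (1 + nm c)) (divr_gt0 e0 (ltr_wpDr nc ltr01)).
exists d => // k kd; have := hd _ kd => hk.
apply: (@le_trans _ _ (nm (c * (H (x + k) - H x - k%:C * a)))).
  apply: le_trans (Re_le_nm _); rewrite le_eqVlt; apply/orP; left; apply/eqP.
  congr (`| _ |); case: c {hd hk nc} => c1 c2; case: (H (x + k)) => u1 u2.
  by case: (H x) => v1 v2; case: a {hH} => a1 a2 /=; ring.
rewrite nmM; apply: (@le_trans _ _ ((1 + nm c) * (e / (1 + nm c) * `|k|))).
  by apply: ler_pM; rewrite ?nm_ge0//; lra.
by rewrite le_eqVlt; apply/orP; left; apply/eqP; field; lra.
Qed.

(** The mean value theorem holds for real values only; it is applied to the real part of
    [conjc D * H], where [D] is the total increment, and whose own increment is [nm D ^+ 2]. *)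
Lemma rder_mean (H : R -> C) (h : R -> C) (a b M : R) : a <= b ->
  (forall x, a <= x <= b -> rder H x (h x)) ->
  (forall x, a <= x <= b -> nm (h x) <= M) ->
  nm (H b - H a) <= M * (b - a).
Proof.
move=> ab dH hM; set D := H b - H a.
pose f t := complex.Re (conjc D * H t).
have nJ z : nm (conjc z) = nm z.
  by apply: complexI; rewrite -!normE normcJ.
have df x : a <= x <= b -> is_derive x 1 f (complex.Re (conjc D * h x)).
  by move=> xab; apply: rder_proj; exact: dH.
have [||c cab fE] := @MVT_segment _ f (fun x => complex.Re (conjc D * h x)) a b ab.
- by move=> x; rewrite in_itv /= => /andP[ax xb]; apply: df; rewrite !ltW.
- apply: derivable_within_continuous => x; rewrite in_itv /= => xab.
  by have [] := df x xab.
have DE : f b - f a = nm D ^+ 2.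
  rewrite /f -Re_sub -mulrBr -/D mulrC.
  have := add_Re2_Im2 D; rewrite normE -rmorphXn => /complexI <-.
  by case: (D) => u v /=; ring.
have cb : nm (h c) <= M by apply: hM; move: cab; rewrite in_itv.
have : nm D ^+ 2 <= nm D * M * (b - a).
  rewrite -DE fE ler_wpM2r ?subr_ge0//.
  apply: (le_trans (ler_norm _)); apply: (le_trans (Re_le_nm _)).
  by rewrite nmM nJ ler_wpM2l ?nm_ge0.
have [->|D0] := eqVneq (nm D) 0.
  by move=> _; rewrite mulr_ge0 ?subr_ge0// (le_trans _ cb)// nm_ge0.
by rewrite expr2 -mulrA ler_pM2l// lt_def D0 nm_ge0.
Qed.

Lemma rderD H1 H2 x a b : rder H1 x a -> rder H2 x b ->
  rder (fun t => H1 t + H2 t) x (a + b).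
Proof.
move=> F G e e0.
have [d d0 hd] := F (e / 2) (half_gt0 e0).
have [d' d'0 hd'] := G (e / 2) (half_gt0 e0).
exists (Num.min d d'); first by rewrite lt_min d0.
move=> k; rewrite lt_min => /andP[k1 k2].
have := hd _ k1; have := hd' _ k2.
set u := (X in nm X <= _ -> _) => hu; set v := (X in nm X <= _ -> _) => hv.
rewrite (_ : _ - _ = u + v); last by rewrite /u /v; ring.
have := nmD u v; lra.
Qed.

Lemma rderZ H x a c : rder H x a -> rder (fun t => c * H t) x (c * a).
Proof.
move=> F e e0; have nc := nm_ge0 c.
have [d d0 hd] := F (e / (1 + nm c)) (divr_gt0 e0 (ltr_wpDr nc ltr01)).
exists d => // k kd; have := hd _ kd => hk.
rewrite (_ : _ - _ = c * (H (x + k) - H x - k%:C * a)); last by ring.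
rewrite nmM; apply: (@le_trans _ _ ((1 + nm c) * (e / (1 + nm c) * `|k|))).
  by apply: ler_pM; rewrite ?nm_ge0//; lra.
by rewrite le_eqVlt; apply/orP; left; apply/eqP; field; lra.
Qed.

Definition prim (h H : R -> C) := forall x, rder H x (h x).

Lemma ex_prim h : rcont h -> exists H, prim h H.
Proof.
move=> ch.
have cRe : continuous (fun t => complex.Re (h t)).
  move=> x; apply/cvgrPdist_lt => e e0; have [d d0 hd] := ch x e e0.
  apply/nbhs_ballP; exists d => //= y; rewrite /ball /= distrC => /hd.
  by apply: le_lt_trans; rewrite nmBC -Re_sub; exact: Re_le_nm.
have cIm : continuous (fun t => complex.Im (h t)).
  move=> x; apply/cvgrPdist_lt => e e0; have [d d0 hd] := ch x e e0.
  apply/nbhs_ballP; exists d => //= y; rewrite /ball /= distrC => /hd.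
  by apply: le_lt_trans; rewrite nmBC -Im_sub; exact: Im_le_nm.
have [F hF] := real_primitive cRe; have [G hG] := real_primitive cIm.
exists (fun t => F t +i* G t) => x e e0.
have [d d0 hd] := proj2 (is_derive_epsP _ _ _) (hF x) _ (half_gt0 e0).
have [d' d'0 hd'] := proj2 (is_derive_epsP _ _ _) (hG x) _ (half_gt0 e0).
exists (Num.min d d'); first by rewrite lt_min d0.
move=> k; rewrite lt_min => /andP[/hd h1 /hd' h2].
apply: (le_trans (nm_le_ReIm _)).
move: h1 h2; case: (h x) => u v /=; rewrite !mul0r subr0 addr0; lra.
Qed.

(* Read off a primitive; [0] when [h] has none. *)
Definition cint (h : R -> C) (a b : R) : C :=
  let H := xget (fun=> 0) [set H | prim h H] in H b - H a.

Lemma prim_unique h H1 H2 a b : prim h H1 -> prim h H2 -> a <= b ->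
  H1 b - H1 a = H2 b - H2 a.
Proof.
move=> h1 h2 ab.
pose D t := H1 t + (-1) * H2 t.
have : nm (D b - D a) <= 0 * (b - a).
  apply: (@rder_mean D (fun x => h x + (-1) * h x)) => // x _.
    by apply: rderD; [exact: h1|apply: rderZ; exact: h2].
  by rewrite mulN1r subrr nm0.
rewrite mul0r => h0; have : nm (D b - D a) == 0.
  by rewrite eq_le h0 nm_ge0.
rewrite nm_eq0 /D !mulN1r => /eqP h3; apply/eqP; rewrite -subr_eq0; apply/eqP.
by rewrite -[RHS]h3; ring.
Qed.

Lemma cintE h H a b : prim h H -> cint h a b = H b - H a.
Proof.
move=> hH; rewrite /cint; case: xgetP => [G _ hG|/(_ H)]; last by [].
have [ab|/ltW ba] := leP a b; first exact: prim_unique hG hH ab.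
by apply: oppr_inj; rewrite !opprB; exact: prim_unique hG hH ba.
Qed.

Lemma cintZ h c a b : rcont h -> cint (fun t => c * h t) a b = c * cint h a b.
Proof.
move=> /ex_prim[H1 p1]; rewrite (cintE a b p1) (@cintE _ (fun t => c * H1 t)).
  by ring.
by move=> x; exact: rderZ.
Qed.

Lemma cintB h1 h2 a b : rcont h1 -> rcont h2 ->
  cint (fun t => h1 t - h2 t) a b = cint h1 a b - cint h2 a b.
Proof.
move=> /ex_prim[H1 p1] /ex_prim[H2 p2].
rewrite (cintE a b p1) (cintE a b p2) (@cintE _ (fun t => H1 t + (-1) * H2 t)).
  by ring.
move=> x; rewrite (_ : h1 x - h2 x = h1 x + (-1) * h2 x); last by rewrite mulN1r.
by apply: rderD; [exact: p1|apply: rderZ; exact: p2].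
Qed.

Lemma cint_cat h a b c : cint h a b + cint h b c = cint h a c.
Proof. by rewrite /cint; ring. Qed.

Lemma cint_cst c a b : cint (fun=> c) a b = (b - a)%:C * c.
Proof.
rewrite (@cintE _ (fun t => t%:C * c)); first by rewrite rmorphB /=; ring.
move=> x e e0; exists 1 => // k _.
have -> : (x + k)%:C * c - x%:C * c - k%:C * c = 0 by rewrite rmorphD; ring.
by rewrite nm0 mulr_ge0// ltW.
Qed.

Lemma cint_le h a b M : rcont h -> a <= b ->
  (forall x, a <= x <= b -> nm (h x) <= M) -> nm (cint h a b) <= M * (b - a).
Proof.
move=> /ex_prim[H p] ab hM; rewrite (cintE a b p).
by apply: (rder_mean ab _ hM) => x _.
Qed.

Lemma eq_cint h1 h2 a b : h1 =1 h2 -> cint h1 a b = cint h2 a b.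
Proof. by move=> /funext ->. Qed.

Lemma rcont_cst c : rcont (fun=> c).
Proof. by move=> x e e0; exists 1 => // y _; rewrite subrr nm0. Qed.

Lemma rcontD h1 h2 : rcont h1 -> rcont h2 -> rcont (fun t => h1 t + h2 t).
Proof.
move=> c1 c2 x e e0.
have [d d0 hd] := c1 x _ (half_gt0 e0); have [d' d'0 hd'] := c2 x _ (half_gt0 e0).
exists (Num.min d d'); first by rewrite lt_min d0.
move=> y; rewrite lt_min => /andP[/hd h /hd' h'].
rewrite (_ : _ - _ = h1 y - h1 x + (h2 y - h2 x)); last by ring.
have := nmD (h1 y - h1 x) (h2 y - h2 x); lra.
Qed.

Lemma rcontM h1 h2 : rcont h1 -> rcont h2 -> rcont (fun t => h1 t * h2 t).
Proof.
move=> c1 c2 x e e0.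
have n1 := nm_ge0 (h1 x); have n2 := nm_ge0 (h2 x).
pose K := 1 + nm (h1 x) + nm (h2 x).
have K0 : 0 < K by rewrite /K; lra.
have e1 : 0 < Num.min 1 (e / (2 * K)) by rewrite lt_min ltr01 div2_gt0.
have [d d0 hd] := c1 x _ e1; have [d' d'0 hd'] := c2 x _ e1.
exists (Num.min d d'); first by rewrite lt_min d0.
move=> y; rewrite lt_min => /andP[/hd + /hd' +].
rewrite !lt_min => /andP[a1 a2] /andP[b1 b2].
rewrite (_ : _ - _ = (h1 y - h1 x) * (h2 y - h2 x) + (h1 y - h1 x) * h2 x +
   h1 x * (h2 y - h2 x)); last by ring.
apply: (le_lt_trans (nmD3 _ _ _)); rewrite !nmM.
move: a2 b2; rewrite !ltr_pdivlMr ?mulr_gt0// /K.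
have := nm_ge0 (h1 y - h1 x); have := nm_ge0 (h2 y - h2 x); nra.
Qed.

Lemma rcontZ c h : rcont h -> rcont (fun t => c * h t).
Proof. by move=> H; apply: rcontM => //; exact: rcont_cst. Qed.

Lemma rcontB h1 h2 : rcont h1 -> rcont h2 -> rcont (fun t => h1 t - h2 t).
Proof.
move=> c1 c2; have := rcontD c1 (rcontZ (-1) c2).
by congr rcont; apply/funext => t; rewrite mulN1r.
Qed.

End RealVariable.

(** * Cauchy theory *)

Section Goursat.
Variable R : realType.
Local Notation C := R[i].

Lemma exp2_bound (K d : R) : 0 < d -> exists n, K / 2 ^+ n < d.
Proof.
move=> d0; pose n := Num.bound `|K / d|.
exists n; have p2 : 0 < (2 : R) ^+ n by rewrite exprn_gt0.
rewrite ltr_pdivrMr//.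
have h : K / d < n%:R.
  by apply: le_lt_trans (ler_norm _) _; exact: archi_boundP (normr_ge0 _).
move: h; rewrite ltr_pdivrMr// => h; apply: (lt_le_trans h).
rewrite mulrC ler_wpM2l ?(ltW d0)// -natrX ler_nat.
by apply: ltnW; exact: ltn_expl.
Qed.

(** Left ends increase and right ends decrease; the common point is the supremum of the left
    ends. *)
Lemma nested_limit (u : nat -> R) (v : R) : 0 <= v ->
  (forall n, u n <= u n.+1 /\ u n.+1 + v / 2 ^+ n.+1 <= u n + v / 2 ^+ n) ->
  exists X, forall n, u n <= X <= u n + v / 2 ^+ n.
Proof.
move=> v0 hu.
have mono n k : u n <= u (n + k)%N /\ u (n + k)%N + v / 2 ^+ (n + k) <= u n + v / 2 ^+ n.
  elim: k => [|k [ih1 ih2]]; first by rewrite addn0.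
  by rewrite addnS; have [h1 h2] := hu (n + k)%N; split; lra.
have pos n : 0 <= v / 2 ^+ n by rewrite divr_ge0// exprn_ge0.
have ub n : ubound (range u) (u n + v / 2 ^+ n).
  move=> _ [m _ <-]; have [nm|/ltnW mn] := leqP n m.
    by have := mono n (m - n)%N; rewrite subnKC// => -[]; have := pos m; lra.
  by have := mono m (n - m)%N; rewrite subnKC// => -[]; have := pos n; lra.
have ne : range u !=set0 by exists (u 0%N), 0%N.
exists (sup (range u)) => n; apply/andP; split.
  by apply: ub_le_sup; [exists (u 0%N + v / 2 ^+ 0); exact: ub|exists n].
by apply: ge_sup => //; exact: ub.
Qed.

(** [P x y n] speaks of the rectangle with lower left corner [(x, y)] and sides [w / 2 ^ n],
    [h / 2 ^ n]; the booleans tell which of its four quarters is kept. *)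
Lemma bisection (P : R -> R -> nat -> Prop) (w h x0 y0 : R) : 0 <= w -> 0 <= h ->
  P x0 y0 0%N ->
  (forall x y n, P x y n -> exists bx by_ : bool,
     P (x + bx%:R * (w / 2 ^+ n.+1)) (y + by_%:R * (h / 2 ^+ n.+1)) n.+1) ->
  exists X Y, forall n, exists x y,
    [/\ P x y n, x <= X <= x + w / 2 ^+ n & y <= Y <= y + h / 2 ^+ n].
Proof.
move=> w0 h0 P0 PS.
(* Choice wants a total relation: where [P] fails, an arbitrary quarter is returned. *)
have [S hS] := @choice _ _ (fun (s : R * R * nat) (b : bool * bool) =>
    P s.1.1 s.1.2 s.2 ->
    P (s.1.1 + b.1%:R * (w / 2 ^+ s.2.+1))
      (s.1.2 + b.2%:R * (h / 2 ^+ s.2.+1)) s.2.+1) ltac:(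
  by move=> [[x y] n] /=; have [/PS[bx [by_ H]]|nP] := pselect (P x y n);
    [exists (bx, by_) | exists (false, false)]).
pose q := fix q n : R * R := if n is n'.+1 then
   ((q n').1 + (S (q n', n')).1%:R * (w / 2 ^+ n),
    (q n').2 + (S (q n', n')).2%:R * (h / 2 ^+ n)) else (x0, y0).
have qP n : P (q n).1 (q n).2 n by elim: n => [//|n ih]; exact: (hS (q n, n)).
have step (v : R) n (b : bool) : 0 <= v ->
    0 <= b%:R * (v / 2 ^+ n.+1) /\ b%:R * (v / 2 ^+ n.+1) + v / 2 ^+ n.+1 <= v / 2 ^+ n.
  move=> v0; have -> : v / 2 ^+ n = 2 * (v / 2 ^+ n.+1).
    by rewrite exprS; field; rewrite expf_neq0.
  have : 0 <= v / 2 ^+ n.+1 by rewrite divr_ge0// exprn_ge0.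
  by case: b; rewrite ?mul1r ?mul0r; lra.
have [n|X hX] := @nested_limit (fun n => (q n).1) w w0.
  by have [/= a1 a2] := step w n (S (q n, n)).1 w0; split => /=; lra.
have [n|Y hY] := @nested_limit (fun n => (q n).2) h h0.
  by have [/= a1 a2] := step h n (S (q n, n)).2 h0; split => /=; lra.
by exists X, Y => n; exists (q n).1, (q n).2.
Qed.

Variable F : R -> R -> C.
Hypothesis cFx : forall y, rcont (F ^~ y).
Hypothesis cFy : forall x, rcont (F x).

(** The integral of [F dz], with [z = x + i y], counterclockwise along the boundary of the
    rectangle. *)
Definition rect_int (x1 x2 y1 y2 : R) : C :=
  cint (F ^~ y1) x1 x2 - cint (F ^~ y2) x1 x2 +
  'i%C * (cint (F x2) y1 y2 - cint (F x1) y1 y2).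

Lemma rect_int_split x1 x x2 y1 y y2 :
  rect_int x1 x2 y1 y2 = rect_int x1 x y1 y + rect_int x x2 y1 y +
    rect_int x1 x y y2 + rect_int x x2 y y2.
Proof.
rewrite /rect_int -!(cint_cat _ x1 x x2) -!(cint_cat _ y1 y y2).
by ring.
Qed.

(** Complex differentiability relative to the closed rectangle. It is one-sided on the boundary, as
    the truncated function in [circ_const] requires. *)
Definition rect_der (x1 x2 y1 y2 x y : R) (a : C) := forall e : R, 0 < e ->
  exists2 d : R, 0 < d & forall x' y', x1 <= x' <= x2 -> y1 <= y' <= y2 ->
   `|x' - x| < d -> `|y' - y| < d ->
   nm (F x' y' - F x y - a * ((x' - x)%:C + 'i%C * (y' - y)%:C)) <=
     e * (`|x' - x| + `|y' - y|).

(** The affine part of [F] integrates to 0 over the closed boundary. Opposite sides are paired: this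
    part becomes a constant in each difference of integrands, and the two constants cancel. *)
Lemma rect_int_small x1 x2 y1 y2 x y a e :
  x1 <= x <= x2 -> y1 <= y <= y2 -> 0 <= e ->
  (forall x' y', x1 <= x' <= x2 -> y1 <= y' <= y2 ->
   nm (F x' y' - F x y - a * ((x' - x)%:C + 'i%C * (y' - y)%:C)) <=
     e * (`|x' - x| + `|y' - y|)) ->
  nm (rect_int x1 x2 y1 y2) <= 2 * e * (x2 - x1 + (y2 - y1)) ^+ 2.
Proof.
move=> xI yI e0 H.
have /andP[xa xb] := xI; have /andP[ya yb] := yI.
have x12 : x1 <= x2 by lra.
have y12 : y1 <= y2 by lra.
pose L := x2 - x1 + (y2 - y1).
have HL x' y' : x1 <= x' <= x2 -> y1 <= y' <= y2 ->
   nm (F x' y' - F x y - a * ((x' - x)%:C + 'i%C * (y' - y)%:C)) <= e * L.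
  move=> hx hy; apply: (le_trans (H _ _ hx hy)); rewrite ler_wpM2l//.
  move: hx hy => /andP[? ?] /andP[? ?]; rewrite /L lerD// ler_norml; lra.
have hor : nm (cint (fun s => F s y1 - F s y2 - (a * ('i%C * (y1 - y2)%:C))) x1 x2) <=
    2 * e * L * (x2 - x1).
  apply: cint_le => //.
    by apply: rcontB; [apply: rcontB; exact: cFx|exact: rcont_cst].
  move=> s hs; have h1 := HL s y1 hs ltac:(lra); have h2 := HL s y2 hs ltac:(lra).
  move: h1 h2; set u := (X in nm X <= _ -> _); set v := (X in _ -> nm X <= _ -> _).
  have -> : F s y1 - F s y2 - a * ('i%C * (y1 - y2)%:C) = u - v.
    by rewrite /u /v !rmorphB; ring.
  by have := nmB u v; lra.
have ver : nm (cint (fun t => F x2 t - F x1 t - (a * (x2 - x1)%:C)) y1 y2) <=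
    2 * e * L * (y2 - y1).
  apply: cint_le => //.
    by apply: rcontB; [apply: rcontB; exact: cFy|exact: rcont_cst].
  move=> t ht; have h1 := HL x2 t ltac:(lra) ht; have h2 := HL x1 t ltac:(lra) ht.
  move: h1 h2; set u := (X in nm X <= _ -> _); set v := (X in _ -> nm X <= _ -> _).
  have -> : F x2 t - F x1 t - a * (x2 - x1)%:C = u - v.
    by rewrite /u /v !rmorphB; ring.
  by have := nmB u v; lra.
have horE : cint (F ^~ y1) x1 x2 - cint (F ^~ y2) x1 x2 =
  cint (fun s => F s y1 - F s y2 - (a * ('i%C * (y1 - y2)%:C))) x1 x2 +
  (x2 - x1)%:C * (a * ('i%C * (y1 - y2)%:C)).
  rewrite (cintB _ _ (rcontB (cFx y1) (cFx y2)) (@rcont_cst R _)).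
  by rewrite (cintB _ _ (cFx y1) (cFx y2)) cint_cst subrK.
have verE : cint (F x2) y1 y2 - cint (F x1) y1 y2 =
  cint (fun t => F x2 t - F x1 t - (a * (x2 - x1)%:C)) y1 y2 +
  (y2 - y1)%:C * (a * (x2 - x1)%:C).
  rewrite (cintB _ _ (rcontB (cFy x2) (cFy x1)) (@rcont_cst R _)).
  by rewrite (cintB _ _ (cFy x2) (cFy x1)) cint_cst subrK.
rewrite /rect_int horE verE.
move: hor ver; set u := cint _ _ _; set v := cint _ _ _ => hu hv.
rewrite (_ : _ + _ = u + 'i%C * v); last by rewrite !rmorphB; ring.
have := nmD u ('i%C * v); rewrite nmM nm_i mul1r => huv.
apply: (le_trans huv); rewrite expr2 -/L.
by have : L = x2 - x1 + (y2 - y1) by []; nra.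
Qed.

Lemma Goursat x1 x2 y1 y2 : x1 <= x2 -> y1 <= y2 ->
  (forall x y, x1 <= x <= x2 -> y1 <= y <= y2 -> exists a, rect_der x1 x2 y1 y2 x y a) ->
  rect_int x1 x2 y1 y2 = 0.
Proof.
move=> x12 y12 dF; apply/eqP; apply: contraT; rewrite -nm_gt0 => c0.
set c := nm _ in c0.
pose w := x2 - x1; pose h := y2 - y1.
have w0 : 0 <= w by rewrite subr_ge0.
have h0 : 0 <= h by rewrite subr_ge0.
pose P x y n := [/\ x1 <= x, x + w / 2 ^+ n <= x2, y1 <= y, y + h / 2 ^+ n <= y2 &
  c / 4 ^+ n <= nm (rect_int x (x + w / 2 ^+ n) y (y + h / 2 ^+ n))].
have [||X [Y XY]] := @bisection P w h x1 y1 w0 h0.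
- rewrite /P !expr0 !divr1 /w /h ![_ + (_ - _)]addrC !subrK.
  by split; rewrite ?lexx.
- move=> x y n [a1 a2 a3 a4 a5].
  pose w' := w / 2 ^+ n.+1; pose h' := h / 2 ^+ n.+1.
  have wE : x + w / 2 ^+ n = x + w' + w' by rewrite /w' exprS; field; rewrite expf_neq0.
  have hE : y + h / 2 ^+ n = y + h' + h' by rewrite /h' exprS; field; rewrite expf_neq0.
  have w'0 : 0 <= w' by rewrite divr_ge0// exprn_ge0.
  have h'0 : 0 <= h' by rewrite divr_ge0// exprn_ge0.
  have cE : c / 4 ^+ n = 4 * (c / 4 ^+ n.+1) by rewrite exprS; field; rewrite expf_neq0.
  move: a5; rewrite (rect_int_split x (x + w') _ y (y + h')) cE.
  rewrite wE hE in a2 a4 *.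
  set A1 := rect_int _ _ _ _; set A2 := rect_int _ _ _ _.
  set A3 := rect_int _ _ _ _; set A4 := rect_int _ _ _ _ => a5.
  have b1 := nmD (A1 + A2 + A3) A4; have b2 := nmD3 A1 A2 A3.
  set c' := c / _ in a5 *.
  rewrite /P -/w' -/h' -/c'.
  have [k1|k1] := leP c' (nm A1).
    by exists false, false; rewrite !mul0r !addr0; split => //; lra.
  have [k2|k2] := leP c' (nm A2).
    by exists true, false; rewrite !mul0r !addr0 mul1r; split => //; lra.
  have [k3|k3] := leP c' (nm A3).
    by exists false, true; rewrite !mul0r !addr0 mul1r; split => //; lra.
  have k4 : c' <= nm A4 by lra.
  by exists true, true; rewrite !mul1r; split => //; lra.
have [x [y [_ hX hY]]] := XY 0%N.
have XI : x1 <= X <= x2.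
  have [x' [y' [[b1 b2 b3 b4 _] /andP[? ?] _]]] := XY 0%N; lra.
have YI : y1 <= Y <= y2.
  have [x' [y' [[b1 b2 b3 b4 _] _ /andP[? ?]]]] := XY 0%N; lra.
have [a ha] := dF X Y XI YI.
(* Affine approximation with error [c / K] bounds the n-th integral by
   [2 (w + h) ^ 2 (c / K) / 4 ^ n], which is less than [c / 4 ^ n]. *)
pose K := 4 * (w + h) ^+ 2 + 1.
have K0 : 0 < K by rewrite /K; have := sqr_ge0 (w + h); lra.
have e0 : 0 < c / K by rewrite divr_gt0.
have [d d0 hd] := ha _ e0.
have [n hn] := exp2_bound (w + h) d0.
have [x' [y' [[b1 b2 b3 b4 b5] hX' hY']]] := XY n.
move: hn hX' hY' b2 b4 b5; rewrite mulrDl.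
set w' := w / _; set h' := h / _ => hn hX' hY' b2 b4 b5.
have w'0 : 0 <= w' by rewrite divr_ge0// exprn_ge0.
have h'0 : 0 <= h' by rewrite divr_ge0// exprn_ge0.
have H u v : x' <= u <= x' + w' -> y' <= v <= y' + h' ->
    nm (F u v - F X Y - a * ((u - X)%:C + 'i%C * (v - Y)%:C)) <=
    c / K * (`|u - X| + `|v - Y|).
  move=> /andP[u1 u2] /andP[v1 v2].
  move: hX' hY' => /andP[p1 p2] /andP[q1 q2].
  by apply: hd; rewrite ?ltr_norml; lra.
have := rect_int_small hX' hY' (ltW e0) H.
have -> : x' + w' - x' + (y' + h' - y') = w' + h' by ring.
move=> /(le_trans b5).
have -> : (w' + h') ^+ 2 = (w + h) ^+ 2 / 4 ^+ n.
  have -> : (4 : R) ^+ n = 2 ^+ n ^+ 2 by rewrite -exprM mulnC exprM; congr (_ ^+ _); ring.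
  by rewrite /w' /h' -mulrDl expr_div_n.
rewrite mulrA ler_pM2r ?invr_gt0 ?exprn_gt0//.
have cq : c = c / K * K by rewrite divfK// gt_eqF.
rewrite {1}cq; set q := c / K in e0 *; have := sqr_ge0 (w + h).
by rewrite /K; nra.
Qed.

End Goursat.

(** * The complex exponential *)

Section ComplexExponential.
Variable R : realType.
Local Notation C := R[i].
Implicit Types z w : C.

Lemma cexpD z w : cexp (z + w) = cexp z * cexp w.
Proof.
case: z w => a b [c d]; rewrite /cexp /= expRD cosD sinD.
by apply/eqP; rewrite eq_complex /=; apply/andP; split; apply/eqP; ring.
Qed.

Lemma cexp0 : cexp (0 : C) = 1.
Proof. by rewrite /cexp /= expR0 cos0 sin0 mul1r. Qed.

Lemma nm_cexp z : nm (cexp z) = expR (complex.Re z).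
Proof.
rewrite /cexp nmM nm_real ger0_norm ?expR_ge0//.
by rewrite /nm /= cos2Dsin2 sqrtr1 mulr1.
Qed.

Lemma cexp_neq0 z : cexp z != 0.
Proof. by rewrite -nm_gt0 nm_cexp expR_gt0. Qed.

Lemma cexpN z : cexp (- z) = (cexp z)^-1.
Proof.
by apply: (mulfI (cexp_neq0 z)); rewrite -cexpD subrr cexp0 mulfV ?cexp_neq0.
Qed.

Lemma cexp_rect (s t : R) : cexp (s +i* t) = (expR s)%:C * cexp (0 +i* t).
Proof. by rewrite /cexp /= expR0 mul1r. Qed.

Lemma cexp_2pi (s t : R) : cexp (s +i* (t + 2 * pi)) = cexp (s +i* t).
Proof. by rewrite /cexp /= mulr_natl cosD2pi sinD2pi. Qed.

Lemma cder_cexp0 : cder (@cexp R) 0 1.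
Proof.
move=> e e0.
(* The errors below add up to [7 * e1 * N]; [e1 <= 1 / 4] bounds [1 + x] by 2. *)
have [e1 [e10 e14 e1e]] : exists e1 : R, [/\ 0 < e1, e1 <= 1 / 4 & e1 <= e / 16].
  exists (Num.min (1 / 4) (e / 16)).
  by split; rewrite ?ge_min ?lexx ?orbT// lt_min !divr_gt0.
have [d1 d10 h1] := proj2 (is_derive_epsP _ _ _) (is_derive_expR (0 : R)) _ e10.
have [d2 d20 h2] := proj2 (is_derive_epsP _ _ _) (is_derive_cos (0 : R)) _ e10.
have [d3 d30 h3] := proj2 (is_derive_epsP _ _ _) (is_derive_sin (0 : R)) _ e10.
exists (Num.min (Num.min d1 d2) (Num.min d3 e1)); first by rewrite !lt_min d10 d20 d30 e10.
move=> h; rewrite !lt_min => /andP[/andP[k1 k2] /andP[k3 k4]].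
rewrite add0r cexp0 mul1r.
have hx := Re_le_nm h; have hy := Im_le_nm h.
apply: (le_trans (nm_le_ReIm _)).
move: hx hy k1 k2 k3 k4; set N := nm h; case: h @N => x y N /= hx hy k1 k2 k3 k4.
have := h1 x (le_lt_trans hx k1); rewrite add0r expR0 mulr1 => a1.
have := h2 y (le_lt_trans hy k2); rewrite add0r cos0 sin0 oppr0 mulr0 subr0 => a2.
have := h3 y (le_lt_trans hy k3); rewrite add0r sin0 cos0 mulr1 subr0 => a3.
rewrite !mul0r !(oppr0, subr0, addr0).
have cy := cos_max y.
have nx := normr_ge0 x; have ny := normr_ge0 y.
have -> : expR x * cos y - 1 - x =
  (expR x - 1 - x) * cos y + (1 + x) * (cos y - 1) by ring.
have -> : expR x * sin y - y =
  (expR x - 1 - x) * sin y + (1 + x) * (sin y - y) + x * y by ring.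
have sy := sin_max y.
have x1 : `|1 + x| <= 2 by have := ler_normD 1 x; rewrite normr1; lra.
have t1 := ler_normD ((expR x - 1 - x) * cos y) ((1 + x) * (cos y - 1)).
have t2 := ler_normD ((expR x - 1 - x) * sin y + (1 + x) * (sin y - y)) (x * y).
have t3 := ler_normD ((expR x - 1 - x) * sin y) ((1 + x) * (sin y - y)).
move: t1 t2 t3; rewrite !normrM.
have p1 : `|expR x - 1 - x| * `|cos y| <= e1 * N * 1.
  by apply: ler_pM => //; apply: (le_trans a1); rewrite ler_wpM2l// ltW.
have p2 : `|expR x - 1 - x| * `|sin y| <= e1 * N * 1.
  by apply: ler_pM => //; apply: (le_trans a1); rewrite ler_wpM2l// ltW.
have p3 : `|1 + x| * `|cos y - 1| <= 2 * (e1 * N).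
  by apply: ler_pM => //; apply: (le_trans a2); rewrite ler_wpM2l// ltW.
have p4 : `|1 + x| * `|sin y - y| <= 2 * (e1 * N).
  by apply: ler_pM => //; apply: (le_trans a3); rewrite ler_wpM2l// ltW.
have p5 : `|x| * `|y| <= e1 * N by apply: ler_pM => //; lra.
have p6 : e1 * N <= e / 16 * N by rewrite ler_wpM2r//; lra.
have p7 : 0 <= e1 * N by rewrite mulr_ge0//; lra.
lra.
Qed.

Lemma cder_cexp z : cder (@cexp R) z (cexp z).
Proof.
have Hs : cder (fun w : C => w - z) z 1.
  by have := cderB (cder_id z) (cder_cst z z); rewrite subr0.
have H0 : cder (@cexp R) (z - z) 1 by rewrite subrr; exact: cder_cexp0.
have := cderZ (cexp z) (cder_comp Hs H0); rewrite !mulr1.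
by apply: cder_ext => w; rewrite -cexpD addrC subrK.
Qed.

End ComplexExponential.

(** * Averages over circles and the mean value property *)

Section CircleAverage.
Variable R : realType.
Local Notation C := R[i].
Implicit Types (f g : C -> C) (a z : C) (r rho : R) (h : R -> C).

Definition arc (t : R) : C := cexp (0 +i* t).

Definition circ h : C := ((2 * pi)^-1)%:C * cint h 0 (2 * pi).

Lemma nm_arc t : nm (arc t) = 1.
Proof. by rewrite nm_cexp /= expR0. Qed.

Lemma nm_rarc r t : 0 <= r -> nm (r%:C * arc t) = r.
Proof. by move=> r0; rewrite nmM nm_real nm_arc mulr1 ger0_norm. Qed.

Lemma pi2_gt0 : 0 < 2 * pi :> R.
Proof. by rewrite mulr_gt0// pi_gt0. Qed.

Lemma circ_le h M : rcont h -> (forall t, nm (h t) <= M) -> nm (circ h) <= M.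
Proof.
move=> ch hM; have p0 := pi2_gt0.
rewrite /circ nmM nm_real ger0_norm ?invr_ge0 ?(ltW p0)// [_^-1 * _]mulrC ler_pdivrMr//.
by rewrite -[X in M * X]subr0; apply: cint_le => //; exact: ltW.
Qed.

Lemma circB h1 h2 : rcont h1 -> rcont h2 ->
  circ (fun t => h1 t - h2 t) = circ h1 - circ h2.
Proof. by move=> c1 c2; rewrite /circ cintB// mulrBr. Qed.

Lemma circZ h c : rcont h -> circ (fun t => c * h t) = c * circ h.
Proof. by move=> c1; rewrite /circ cintZ// mulrCA. Qed.

Lemma circ_cst c : circ (fun=> c) = c.
Proof.
rewrite /circ cint_cst subr0 mulrA -rmorphM /= mulVf ?mul1r//.
by rewrite gt_eqF// pi2_gt0.
Qed.

Lemma eq_circ h1 h2 : h1 =1 h2 -> circ h1 = circ h2.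
Proof. by move=> /funext ->. Qed.

Lemma rcont_line g z c : (exists d, cder g z d) -> forall e : R, 0 < e ->
  exists2 d : R, 0 < d & forall k : R, `|k| < d -> nm (g (z + k%:C * c) - g z) < e.
Proof.
move=> [b gb] e e0; have [d d0 hd] := cder_cont gb e0.
have nc := nm_ge0 c.
exists (d / (1 + nm c)); first by rewrite divr_gt0//; lra.
move=> k; rewrite ltr_pdivlMr; last lra.
move=> kd; apply: hd; rewrite addrAC subrr add0r nmM nm_real.
by have := normr_ge0 k; nra.
Qed.

Section Punctured.
Variables (g : C -> C) (a : C) (rho : R).
Hypothesis gD : forall z, 0 < nm (z - a) < rho -> exists d, cder g z d.

(** In the coordinate [w = log (z - a)], circles about [a] become vertical segments of length [2 pi]
    and annuli become rectangles, to which Goursat's theorem applies. *)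
Let G w := g (a + cexp w).

Let GD w : expR (complex.Re w) < rho -> exists d, cder G w d.
Proof.
move=> hw; have [|d hd] := gD (z := a + cexp w).
  by rewrite addrC addKr nm_cexp expR_gt0.
exists (d * cexp w); apply: (cder_comp (g := fun w => a + cexp w)) hd.
by have := cderD (cder_cst a w) (cder_cexp w); rewrite add0r.
Qed.

Lemma rcont_circle r : 0 < r < rho -> rcont (fun t => g (a + r%:C * arc t)).
Proof.
move=> /andP[r0 rr] t e e0.
have [|d d0 hd] := @rcont_line G (ln r +i* t) 'i%C (GD _) e e0.
  by rewrite /= lnK.
have E s : r%:C * arc s = cexp (ln r +i* s) by rewrite cexp_rect lnK.
exists d => // s /hd; rewrite /G E [a + r%:C * _]addrC E addrC.
congr (nm (g (a + cexp _) - _) < _).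
by apply/eqP; rewrite eq_complex /=; apply/andP; split; apply/eqP; ring.
Qed.

Lemma circ_const r1 r2 : 0 < r1 -> r1 <= r2 -> r2 < rho ->
  circ (fun t => g (a + r1%:C * arc t)) = circ (fun t => g (a + r2%:C * arc t)).
Proof.
move=> r10 r12 r2r; have r20 := lt_le_trans r10 r12.
pose s1 := ln r1; pose s2 := ln r2.
have s12 : s1 <= s2 by rewrite ler_ln.
(* Truncation at [s2] keeps the argument of [G] inside the domain for all real [s], since [rcont]
   asks for continuity on the whole line. *)
pose F s t := G (Num.min s s2 +i* t).
have inD s t : expR (complex.Re (Num.min s s2 +i* t)) < rho.
  apply: le_lt_trans r2r; rewrite -[leRHS]lnK// ler_expR /=.
  by rewrite ge_min lexx orbT.
have cFx y : rcont (F ^~ y).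
  move=> s e e0.
  have [d d0 hd] := @rcont_line G (Num.min s s2 +i* y) 1 (GD (inD _ _)) e e0.
  exists d => // s' ss'.
  have h : `|Num.min s' s2 - Num.min s s2| < d.
    move: ss'; rewrite !ltr_norml => /andP[? ?]; apply/andP.
    by case: (leP s' s2) => ?; case: (leP s s2) => ?; split; lra.
  have := hd _ h; congr (nm (G _ - _) < _).
  by apply/eqP; rewrite eq_complex /=; apply/andP; split; apply/eqP; ring.
have cFy s : rcont (F s).
  move=> t e e0.
  have [d d0 hd] := @rcont_line G (Num.min s s2 +i* t) 'i%C (GD (inD _ _)) e e0.
  exists d => // t' /hd; congr (nm (G _ - _) < _).
  by apply/eqP; rewrite eq_complex /=; apply/andP; split; apply/eqP; ring.
have Z := @Goursat R F cFx cFy s1 s2 0 (2 * pi) s12 (ltW pi2_gt0).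
have {Z} : rect_int F s1 s2 0 (2 * pi) = 0.
  apply: Z => x y /andP[x1 x2] yI.
  have minE u : u <= s2 -> Num.min u s2 = u by move=> h; apply/min_idPl.
  have [b hb] := GD (inD x y); exists b => e e0.
  have [d d0 hd] := hb e e0; exists (d / 2); first by rewrite divr_gt0.
  move=> x' y' /andP[_ x2'] _ hx hy.
  have := hd ((x' - x)%:C + 'i%C * (y' - y)%:C) => H.
  have hn : nm ((x' - x)%:C + 'i%C * (y' - y)%:C) <= `|x' - x| + `|y' - y|.
    by apply: (le_trans (nmD _ _)); rewrite nmM nm_i mul1r !nm_real.
  have {}H := H ltac:(lra).
  apply: (@le_trans _ _ (e * nm ((x' - x)%:C + 'i%C * (y' - y)%:C))); last first.
    by rewrite ler_wpM2l// ltW.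
  move: H; rewrite /F minE// [Num.min x' _]minE//; congr (nm (G _ - _ - _) <= _).
  by apply/eqP; rewrite eq_complex /=; apply/andP; split; apply/eqP; ring.
rewrite /rect_int.
(* By periodicity the two horizontal sides cancel, so the two vertical ones are equal. *)
have -> : F ^~ (2 * pi) = F ^~ 0.
  by apply/funext => s; rewrite /F /G -[2 * pi]add0r cexp_2pi.
rewrite subrr add0r => /eqP; rewrite mulf_eq0 subr_eq0.
have -> /= : ('i%C == 0 :> C) = false by rewrite -nm_eq0 nm_i oner_eq0.
move=> /eqP E.
have FE r : 0 < r -> r <= r2 ->
    cint (fun t => g (a + r%:C * arc t)) 0 (2 * pi) = cint (F (ln r)) 0 (2 * pi).
  move=> r0 rr2; apply: eq_cint => t; rewrite /F /G.
  have -> : Num.min (ln r) s2 = ln r by apply/min_idPl; rewrite ler_ln.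
  by rewrite cexp_rect lnK.
congr (_ * _).
exact: etrans (FE r1 r10 r12) (etrans (esym E) (esym (FE r2 r20 (lexx r2)))).
Qed.

(** Averages do not depend on the radius, and they tend to [g a] on small circles. Holomorphy off
    [a] and continuity at [a] are the properties that difference quotients have. *)
Lemma circ_mean r : 0 < r < rho ->
  (forall e : R, 0 < e -> exists2 d : R, 0 < d & forall y, nm (y - a) < d -> nm (g y - g a) < e) ->
  circ (fun t => g (a + r%:C * arc t)) = g a.
Proof.
move=> /andP[r0 rr] cg; apply/eqP; rewrite -subr_eq0; apply/eqP.
apply: nm_small => e e0; have [d d0 hd] := cg e e0.
pose r1 := Num.min r (d / 2).
have r10 : 0 < r1 by rewrite lt_min r0 half_gt0.
have r1r : r1 <= r by rewrite ge_min lexx.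
have r1d : r1 < d by rewrite gt_min; apply/orP; right; lra.
rewrite -(circ_const r10 r1r rr) -(circ_cst (g a)) -circB; last 2 first.
- by apply: rcont_circle; rewrite r10 (le_lt_trans r1r).
- exact: rcont_cst.
apply: circ_le.
  apply: rcontB; last exact: rcont_cst.
  by apply: rcont_circle; rewrite r10 (le_lt_trans r1r).
by move=> t; rewrite ltW// hd// addrAC subrr add0r nm_rarc// ltW.
Qed.

End Punctured.

Definition hol f f' a rho := forall z, nm (z - a) < rho -> cder f z (f' z).

Lemma hol_rcont f f' a rho r : hol f f' a rho -> 0 < r < rho ->
  rcont (fun t => f (a + r%:C * arc t)).
Proof.
by move=> H; apply: rcont_circle => z /andP[_ /H]; exists (f' z).
Qed.

Lemma mean_value f f' a rho r : hol f f' a rho -> 0 < r < rho ->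
  circ (fun t => f (a + r%:C * arc t)) = f a.
Proof.
move=> H rr; apply: (@circ_mean f a rho) => //.
  by move=> z /andP[_ /H]; exists (f' z).
apply: cder_cont; apply: H; rewrite subrr nm0.
by case/andP: rr; exact: lt_trans.
Qed.

Lemma rarc_neq0 r t : 0 < r -> r%:C * arc t != 0.
Proof. by move=> r0; rewrite -nm_gt0 nm_rarc// ltW. Qed.

Lemma cder_quot f c a z d : z - a != 0 -> cder f z d ->
  exists d', cder (fun z => (f z - c) / (z - a)) z d'.
Proof.
move=> za fd; eexists.
exact: (cderM (cderB fd (cder_cst c z))
  (cderV (f := fun z => z - a) za (cderB (cder_id z) (cder_cst a z)))).
Qed.

Lemma rcont_quot f f' a rho r : hol f f' a rho -> 0 < r < rho ->
  rcont (fun t => (f (a + r%:C * arc t) - f a) / (r%:C * arc t)).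
Proof.
move=> H rr; have /andP[r0 _] := rr.
have : rcont (fun t => (fun z => (f z - f a) / (z - a)) (a + r%:C * arc t)).
  apply: (@rcont_circle (fun z => (f z - f a) / (z - a)) a rho) => // z /andP[z0 zr].
  by apply: cder_quot (H _ zr); rewrite -nm_gt0.
by congr rcont; apply/funext => t; rewrite [a + _ - a]addrC addKr.
Qed.

(** The mean value property, at [a], of the difference quotient extended by [f' a]; it plays the
    part of Cauchy's integral formula for the derivative. *)
Lemma cauchy_derivative f f' a rho r : hol f f' a rho -> 0 < r < rho ->
  f' a = circ (fun t => (f (a + r%:C * arc t) - f a) / (r%:C * arc t)).
Proof.
move=> H rr; have /andP[r0 rrho] := rr.
pose g z := if z == a then f' a else (f z - f a) / (z - a).
have ga : g a = f' a by rewrite /g eqxx.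
rewrite -ga -(@circ_mean g a rho _ r rr).
- apply: eq_circ => t; rewrite /g [a + _ - a]addrC addKr.
  case: eqP => // /eqP; rewrite -subr_eq0 [a + _ - a]addrC addKr.
  by rewrite (negPf (rarc_neq0 t r0)).
- move=> z /andP[z0 zr].
  have za : z - a != 0 by rewrite -nm_gt0.
  have [d hd] := cder_quot (f a) za (H _ zr); exists d; apply: cder_eq hd; exists (nm (z - a)) => //.
  move=> y yz; rewrite /g; case: eqP => // ya.
  by move: yz; rewrite ya nmBC ltxx.
- move=> e e0; have Ha : cder f a (f' a).
    by apply: H; rewrite subrr nm0 (lt_trans r0).
  have [d d0 hd] := Ha _ (half_gt0 e0); exists d => // y yd; rewrite /g eqxx.
  case: eqP => [_|/eqP ya]; first by rewrite subrr nm0.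
  have ya0 : y - a != 0 by rewrite subr_eq0.
  rewrite (_ : _ - _ = (f (a + (y - a)) - f a - f' a * (y - a)) / (y - a)); last first.
    by rewrite [a + _]addrC subrK; field.
  rewrite nmM nmV ltr_pdivrMr ?nm_gt0//; apply: (le_lt_trans (hd _ yd)).
  by rewrite ltr_pM2r ?nm_gt0//; lra.
Qed.

End CircleAverage.

(** * Cauchy estimates and the derivative of a derivative *)

Section Holomorphic.
Variable R : realType.
Local Notation C := R[i].
Implicit Types (f g : C -> C) (a z w : C) (r rho : R).

Lemma segment_lip f f' z w (M : R) :
  (forall t : R, 0 <= t <= 1 -> cder f (z + t%:C * (w - z)) (f' (z + t%:C * (w - z)))) ->
  (forall t : R, 0 <= t <= 1 -> nm (f' (z + t%:C * (w - z))) <= M) ->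
  nm (f w - f z) <= M * nm (w - z).
Proof.
move=> H HM.
have := @rder_mean R (fun t => f (z + t%:C * (w - z)))
  (fun t => f' (z + t%:C * (w - z)) * (w - z)) 0 1 (M * nm (w - z)) ler01.
have -> : z + 1%:C * (w - z) = w by rewrite mul1r addrC subrK.
have -> : z + 0%:C * (w - z) = z by rewrite mul0r addr0.
rewrite subr0 mulr1; apply; last first.
  by move=> t tI; rewrite nmM ler_wpM2r ?nm_ge0// HM.
move=> t tI e e0; have nwz := nm_ge0 (w - z).
have e1 : 0 < e / (1 + nm (w - z)) by rewrite divr_gt0//; lra.
have [d d0 hd] := H t tI _ e1.
exists (d / (1 + nm (w - z))); first by rewrite divr_gt0//; lra.
move=> k; rewrite ltr_pdivlMr; last lra.
move=> kd; have nk := normr_ge0 k.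
have /hd : nm (k%:C * (w - z)) < d by rewrite nmM nm_real; nra.
have -> : z + t%:C * (w - z) + k%:C * (w - z) = z + (t + k)%:C * (w - z).
  by rewrite rmorphD; ring.
rewrite mulrCA => /le_trans; apply.
rewrite nmM nm_real; have eE : e = e / (1 + nm (w - z)) * (1 + nm (w - z)).
  by field; lra.
rewrite [in leRHS]eE; set q := e / _ in e1 *.
have : 0 <= q * `|k| by rewrite mulr_ge0// ltW.
nra.
Qed.

Lemma disk_convex a z w rho (t : R) : 0 <= t <= 1 ->
  nm (z - a) < rho -> nm (w - a) < rho -> nm (z + t%:C * (w - z) - a) < rho.
Proof.
move=> /andP[t0 t1] hz hw.
have -> : z + t%:C * (w - z) - a = (1 - t)%:C * (z - a) + t%:C * (w - a).
  by rewrite rmorphB; ring.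
apply: (le_lt_trans (nmD _ _)); rewrite !nmM !nm_real !ger0_norm ?subr_ge0//.
have [t1'|] := ltP t 1; first nra.
by move=> t1'; have -> : t = 1 by [lra]; lra.
Qed.

Lemma disk_lip f f' a rho (M : R) z w : hol f f' a rho ->
  (forall z, nm (z - a) < rho -> nm (f' z) <= M) ->
  nm (z - a) < rho -> nm (w - a) < rho -> nm (f w - f z) <= M * nm (w - z).
Proof.
move=> H HM hz hw; apply: (@segment_lip f f') => t tI.
  by apply: H; exact: disk_convex.
by apply: HM; exact: disk_convex.
Qed.

Lemma hol_sub f f' a rho b r : hol f f' a rho -> nm (b - a) + r <= rho ->
  hol f f' b r.
Proof.
move=> H br z zb; apply: H.
have -> : z - a = z - b + (b - a) by ring.
by apply: (le_lt_trans (nmD _ _)); lra.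
Qed.

Lemma hol_shift f f' a rho h : hol f f' a rho ->
  hol (fun z => f (z + h)) (fun z => f' (z + h)) (a - h) rho.
Proof.
move=> H z hz.
have := @cder_comp R f (fun z => z + h) z (f' (z + h)) 1.
rewrite mulr1; apply.
  by have := cderD (cder_id z) (cder_cst h z); rewrite addr0.
by apply: H; move: hz; congr (nm _ < _); ring.
Qed.

Lemma holB f f' g g' a rho : hol f f' a rho -> hol g g' a rho ->
  hol (fun z => f z - g z) (fun z => f' z - g' z) a rho.
Proof. by move=> F G z hz; apply: cderB; [exact: F|exact: G]. Qed.

Lemma cauchy_bound f f' a rho (M : R) r : hol f f' a rho ->
  (forall z, nm (z - a) < rho -> nm (f z) <= M) -> 0 < r < rho ->
  nm (f' a) <= 2 * M / r.
Proof.
move=> H HM rr; have /andP[r0 rrho] := rr.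
rewrite (cauchy_derivative H rr); apply: circ_le.
  exact: rcont_quot H rr.
move=> t; rewrite nmM nmV nm_rarc ?(ltW r0)// ler_wpM2r ?invr_ge0 ?(ltW r0)//.
have h1 : nm (f (a + r%:C * arc t)) <= M.
  by apply: HM; rewrite addrAC subrr add0r nm_rarc ?(ltW r0).
have h2 : nm (f a) <= M by apply: HM; rewrite subrr nm0 (lt_trans r0).
by have := nmB (f (a + r%:C * arc t)) (f a); lra.
Qed.

(** A bound on the disk of radius [4 r] is passed on to [3 r] for the derivative and to [2 r] for
    its Lipschitz constant, each time with a margin [r] for a Cauchy estimate. *)
Lemma der_bound f f' a (M : R) r z : hol f f' a (4 * r) -> 0 < r ->
  (forall z, nm (z - a) < 4 * r -> nm (f z) <= M) -> nm (z - a) < 3 * r ->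
  nm (f' z) <= 4 * M / r.
Proof.
move=> H r0 HM hz.
have Hz : hol f f' z r by apply: (hol_sub H); lra.
have := @cauchy_bound f f' z r M (r / 2) Hz.
have -> : 2 * M / (r / 2) = 4 * M / r by field; lra.
apply; last by rewrite half_gt0//; lra.
move=> w hw; apply: HM; have -> : w - a = w - z + (z - a) by ring.
by have := nmD (w - z) (z - a); lra.
Qed.

(** The second derivative is not yet known to exist; the Cauchy bound is applied instead to the
    difference between [f] and its translate by [w - z]. *)
Lemma der_lip f f' a (M : R) r z w : hol f f' a (4 * r) -> 0 < r ->
  (forall z, nm (z - a) < 4 * r -> nm (f z) <= M) ->
  nm (z - a) < 2 * r -> nm (w - a) < 2 * r ->
  nm (f' w - f' z) <= 16 * M / r ^+ 2 * nm (w - z).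
Proof.
move=> H r0 HM hz hw.
have H3 : hol f f' a (3 * r) by apply: (hol_sub H); rewrite subrr nm0; lra.
have lip := disk_lip H3 (fun z => @der_bound f f' a M r z H r0 HM).
pose F x := f (x + (w - z)) - f x.
pose F' x := f' (x + (w - z)) - f' x.
have HF : hol F F' z r.
  apply: holB; last by apply: (hol_sub H); lra.
  have := @hol_shift f f' w r (w - z).
  have -> : w - (w - z) = z by ring.
  by apply; apply: (hol_sub H); lra.
have := @cauchy_bound F F' z r (4 * M / r * nm (w - z)) (r / 2) HF.
have -> : F' z = f' w - f' z by rewrite /F' [z + _]addrC subrK.
have -> : 2 * (4 * M / r * nm (w - z)) / (r / 2) = 16 * M / r ^+ 2 * nm (w - z).
  by field; lra.
apply; last by rewrite half_gt0//; lra.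
move=> x hx; have E : x + (w - z) - x = w - z by ring.
rewrite /F -{2}E; apply: lip.
  have -> : x - a = x - z + (z - a) by ring.
  by have := nmD (x - z) (z - a); lra.
have -> : x + (w - z) - a = x - z + (w - a) by ring.
by have := nmD (x - z) (w - a); lra.
Qed.

Lemma quadratic_remainder f f' a (M : R) r z h : hol f f' a (4 * r) -> 0 < r ->
  (forall z, nm (z - a) < 4 * r -> nm (f z) <= M) ->
  nm (z - a) < 2 * r -> nm (z + h - a) < 2 * r ->
  nm (f (z + h) - f z - f' z * h) <= 16 * M / r ^+ 2 * nm h ^+ 2.
Proof.
move=> H r0 HM hz hw.
have H2 : hol f f' a (2 * r) by apply: (hol_sub H); rewrite subrr nm0; lra.
have E : z + h - z = h by ring.
have hdc (t : R) : 0 <= t <= 1 -> nm (z + t%:C * h - a) < 2 * r.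
  by move=> tI; have := disk_convex tI hz hw; rewrite E.
have := @segment_lip (fun x => f x - f' z * x) (fun x => f' x - f' z) z (z + h)
  (16 * M / r ^+ 2 * nm h).
rewrite E (_ : _ - _ - _ = f (z + h) - f z - f' z * h); last by ring.
rewrite expr2 mulrA; apply => t tI.
  apply: cderB.
    by apply: H2; exact: hdc.
  by have := cderZ (f' z) (cder_id (z + t%:C * h)); rewrite mulr1.
have := @der_lip f f' a M r z (z + t%:C * h) H r0 HM hz.
have E2 : z + t%:C * h - z = t%:C * h by ring.
rewrite E2 => /(_ _)/le_trans; apply.
  exact: hdc.
have M0 : 0 <= M by apply: le_trans (HM a _); rewrite ?nm_ge0// subrr nm0; lra.
rewrite ler_wpM2l//; first by rewrite divr_ge0 ?exprn_ge0//; lra.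
have /andP[t0 t1] := tI; rewrite nmM nm_real ger0_norm//.
by have := nm_ge0 h; nra.
Qed.

Lemma hol_locally_bounded f f' a rho z : hol f f' a rho -> nm (z - a) < rho ->
  exists (M r : R), [/\ 0 < r, nm (z - a) + 4 * r <= rho &
    forall w, nm (w - z) < 4 * r -> nm (f w) <= M].
Proof.
move=> H hz; have [d d0 hd] := cder_cont (H z hz) ltr01.
exists (1 + nm (f z)), (Num.min (d / 4) ((rho - nm (z - a)) / 4)); split.
- by rewrite lt_min !divr_gt0// subr_gt0.
- by rewrite -lerBrDl -ler_pdivlMl// [4^-1 * _]mulrC ge_min lexx orbT.
- move=> w; rewrite -ltr_pdivrMl// lt_min => /andP[h1 _].
  have := nm_subl (f w) (f z); have := hd w ltac:(lra); lra.
Qed.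

(** Differentiation of [cauchy_derivative] under the average: [f' w] averages the difference
    quotients of [f] at [w], and averaging those of [f'] at [z] gives the derivative of [f']. The
    error averages difference quotients of [Q], which is of order [nm h ^+ 2]. *)
Lemma hol_der f f' a rho : hol f f' a rho -> exists f'', hol f' f'' a rho.
Proof.
move=> H; exists (fun z => xget 0 [set d | cder f' z d]) => z hz.
suff [d hd] : exists d, cder f' z d.
  by case: xgetP => [d' -> //|/(_ d)]; case.
have [M [r [r0 rr HM]]] := hol_locally_bounded H hz.
have Hz : hol f f' z (4 * r) by exact: hol_sub rr.
have M0 : 0 <= M by apply: le_trans (HM z _); rewrite ?nm_ge0// subrr nm0; lra.
pose K := 16 * M / r ^+ 2.
have K0 : 0 <= K by rewrite divr_ge0 ?exprn_ge0//; lra.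
have lip u v := @der_lip f f' z M r u v Hz r0 HM.
have cf' w : nm (w - z) < r / 2 -> rcont (fun t => f' (w + r%:C * arc t)).
  move=> hw t e e0.
  have [d d0 hd] : exists2 d : R, 0 < d & forall s, `|s - t| < d ->
      nm ((w + r%:C * arc s) - (w + r%:C * arc t)) < e / (1 + K).
    have := @rcont_circle R id w (r + r) _ r _ t (e / (1 + K)).
    apply; last by rewrite divr_gt0//; lra.
      by move=> x _; exists 1; exact: cder_id.
    by rewrite r0; lra.
  exists d => // s /hd; rewrite ltr_pdivlMr; last lra.
  move=> hs; apply: le_lt_trans (lip _ _ _ _) _; rewrite -/K.
  - have -> : w + r%:C * arc t - z = w - z + r%:C * arc t by ring.
    by have := nmD (w - z) (r%:C * arc t); rewrite nm_rarc ?(ltW r0)//; lra.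
  - have -> : w + r%:C * arc s - z = w - z + r%:C * arc s by ring.
    by have := nmD (w - z) (r%:C * arc s); rewrite nm_rarc ?(ltW r0)//; lra.
  - by have := nm_ge0 (w + r%:C * arc s - (w + r%:C * arc t)); nra.
pose q (F : C -> C) w t := (F (w + r%:C * arc t) - F w) / (r%:C * arc t).
have cq w : nm (w - z) < r / 2 -> rcont (q f w).
  move=> hw; apply: (@rcont_quot R f f' w (2 * r)); last by rewrite r0; lra.
  by apply: (hol_sub Hz); lra.
have cinv : rcont (fun t => (r%:C * arc t)^-1).
  have := @rcont_circle R (fun z => z^-1) 0 (r + r).
  move=> Hc; have : rcont (fun t => (0 + r%:C * arc t)^-1 : C).
    apply: Hc; last by rewrite r0; lra.
    move=> x; rewrite subr0 => /andP[x0 _]; eexists.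
    by apply: (cderV (f := id)); [rewrite -nm_gt0|exact: cder_id].
  by congr rcont; apply/funext => t; rewrite add0r.
have cq' : rcont (q f' z).
  apply: rcontM => //; apply: rcontB; last exact: rcont_cst.
  by apply: cf'; rewrite subrr nm0 half_gt0.
exists (circ (q f' z)) => e e0.
pose d := Num.min (r / 2) (e * r / (1 + 2 * K)).
have d0 : 0 < d by rewrite lt_min half_gt0//= divr_gt0 ?mulr_gt0//; lra.
exists d => // h hh.
have [hr he] : nm h < r / 2 /\ nm h * (1 + 2 * K) < e * r.
  move: hh; rewrite /d lt_min => /andP[-> ].
  by rewrite ltr_pdivlMr//; lra.
have zz : nm (z - z) < r / 2 by rewrite subrr nm0 half_gt0.
have zh : nm (z + h - z) < r / 2 by rewrite addrAC subrr add0r.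
have r2 : 0 < r < 2 * r by rewrite r0; lra.
have E w : nm (w - z) < r / 2 -> f' w = circ (q f w).
  move=> hw; apply: (@cauchy_derivative R f f' w (2 * r)) => //.
  by apply: (hol_sub Hz); lra.
have c1 := cq _ zz; have c2 := cq _ zh; have c3 := rcontZ h cq'.
rewrite (E _ zz) (E _ zh).
have -> : circ (q f (z + h)) - circ (q f z) - circ (q f' z) * h =
    circ (fun t => q f (z + h) t - q f z t - h * q f' z t).
  rewrite (circB (rcontB c2 c1) c3) (circB c2 c1) (circZ h cq').
  by rewrite [h * _]mulrC.
pose Q w := f (w + h) - f w - f' w * h.
have QE t : q f (z + h) t - q f z t - h * q f' z t =
   (Q (z + r%:C * arc t) - Q z) / (r%:C * arc t).
  rewrite /q /Q; move: (rarc_neq0 t r0); move: (r%:C * arc t) => u u0.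
  by rewrite (addrAC z h); field.
have Qle w : nm (w - z) < 3 / 2 * r -> nm (Q w) <= K * nm h ^+ 2.
  move=> hw; apply: (@quadratic_remainder f f' z M r w h) => //; first lra.
  have -> : w + h - z = w - z + h by ring.
  by have := nmD (w - z) h; lra.
rewrite (eq_circ QE).
apply: (@le_trans _ _ (2 * K * nm h ^+ 2 / r)).
  apply: circ_le.
    have : rcont (fun t => q f (z + h) t - q f z t - h * q f' z t).
      exact: rcontB (rcontB c2 c1) c3.
    by congr rcont; apply/funext => t; exact: QE.
  move=> t; rewrite nmM nmV nm_rarc ?(ltW r0)// ler_wpM2r ?invr_ge0 ?(ltW r0)//.
  have := nmB (Q (z + r%:C * arc t)) (Q z).
  have := Qle z ltac:(lra); have := Qle (z + r%:C * arc t).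
  by rewrite (addrAC z) subrr add0r nm_rarc ?(ltW r0)// => /(_ ltac:(lra)); lra.
rewrite ler_pdivrMr// expr2.
by have := nm_ge0 h; nra.
Qed.

End Holomorphic.

(** * Zeros of holomorphic functions *)

Section Factorization.
Variable R : realType.
Local Notation C := R[i].
Implicit Types (f g : C -> C) (a z w : C) (r rho : R).

(** A removable singularity. Only the origin is at stake, where the derivative of the quotient is
    half the second derivative of [f]. *)
Lemma hol_div f f' rho : 0 < rho -> hol f f' 0 rho -> f 0 = 0 ->
  exists g g', hol g g' 0 rho /\ forall z, f z = z * g z.
Proof.
move=> rho0 H f0.
pose g z := if z == 0 then f' 0 else f z / z.
suff dg z : nm (z - 0) < rho -> exists d, cder g z d.
  exists g, (fun z => xget 0 [set d | cder g z d]); split.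
    by move=> z /dg[d hd]; case: xgetP => [d' -> //|/(_ d)]; case.
  move=> z; rewrite /g; case: eqP => [->|/eqP z0]; first by rewrite f0 mul0r.
  by rewrite mulrC divfK.
move=> hz; have [->|z0] := eqVneq z 0; last first.
  have z0' : z - 0 != 0 by rewrite subr0.
  have [d hd] := cder_quot 0 z0' (H z hz); exists d.
  apply: cder_eq hd; exists (nm z); first by rewrite nm_gt0.
  move=> y hy; rewrite /g !subr0; case: eqP => // y0.
  by move: hy; rewrite y0 sub0r nmN ltxx.
have [f'' H'] := hol_der H.
have z00 : nm (0 - 0 : C) < rho by rewrite subrr nm0.
exists (f'' 0 / 2) => e e0.
have [d d0 hd] := H' 0 z00 e e0.
exists (Num.min d rho); first by rewrite lt_min d0.
move=> h; rewrite lt_min => /andP[hh hrho]; rewrite add0r {2}/g eqxx.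
have [->|h0] := eqVneq h 0; first by rewrite /g eqxx mulr0 !subrr nm0 mulr0.
(* The derivative of [k] is [o(nm h)] on the segment from 0 to [h], because [f'] is differentiable
   at 0; so [k h] is [o(nm h ^+ 2)]. *)
pose k z := f z - f' 0 * z - f'' 0 / 2 * z ^+ 2.
pose k' z := f' z - f' 0 - f'' 0 * z.
have := @segment_lip R k k' 0 h (e * nm h).
have -> : k h - k 0 = f h - f' 0 * h - f'' 0 / 2 * h ^+ 2.
  by rewrite /k f0; ring.
rewrite subr0 => K.
have {}K : nm (f h - f' 0 * h - f'' 0 / 2 * h ^+ 2) <= e * nm h * nm h.
  have small (t : R) : 0 <= t <= 1 -> nm (0 + t%:C * h) <= nm h.
    move=> /andP[t0 t1]; rewrite add0r nmM nm_real ger0_norm//.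
    by have := nm_ge0 h; nra.
  apply: K => t tI; have hs := small t tI.
    have hz1 : nm (0 + t%:C * h - 0) < rho by rewrite subr0; lra.
    have dX : cder (fun z => f'' 0 / 2 * z ^+ 2) (0 + t%:C * h) (f'' 0 * (0 + t%:C * h)).
      have := cderZ (f'' 0 / 2) (cderXn 2 (0 + t%:C * h)).
      by rewrite /= expr1 [_ / 2 * _]mulrA divfK// pnatr_eq0.
    apply: cderB dX; apply: cderB; first exact: H.
    by have := cderZ (f' 0) (cder_id (0 + t%:C * h)); rewrite mulr1.
  have := hd (0 + t%:C * h) ltac:(lra); rewrite add0r => /le_trans; apply.
  by rewrite ler_wpM2l// ltW.
rewrite /g (negPf h0).
have -> : f h / h - f' 0 - f'' 0 / 2 * h = (f h - f' 0 * h - f'' 0 / 2 * h ^+ 2) / h.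
  by field.
by rewrite nmM nmV ler_pdivrMr ?nm_gt0.
Qed.

(** The mean value of [g] is taken on a circle about [t] that keeps away from 0: there
    [nm (t / w) <= 1 / 2], hence [nm (f t)] is at most [M / 2 ^ n] for every [n]. *)
Lemma hol_flat f f' rho : 0 < rho -> hol f f' 0 rho ->
  (forall n, exists g g', hol g g' 0 rho /\ forall z, f z = z ^+ n * g z) ->
  exists2 d : R, 0 < d & forall z, nm z < d -> f z = 0.
Proof.
move=> rho0 H HD.
have z00 : nm (0 - 0 : C) < rho by rewrite subrr nm0.
have [M [r [r0 rr HM]]] := hol_locally_bounded H z00.
have {}rr : 4 * r <= rho by move: rr; rewrite subrr nm0 add0r.
exists (r / 4); first by rewrite divr_gt0.
move=> t ht; apply: nm_small => e e0.
have [n hn] := exp2_bound M e0.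
have [g [g' [Hg fE]]] := HD n.
apply: (le_trans _ (ltW hn)); rewrite fE.
have Ht : hol g g' t (2 * r) by apply: (hol_sub Hg); rewrite subr0; lra.
rewrite -(mean_value Ht (r := r)); last by rewrite r0; lra.
rewrite -circZ; last by apply: (hol_rcont Ht); rewrite r0; lra.
apply: circ_le.
  by apply: rcontZ; apply: (hol_rcont Ht); rewrite r0; lra.
move=> s; set w := t + _.
have w1 : nm w <= 2 * r.
  by rewrite /w; have := nmD t (r%:C * arc s); rewrite nm_rarc ?(ltW r0)//; lra.
have w2 : r / 2 <= nm w.
  have := nm_subl (r%:C * arc s) w; rewrite nm_rarc ?(ltW r0)//.
  have -> : r%:C * arc s - w = - t by rewrite /w; ring.
  by rewrite nmN; lra.
have w0 : w != 0 by rewrite -nm_gt0; lra.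
have -> : t ^+ n * g w = (t / w) ^+ n * f w.
  by rewrite fE expr_div_n; field; rewrite expf_neq0.
rewrite nmM nmX nmM nmV mulrC; apply: ler_pM => //.
- exact: nm_ge0.
- by rewrite exprn_ge0// divr_ge0 ?nm_ge0.
- by apply: HM; rewrite subr0; lra.
rewrite -exprVn lerXn2r ?nnegrE ?invr_ge0// ?divr_ge0 ?nm_ge0//.
by rewrite ler_pdivrMr; lra.
Qed.

(** If no such [n] existed, every power of [z] would divide [f], and [hol_flat] would make it vanish
    near 0. *)
Lemma hol_factor f f' rho : 0 < rho -> hol f f' 0 rho ->
  (forall d : R, 0 < d -> exists2 z, nm z < d & f z != 0) ->
  exists n g g', [/\ hol g g' 0 rho, forall z, f z = z ^+ n * g z & g 0 != 0].
Proof.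
move=> rho0 H nz.
pose P n := exists g g', hol g g' 0 rho /\ forall z, f z = z ^+ n * g z.
have [n [Pn nPn]] : exists n, P n /\ ~ P n.+1.
  apply: contrapT => h.
  have HP : forall n, P n.
    elim=> [|n Pn]; first by exists f, f'; split => // z; rewrite mul1r.
    by apply: contrapT => nP; apply: h; exists n.
  have [d d0 hd] := hol_flat rho0 H HP.
  by have [z /hd -> ] := nz d d0; rewrite eqxx.
have [g [g' [Hg fE]]] := Pn; exists n, g, g'; split => //.
apply/negP => /eqP g0; apply: nPn.
have [k [k' [Hk gE]]] := hol_div rho0 Hg g0.
by exists k, k'; split => // z; rewrite fE gE exprS; ring.
Qed.

(** As long as [k < n], the quotient of [f] by [z ^ k] is [O(z)] along the positive reals, hence
    vanishes at 0 and can be divided once more. *)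
Lemma hol_factor_le f f' rho n (K d : R) : 0 < rho -> hol f f' 0 rho -> 0 < d ->
  (forall z, nm z < d -> nm (f z) <= K * nm z ^+ n) ->
  exists g g', hol g g' 0 rho /\ forall z, f z = z ^+ n * g z.
Proof.
move=> rho0 H d0 fK.
suff : forall k, (k <= n)%N -> exists g g', hol g g' 0 rho /\ forall z, f z = z ^+ k * g z.
  by apply.
elim=> [_|k ih kn]; first by exists f, f'; split => // z; rewrite mul1r.
have [g [g' [Hg fE]]] := ih (ltnW kn).
suff g0 : g 0 = 0.
  have [l [l' [Hl gE]]] := hol_div rho0 Hg g0.
  by exists l, l'; split => // z; rewrite fE gE exprS; ring.
apply: nm_small => e e0.
have z00 : nm (0 - 0 : C) < rho by rewrite subrr nm0.
have [d1 d10 h1] := cder_cont (Hg 0 z00) (half_gt0 e0).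
have K1 : 0 < 1 + `|K| by have := normr_ge0 K; lra.
pose x := Num.min (Num.min (d / 2) (d1 / 2)) (Num.min 1 (e / (2 * (1 + `|K|)))).
have x0 : 0 < x by rewrite !lt_min !half_gt0//= ltr01 div2_gt0.
have [xd xd1 x1 xe] : [/\ x < d, x < d1, x <= 1 & x * (2 * (1 + `|K|)) <= e].
  split; rewrite ?/x ?gt_min.
  - by apply/orP; left; apply/orP; left; lra.
  - by apply/orP; left; apply/orP; right; lra.
  - by rewrite !ge_min lexx orbT.
  - by rewrite -ler_pdivlMr ?mulr_gt0// !ge_min lexx !orbT.
have nx : nm x%:C = x by rewrite nm_real ger0_norm// ltW.
have gx : nm (g x%:C) <= K * x.
  have := fK x%:C; rewrite fE nmM nmX nx => /(_ xd).
  have -> : x ^+ n = x ^+ k * x ^+ (n - k) by rewrite -exprD subnKC// ltnW.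
  rewrite mulrCA ler_pM2l ?exprn_gt0// => /le_trans; apply.
  have [K0|K0] := leP 0 K.
    rewrite ler_wpM2l//; move: kn; rewrite -subn_gt0; case: (n - k)%N => // j _.
    by rewrite exprS ler_piMr ?(ltW x0)// exprn_ile1// ltW.
  have := fK x%:C; rewrite nx => /(_ xd) h.
  have := le_trans (nm_ge0 _) h; rewrite leNgt nmulr_rlt0//.
  by rewrite exprn_gt0.
have := h1 x%:C; rewrite subr0 nx => /(_ xd1).
have := nm_subl (g 0) (g x%:C); rewrite nmBC.
have := ler_norm K; nra.
Qed.

End Factorization.

(** * Fixed points of contractions *)

Section Contraction.
Variable R : realType.
Local Notation C := R[i].

Lemma geometric_limit (u : nat -> R) (r : R) : 0 <= r ->
  (forall n, `|u n.+1 - u n| <= r / 2 ^+ n) ->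
  exists X, forall n, `|u n - X| <= 2 * r / 2 ^+ n.
Proof.
(* After rank [n] the sequence moves by at most [2 r / 2 ^ n], so [u n] minus and plus this amount
   are the ends of nested intervals. *)
move=> r0 hu; pose a n := u n - 2 * r / 2 ^+ n.
have [||X hX] := @nested_limit R a (4 * r).
- by rewrite mulr_ge0.
- move=> n; rewrite /a.
  have e1 : r / 2 ^+ n = 2 * (r / 2 ^+ n.+1).
    by rewrite exprS; field; rewrite expf_neq0.
  have := hu n; rewrite -![_ * r / _]mulrA e1 ler_norml; lra.
exists X => n; have := hX n; rewrite /a -![_ * r / _]mulrA ler_norml; lra.
Qed.

Lemma geometric_limitC (u : nat -> C) (r : R) : 0 <= r ->
  (forall n, nm (u n.+1 - u n) <= r / 2 ^+ n) ->
  exists X, forall n, nm (u n - X) <= 4 * r / 2 ^+ n.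
Proof.
move=> r0 hu.
have [n|X hX] := @geometric_limit (fun n => complex.Re (u n)) r r0.
  by apply: le_trans (hu n); rewrite -Re_sub Re_le_nm.
have [n|Y hY] := @geometric_limit (fun n => complex.Im (u n)) r r0.
  by apply: le_trans (hu n); rewrite -Im_sub Im_le_nm.
exists (X +i* Y) => n; apply: (le_trans (nm_le_ReIm _)).
rewrite Re_sub Im_sub /=; have := hX n; have := hY n.
by rewrite -![_ * r / _]mulrA; lra.
Qed.

(** Banach's fixed point theorem in the norm [nm x + nm y]; the bound [r / 2] at the origin makes
    the ball of radius [r] stable. *)
Lemma contraction2 (T1 T2 : C -> C -> C) (r : R) : 0 <= r ->
  (forall x y x' y', nm x + nm y <= r -> nm x' + nm y' <= r ->
    nm (T1 x' y' - T1 x y) + nm (T2 x' y' - T2 x y) <=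
      (nm (x' - x) + nm (y' - y)) / 2) ->
  nm (T1 0 0) + nm (T2 0 0) <= r / 2 ->
  exists x y, [/\ nm x + nm y <= r, T1 x y = x & T2 x y = y].
Proof.
move=> r0 HT H0.
pose p := fix p n : C * C := if n is n'.+1 then
  (T1 (p n').1 (p n').2, T2 (p n').1 (p n').2) else (0, 0).
have p0E : p 0%N = (0, 0) by [].
have pSE n : p n.+1 = (T1 (p n).1 (p n).2, T2 (p n).1 (p n).2) by [].
have pr n : nm (p n).1 + nm (p n).2 <= r.
  elim: n => [|n ih]; first by rewrite p0E /= !nm0 addr0.
  have := HT 0 0 (p n).1 (p n).2; rewrite !nm0 addr0 => /(_ r0 ih).
  rewrite !subr0 pSE /= => h.
  have := nm_subl (T1 (p n).1 (p n).2) (T1 0 0).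
  have := nm_subl (T2 (p n).1 (p n).2) (T2 0 0); lra.
have pd n : nm ((p n.+1).1 - (p n).1) + nm ((p n.+1).2 - (p n).2) <= r / 2 ^+ n.
  elim: n => [|n ih]; first by have := H0; rewrite pSE p0E /= !subr0 divr1; lra.
  have := HT _ _ _ _ (pr n) (pr n.+1).
  have -> : r / 2 ^+ n.+1 = (r / 2 ^+ n) / 2.
    by rewrite exprS; field; rewrite expf_neq0.
  by move=> h; apply: (le_trans h); lra.
have [n|x hx] := @geometric_limitC (fun n => (p n).1) r r0.
  by apply: le_trans (pd n); rewrite lerDl nm_ge0.
have [n|y hy] := @geometric_limitC (fun n => (p n).2) r r0.
  by apply: le_trans (pd n); rewrite lerDr nm_ge0.
have small e : 0 < e -> exists n, nm ((p n).1 - x) + nm ((p n).2 - y) <= e /\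
    nm ((p n.+1).1 - x) + nm ((p n.+1).2 - y) <= e.
  move=> e0; have [n hn] := exp2_bound (8 * r) e0; exists n.
  have := hx n; have := hy n; have := hx n.+1; have := hy n.+1.
  have -> : 4 * r / 2 ^+ n.+1 = (4 * r / 2 ^+ n) / 2.
    by rewrite exprS; field; rewrite expf_neq0.
  have E : 8 * r / 2 ^+ n = 2 * (4 * r / 2 ^+ n) by ring.
  have : 0 <= 4 * r / 2 ^+ n by rewrite divr_ge0 ?mulr_ge0// exprn_ge0.
  by move: hn; rewrite E; lra.
have xyr : nm x + nm y <= r.
  rewrite leNgt; apply/negP => h.
  have [n [h1 _]] := small ((nm x + nm y - r) / 2) ltac:(lra).
  have := nm_subl x (p n).1; have := nm_subl y (p n).2.
  have := pr n; rewrite [nm (x - _)]nmBC [nm (y - _)]nmBC; lra.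
have key e : 0 < e -> nm (T1 x y - x) + nm (T2 x y - y) <= e.
  move=> e0; have [n [h1 h2]] := small (e / 2) (half_gt0 e0).
  have := HT _ _ _ _ xyr (pr n).
  have a1 := nm_subl (T1 x y - x) ((p n.+1).1 - x).
  have a2 := nm_subl (T2 x y - y) ((p n.+1).2 - y).
  move: a1 a2; rewrite !pSE /= !opprB !addrA !subrK ![nm (T1 x y - T1 _ _)]nmBC.
  rewrite ![nm (T2 x y - T2 _ _)]nmBC; lra.
exists x, y; split => //; apply/eqP; rewrite -subr_eq0; apply/eqP/nm_small => e e0.
  by have := key e e0; have := nm_ge0 (T2 x y - y); lra.
by have := key e e0; have := nm_ge0 (T1 x y - x); lra.
Qed.

Lemma contraction1 (T : C -> C) (r : R) : 0 <= r ->
  (forall x x', nm x <= r -> nm x' <= r -> nm (T x' - T x) <= nm (x' - x) / 2) ->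
  nm (T 0) <= r / 2 ->
  exists2 x, nm x <= r & T x = x.
Proof.
move=> r0 HT H0.
have [||x [y [h1 h2 h3]]] := @contraction2 (fun x _ => T x) (fun _ _ => 0) r r0.
- move=> x y x' y' h h'; rewrite subrr nm0 addr0.
  have := HT x x'; have := nm_ge0 y; have := nm_ge0 y'; have := nm_ge0 (y' - y).
  move=> ? ? ? /(_ ltac:(lra) ltac:(lra)); lra.
- by rewrite nm0 addr0.
by exists x => //; have := nm_ge0 y; lra.
Qed.

End Contraction.

(** * Functions of two variables *)

Section TwoVariables.
Variable R : realType.
Local Notation C := R[i].
Implicit Types (f fx fy : C -> C -> C) (rho : R).

Definition hol2 f fx fy rho := forall x y, nm x < rho -> nm y < rho ->
  cder2 f x y (fx x y) (fy x y).

Lemma cder2_swap f x y a b : cder2 f x y a b -> cder2 (fun x y => f y x) y x b a.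
Proof.
move=> H e e0; have [d d0 hd] := H e e0; exists d => // h k hh hk.
by have := hd k h hk hh; rewrite [nm k + _]addrC addrAC.
Qed.

Lemma hol2_swap f fx fy rho : hol2 f fx fy rho ->
  hol2 (fun x y => f y x) (fun x y => fy y x) (fun x y => fx y x) rho.
Proof. by move=> H x y hx hy; apply: cder2_swap; exact: H. Qed.

Lemma hol2_fix f fx fy rho y : hol2 f fx fy rho -> nm y < rho ->
  hol (f ^~ y) (fx ^~ y) 0 rho.
Proof.
by move=> H hy x; rewrite subr0 => hx; apply: cder2_x; exact: H.
Qed.

Lemma hol2_bounded f fx fy rho : 0 < rho -> hol2 f fx fy rho ->
  exists (M r : R), [/\ 0 < r, 4 * r <= rho, 0 <= M &
    forall x y, nm x < 4 * r -> nm y < 4 * r -> nm (f x y) <= M].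
Proof.
move=> rho0 H.
have [||d d0 hd] := cder2_cont (H 0 0 _ _) ltr01; rewrite ?nm0//.
exists (1 + nm (f 0 0)), (Num.min (d / 4) (rho / 4)); split.
- by rewrite lt_min !divr_gt0.
- by rewrite -ler_pdivlMl// [4^-1 * _]mulrC ge_min lexx orbT.
- by have := nm_ge0 (f 0 0); lra.
move=> x y; rewrite -!ltr_pdivrMl// !lt_min => /andP[hx _] /andP[hy _].
have := nm_subl (f x y) (f 0 0).
have := hd x y; rewrite !subr0 => /(_ ltac:(lra) ltac:(lra)); lra.
Qed.

(** Cauchy estimates in [x], for [f x 0] and for [f x y - f x 0]; the latter is [O(nm y)] since [fy]
    is bounded. *)
Lemma partial_continuous f fx fy rho : 0 < rho -> hol2 f fx fy rho ->
  forall e : R, 0 < e -> exists2 d : R, 0 < d &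
    forall x y, nm x < d -> nm y < d -> nm (fx x y - fx 0 0) <= e.
Proof.
move=> rho0 H e e0.
have [M [r [r0 rr M0 HM]]] := hol2_bounded rho0 H.
have hx y : nm y < 4 * r -> hol (f ^~ y) (fx ^~ y) 0 (4 * r).
  move=> hy; apply: (hol_sub (hol2_fix H _)); first lra.
  by rewrite subrr nm0 add0r.
have hy x : nm x < 4 * r -> hol (f x) (fy x) 0 (4 * r).
  move=> hx'; apply: (hol_sub (hol2_fix (hol2_swap H) _)); first lra.
  by rewrite subrr nm0 add0r.
pose B := 4 * M / r.
have B0 : 0 <= B by rewrite divr_ge0 ?mulr_ge0// ltW.
have By x y : nm x < 4 * r -> nm y < 3 * r -> nm (fy x y) <= B.
  move=> h1 h2; apply: (@der_bound _ (f x) (fy x) 0 M r) => //; first exact: hy.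
    by move=> z; rewrite subr0 => h; exact: HM.
  by rewrite subr0.
have lipy x y : nm x < 3 * r -> nm y < 3 * r ->
    nm (fx x y - fx x 0) <= 4 * (B * nm y) / r.
  move=> h1 h2.
  have h00 : nm (0 : C) < 4 * r by rewrite nm0; lra.
  apply: (@der_bound _ (fun x => f x y - f x 0) (fun x => fx x y - fx x 0) 0) => //.
  - by apply: holB; apply: hx => //; lra.
  - move=> z; rewrite subr0 => hz.
    have Hy : hol (f z) (fy z) 0 (3 * r).
      by apply: (hol_sub (hy z hz)); rewrite subrr nm0; lra.
    have := @disk_lip _ _ _ 0 (3 * r) B 0 y Hy.
    rewrite !subr0 nm0; apply => //; last lra.
    by move=> w; rewrite subr0 => hw; exact: By.
  - by rewrite subr0.
have lipx x : nm x < 2 * r -> nm (fx x 0 - fx 0 0) <= 16 * M / r ^+ 2 * nm x.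
  move=> h1; have h00 : nm (0 : C) < 4 * r by rewrite nm0; lra.
  have := @der_lip _ _ _ 0 M r 0 x (hx 0 h00) r0.
  rewrite !subr0 nm0; apply => //; last lra.
  by move=> z; rewrite subr0 => hz; exact: HM.
pose L := 16 * M / r ^+ 2 + 4 * B / r.
have q1 : 0 <= 16 * M / r ^+ 2.
  by apply: divr_ge0; [exact: mulr_ge0|apply: exprn_ge0; exact: ltW].
have q2 : 0 <= 4 * B / r by apply: divr_ge0; [exact: mulr_ge0|exact: ltW].
have L0 : 0 <= L by exact: addr_ge0.
exists (Num.min r (e / (2 * (1 + L)))).
  by rewrite lt_min r0 div2_gt0//; lra.
move=> x y; rewrite !lt_min !ltr_pdivlMr; try lra.
move=> /andP[x1 x2] /andP[y1 y2].
have a1 := lipx x ltac:(lra); have a2 := lipy x y ltac:(lra) ltac:(lra).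
have := nmD (fx x y - fx x 0) (fx x 0 - fx 0 0); rewrite addrA subrK.
have E : 4 * (B * nm y) / r = 4 * B / r * nm y by ring.
move: a1 a2 x2 y2; rewrite E /L.
move: q1 q2; set u := 16 * M / _; set v := 4 * B / r => q1 q2.
have := nm_ge0 x; have := nm_ge0 y; nra.
Qed.

(* Strict differentiability at [(0, 0)]. *)
Definition sdiff f (a b : C) := forall e : R, 0 < e -> exists2 d : R, 0 < d &
  forall x y x' y', nm x < d -> nm y < d -> nm x' < d -> nm y' < d ->
  nm (f x' y' - f x y - a * (x' - x) - b * (y' - y)) <=
    e * (nm (x' - x) + nm (y' - y)).

(** The increment is split into one leg along each axis; on each leg the function minus its linear
    part has a small derivative, by continuity of the partials. *)
Lemma hol2_sdiff f fx fy rho : 0 < rho -> hol2 f fx fy rho ->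
  sdiff f (fx 0 0) (fy 0 0).
Proof.
move=> rho0 H e e0.
have [d1 d10 h1] := partial_continuous rho0 H e0.
have [d2 d20 h2] := partial_continuous rho0 (hol2_swap H) e0.
pose d := Num.min rho (Num.min d1 d2).
have d0 : 0 < d by rewrite !lt_min rho0 d10.
have [dr dd1 dd2] : [/\ d <= rho, d <= d1 & d <= d2].
  by rewrite /d !ge_min !lexx !orbT.
exists d => // x y x' y' hx hy hx' hy'.
have A1 : nm ((f x' y - fx 0 0 * x') - (f x y - fx 0 0 * x)) <= e * nm (x' - x).
  have Hx : hol (fun x => f x y - fx 0 0 * x) (fun x => fx x y - fx 0 0) 0 d.
    apply: holB.
      by apply: (hol_sub (hol2_fix H _)); rewrite ?subrr ?nm0; lra.
    by move=> z _; have := cderZ (fx 0 0) (cder_id z); rewrite mulr1.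
  apply: (disk_lip Hx); rewrite ?subr0// => z; rewrite subr0 => hz.
  by apply: h1; lra.
have A2 : nm ((f x' y' - fy 0 0 * y') - (f x' y - fy 0 0 * y)) <= e * nm (y' - y).
  have Hy : hol (fun y => f x' y - fy 0 0 * y) (fun y => fy x' y - fy 0 0) 0 d.
    apply: holB.
      by apply: (hol_sub (hol2_fix (hol2_swap H) _)); rewrite ?subrr ?nm0; lra.
    by move=> z _; have := cderZ (fy 0 0) (cder_id z); rewrite mulr1.
  apply: (disk_lip Hy); rewrite ?subr0// => z; rewrite subr0 => hz.
  by apply: h2; lra.
move: A1 A2; set u := (X in nm X <= _ -> _); set v := (X in _ -> nm X <= _ -> _).
rewrite (_ : f x' y' - _ - _ - _ = u + v); last by rewrite /u /v; ring.
by have := nmD u v; lra.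
Qed.

Lemma sdiffD f g a b a' b' : sdiff f a b -> sdiff g a' b' ->
  sdiff (fun x y => f x y + g x y) (a + a') (b + b').
Proof.
move=> F G e e0.
have [d d0 hd] := F _ (half_gt0 e0); have [d' d'0 hd'] := G _ (half_gt0 e0).
exists (Num.min d d'); first by rewrite lt_min d0.
move=> x y x' y'; rewrite !lt_min.
move=> /andP[x1 x2] /andP[y1 y2] /andP[x3 x4] /andP[y3 y4].
have := hd x y x' y' x1 y1 x3 y3; have := hd' x y x' y' x2 y2 x4 y4.
set u := (X in nm X <= _ -> _); set v := (X in _ -> nm X <= _ -> _).
rewrite (_ : f x' y' + _ - _ - _ - _ = u + v); last by rewrite /u /v; ring.
by have := nmD u v; lra.
Qed.

Lemma sdiffZ f a b c : sdiff f a b -> sdiff (fun x y => c * f x y) (c * a) (c * b).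
Proof.
move=> F e e0; have nc := nm_ge0 c.
have [d d0 hd] := F (e / (1 + nm c)) ltac:(rewrite divr_gt0//; lra).
exists d => // x y x' y' h1 h2 h3 h4.
have := hd x y x' y' h1 h2 h3 h4; set u := (X in nm X <= _ -> _).
rewrite (_ : c * f x' y' - _ - _ - _ = c * u); last by rewrite /u; ring.
move=> hu; rewrite nmM.
apply: (@le_trans _ _ ((1 + nm c) * (e / (1 + nm c) * (nm (x' - x) + nm (y' - y))))).
  by apply: ler_pM; rewrite ?nm_ge0//; lra.
by rewrite le_eqVlt; apply/orP; left; apply/eqP; field; lra.
Qed.

(** * Quantitative inversion of maps close to the identity *)

Section InverseCurve.
Variables (F1 F2 : C -> C -> C) (r : R).
Hypothesis r0 : 0 < r.
Hypothesis near_id : forall x y x' y', nm x + nm y <= r -> nm x' + nm y' <= r ->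
  nm (F1 x' y' - F1 x y - (x' - x)) + nm (F2 x' y' - F2 x y - (y' - y)) <=
  (nm (x' - x) + nm (y' - y)) / 2.

Lemma near_id_lip x y x' y' : nm x + nm y <= r -> nm x' + nm y' <= r ->
  nm (x' - x) + nm (y' - y) <=
  2 * (nm (F1 x' y' - F1 x y) + nm (F2 x' y' - F2 x y)).
Proof.
move=> h h'; have := near_id h h'.
have := nm_subl (x' - x) (F1 x' y' - F1 x y).
have := nm_subl (y' - y) (F2 x' y' - F2 x y).
rewrite [nm (_ - _ - (F1 _ _ - _))]nmBC [nm (_ - _ - (F2 _ _ - _))]nmBC; lra.
Qed.

(** A solution is a fixed point of the identity minus [(F1, F2)] plus [(c1, c2)], a contraction by
    [near_id]. *)
Lemma near_id_solve c1 c2 : nm (F1 0 0 - c1) + nm (F2 0 0 - c2) <= r / 4 ->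
  exists x y, [/\ nm x + nm y <= r / 2, F1 x y = c1 & F2 x y = c2].
Proof.
move=> hc.
have [|||x [y [h1 h2 h3]]] := @contraction2 R (fun x y => x - F1 x y + c1)
   (fun x y => y - F2 x y + c2) (r / 2).
- by rewrite divr_ge0// ltW.
- have rr : r / 2 <= r by move: r0; lra.
  move=> x y x' y' h h'; have := near_id (le_trans h rr) (le_trans h' rr).
  congr (_ <= _); congr (_ + _); rewrite -nmN; congr nm; ring.
- rewrite !sub0r ![- _ + _]addrC [nm (c1 - _)]nmBC [nm (c2 - _)]nmBC; lra.
exists x, y; split => //.
  by have := congr1 (fun z => x + c1 - z) h2; rewrite (_ : _ - (_ + _) = F1 x y);
    [move=> ->; ring|ring].
by have := congr1 (fun z => y + c2 - z) h3; rewrite (_ : _ - (_ + _) = F2 x y);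
    [move=> ->; ring|ring].
Qed.

(** The lower bound of [near_id_lip] passes to the differential, which is therefore injective. *)
Lemma near_id_det x y a1 b1 a2 b2 : nm x + nm y <= r / 2 ->
  cder2 F1 x y a1 b1 -> cder2 F2 x y a2 b2 -> a1 * b2 - a2 * b1 != 0.
Proof.
move=> hxy D1 D2.
have low h k : nm h + nm k <= 4 * (nm (a1 * h + b1 * k) + nm (a2 * h + b2 * k)).
  have [d1 d10 h1] := D1 (1 / 8) ltac:(by rewrite divr_gt0).
  have [d2 d20 h2] := D2 (1 / 8) ltac:(by rewrite divr_gt0).
  pose N := nm h + nm k.
  have N0 : 0 <= N by rewrite addr_ge0 ?nm_ge0.
  pose d := Num.min (r / 2) (Num.min d1 d2).
  have d0 : 0 < d by rewrite !lt_min half_gt0//= d10.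
  have [dr dd1 dd2] : [/\ d <= r / 2, d <= d1 & d <= d2].
    by rewrite /d !ge_min !lexx !orbT.
  (* By homogeneity [(h, k)] may be shrunk until the linear approximations hold with error factor
     1/8. *)
  pose t := d / (1 + N).
  have t0 : 0 < t by rewrite divr_gt0//; lra.
  have tN : t * N < d.
    by rewrite /t mulrAC ltr_pdivrMr; nra.
  have nt z : nm (t%:C * z) = t * nm z by rewrite nmM nm_real ger0_norm// ltW.
  have hk : nm (t%:C * h) + nm (t%:C * k) < d by rewrite !nt -mulrDr.
  have nh := nm_ge0 (t%:C * h); have nk := nm_ge0 (t%:C * k).
  have := @near_id_lip x y (x + t%:C * h) (y + t%:C * k) ltac:(lra).
  have e1 := nmD x (t%:C * h); have e2 := nmD y (t%:C * k).
  rewrite ![_ + _ * _ - _]addrAC !subrr !add0r => /(_ ltac:(lra)) L.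
  have := h1 (t%:C * h) (t%:C * k) ltac:(lra) ltac:(lra).
  have := h2 (t%:C * h) (t%:C * k) ltac:(lra) ltac:(lra).
  have := nm_subl (F1 (x + t%:C * h) (y + t%:C * k) - F1 x y)
    (t%:C * (a1 * h + b1 * k)).
  have := nm_subl (F2 (x + t%:C * h) (y + t%:C * k) - F2 x y)
    (t%:C * (a2 * h + b2 * k)).
  have E a b : a * (t%:C * h) + b * (t%:C * k) = t%:C * (a * h + b * k) by ring.
  rewrite -!(addrA _ (- (_ * _)) (- (_ * _))) -!opprD !E.
  move: L; rewrite !nt; have := nm_ge0 h; have := nm_ge0 k.
  set A := nm (a1 * h + b1 * k); set B := nm (a2 * h + b2 * k).
  set U := nm (F1 _ _ - _); set V := nm (F2 _ _ - _).
  move=> ? ? ? ? ? ? ?.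
  rewrite -(ler_pM2l t0) mulrDr; lra.
apply/negP => /eqP det0.
(* If the determinant is 0, the vectors [(b1, - a1)] and [(b2, - a2)] lie in the kernel, so all four
   entries vanish, against [low 1 0]. *)
have := low b1 (- a1).
have -> : a1 * b1 + b1 * - a1 = 0 by ring.
have -> : a2 * b1 + b2 * - a1 = - (a1 * b2 - a2 * b1) by ring.
rewrite det0 oppr0 !nm0 !addr0 mulr0 nmN => h1.
have := low b2 (- a2).
have -> : a2 * b2 + b2 * - a2 = 0 by ring.
have -> : a1 * b2 + b1 * - a2 = a1 * b2 - a2 * b1 by ring.
rewrite det0 !nm0 !addr0 mulr0 nmN => h2.
have := low 1 0; rewrite !mulr0 !mulr1 !addr0 nm0 nm1.
have := nm_ge0 a1; have := nm_ge0 b1; have := nm_ge0 a2; have := nm_ge0 b2; lra.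
Qed.

(** Cramer's rule for the differentiated equations. By [near_id_lip] the increments of [p] and [q]
    are [O(h)], which makes the error terms [o(h)]. *)
Lemma near_id_curve_der (p q c1 c2 : C -> C) z rho a1 b1 a2 b2 c1' c2' :
  nm z < rho ->
  (forall z, nm z < rho ->
    [/\ nm (p z) + nm (q z) <= r / 2, F1 (p z) (q z) = c1 z & F2 (p z) (q z) = c2 z]) ->
  cder2 F1 (p z) (q z) a1 b1 -> cder2 F2 (p z) (q z) a2 b2 ->
  cder c1 z c1' -> cder c2 z c2' ->
  cder p z ((b2 * c1' - b1 * c2') / (a1 * b2 - a2 * b1)).
Proof.
move=> hz Hpq D1 D2 Dc1 Dc2.
have [hpq E1 E2] := Hpq z hz.
have det := near_id_det hpq D1 D2.
set D := a1 * b2 - a2 * b1 in det *.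
have nD : 0 < nm D by rewrite nm_gt0.
pose L := 2 * (2 + nm c1' + nm c2').
have nc1 := nm_ge0 c1'; have nc2 := nm_ge0 c2'.
have L0 : 0 < L by rewrite /L; lra.
have nb1 := nm_ge0 b1; have nb2 := nm_ge0 b2.
move=> e e0.
pose W := 2 * (1 + nm b1 + nm b2) * (1 + L).
have W0 : 0 < W by rewrite /W; nra.
pose e1 := Num.min 1 (e * nm D / W).
have e10 : 0 < e1 by rewrite lt_min ltr01 divr_gt0// mulr_gt0.
have e11 : e1 <= 1 by rewrite ge_min lexx.
have e1W : e1 * W <= e * nm D.
  by rewrite -ler_pdivlMr// ge_min lexx orbT.
have [d1 d10 h1] := D1 _ e10; have [d2 d20 h2] := D2 _ e10.
have [d3 d30 h3] := Dc1 _ e10; have [d4 d40 h4] := Dc2 _ e10.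
pose d := Num.min (Num.min (d1 / L) (d2 / L)) (Num.min (rho - nm z) (Num.min d3 d4)).
have d0 : 0 < d by rewrite !lt_min !divr_gt0//= subr_gt0 hz d30.
exists d => // h; rewrite !lt_min !ltr_pdivlMr//.
move=> /andP[/andP[k1 k2] /andP[k5 /andP[k3 k4]]].
have hzh : nm (z + h) < rho by have := nmD z h; lra.
have [hpq' E1' E2'] := Hpq _ hzh.
have rr : r / 2 <= r by move: r0; lra.
have := near_id_lip (le_trans hpq rr) (le_trans hpq' rr).
rewrite E1 E2 E1' E2'.
have g3 := h3 _ k3; have g4 := h4 _ k4.
have f3 := nm_subl (c1 (z + h) - c1 z) (c1' * h).
have f4 := nm_subl (c2 (z + h) - c2 z) (c2' * h).
move: f3 f4; rewrite !nmM => f3 f4 l.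
have nh := nm_ge0 h.
have lip : nm (p (z + h) - p z) + nm (q (z + h) - q z) <= L * nm h.
  by rewrite /L; nra.
have np := nm_ge0 (p (z + h) - p z); have nq := nm_ge0 (q (z + h) - q z).
have := h1 (p (z + h) - p z) (q (z + h) - q z) ltac:(lra) ltac:(lra).
have := h2 (p (z + h) - p z) (q (z + h) - q z) ltac:(lra) ltac:(lra).
rewrite ![_ z + (_ - _)]addrC !subrK E1 E2 E1' E2'.
set r2 := (X in nm X <= _ -> _); set r1 := (X in _ -> nm X <= _ -> _).
move: g3 g4; set s1 := (X in nm X <= _ -> _); set s2 := (X in _ -> nm X <= _ -> _).
move=> g3 g4 g2 g1.
have -> : p (z + h) - p z - (b2 * c1' - b1 * c2') / D * h =
   (b2 * s1 - b1 * s2 - b2 * r1 + b1 * r2) / D.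
  apply: (mulIf det); rewrite divfK// mulrBl mulrAC divfK// /D.
  by rewrite /s1 /s2 /r1 /r2; ring.
rewrite nmM nmV ler_pdivrMr//.
have := nmD (b2 * s1 - b1 * s2 - b2 * r1) (b1 * r2).
have := nmB (b2 * s1 - b1 * s2) (b2 * r1).
have := nmB (b2 * s1) (b1 * s2); rewrite !nmM => t1 t2 t3.
have m1 : nm b2 * nm s1 <= nm b2 * (e1 * nm h) by rewrite ler_wpM2l.
have m2 : nm b1 * nm s2 <= nm b1 * (e1 * nm h) by rewrite ler_wpM2l.
have m3 : nm b2 * nm r1 <= nm b2 * (e1 * (L * nm h)).
  by rewrite ler_wpM2l// (le_trans g1)// ler_wpM2l// ltW.
have m4 : nm b1 * nm r2 <= nm b1 * (e1 * (L * nm h)).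
  by rewrite ler_wpM2l// (le_trans g2)// ler_wpM2l// ltW.
apply: (@le_trans _ _ (e1 * W * nm h)).
  have -> : e1 * W * nm h = 2 * ((1 + nm b1 + nm b2) * (1 + L) * (e1 * nm h)).
    by rewrite /W; ring.
  have : 0 <= e1 * nm h by rewrite mulr_ge0// ltW.
  move: m1 m2 m3 m4; rewrite [e1 * (L * _)]mulrCA; set X := e1 * nm h.
  move=> m1 m2 m3 m4 X0.
  have LX : 0 <= L * X by rewrite mulr_ge0// ltW.
  have := mulr_ge0 nb1 X0; have := mulr_ge0 nb2 X0.
  by have := mulr_ge0 nb1 LX; have := mulr_ge0 nb2 LX; lra.
by rewrite [leRHS]mulrAC ler_wpM2r.
Qed.

End InverseCurve.

Lemma near_id_curve (F1 F2 : C -> C -> C) (r : R) (c1 c2 : C -> C) rho : 0 < r ->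
  (forall x y x' y', nm x + nm y <= r -> nm x' + nm y' <= r ->
  nm (F1 x' y' - F1 x y - (x' - x)) + nm (F2 x' y' - F2 x y - (y' - y)) <=
  (nm (x' - x) + nm (y' - y)) / 2) ->
  (forall x y, nm x + nm y <= r / 2 -> exists a b, cder2 F1 x y a b) ->
  (forall x y, nm x + nm y <= r / 2 -> exists a b, cder2 F2 x y a b) ->
  (forall z, nm z < rho -> exists d, cder c1 z d) ->
  (forall z, nm z < rho -> exists d, cder c2 z d) ->
  (forall z, nm z < rho -> nm (F1 0 0 - c1 z) + nm (F2 0 0 - c2 z) <= r / 4) ->
  exists p q : C -> C, forall z, nm z < rho ->
    [/\ nm (p z) + nm (q z) <= r / 2, F1 (p z) (q z) = c1 z, F2 (p z) (q z) = c2 z,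
      exists d, cder p z d & exists d, cder q z d].
Proof.
move=> r0 near_id D1 D2 Dc1 Dc2 hc.
have [s hs] := @choice C (C * C) (fun z w => nm z < rho ->
  [/\ nm w.1 + nm w.2 <= r / 2, F1 w.1 w.2 = c1 z & F2 w.1 w.2 = c2 z]) ltac:(
  by move=> z; have [hz|] := ltP (nm z) rho; [
    have [x [y h]] := near_id_solve r0 near_id (hc z hz); exists (x, y) | exists (0, 0)]).
exists (fun z => (s z).1), (fun z => (s z).2) => z hz.
have [h1 h2 h3] := hs z hz.
have [a1 [b1 d1]] := D1 _ _ h1; have [a2 [b2 d2]] := D2 _ _ h1.
have [c1' e1] := Dc1 z hz; have [c2' e2] := Dc2 z hz.
split => //; first by eexists; exact: (near_id_curve_der r0 near_id hz hs d1 d2 e1 e2).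
(* Exchanging both the coordinates and the equations reduces the derivative of [q] to that of
   [p]. *)
have near_id' x y x' y' : nm x + nm y <= r -> nm x' + nm y' <= r ->
  nm (F2 y' x' - F2 y x - (x' - x)) + nm (F1 y' x' - F1 y x - (y' - y)) <=
  (nm (x' - x) + nm (y' - y)) / 2.
  rewrite [nm x + _]addrC [nm x' + _]addrC => h h'.
  by have := near_id _ _ _ _ h h'; lra.
eexists; apply: (near_id_curve_der r0 near_id' hz _ (cder2_swap d2) (cder2_swap d1) e2 e1).
by move=> w hw; have [e3 e4 e5] := hs w hw; split; [rewrite addrC; exact: e3|exact: e5|exact: e4].
Qed.

End TwoVariables.

(** * A second solution of an equation of order greater than 1 *)

Section SecondRoot.
Variable R : realType.
Local Notation C := R[i].

Lemma nontrivial_unity_root n : (1 < n)%N -> exists2 w : C, w ^+ n = 1 & w != 1.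
Proof.
case: n => // n n1.
(* A root of [1 + X + ... + X ^ n]; it differs from 1, where this sum is [n.+1]. *)
have [w hw] := @solve_monicpoly C n (fun=> -1) n1.
have S0 : \sum_(i < n.+1) w ^+ i = 0.
  rewrite big_ord_recr /= hw -big_split /=; apply: big1 => i _.
  by rewrite mulN1r subrr.
exists w; first by apply/eqP; rewrite -subr_eq0 subrX1 S0 mulr0.
apply/eqP => w1; move: S0; rewrite w1.
under eq_bigr do rewrite expr1n.
by rewrite sumr_const card_ord => /eqP; rewrite pnatr_eq0.
Qed.

Lemma power_sdiff n (e : R) : (0 < n)%N -> 0 < e -> exists2 d : R, 0 < d &
  forall x y : C, nm x < d -> nm y < d ->
    nm (y - x - ((1 + y) ^+ n - (1 + x) ^+ n) / n%:R) <= e * nm (y - x).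
Proof.
move=> n0 e0.
have n0' : n%:R != 0 :> C by rewrite pnatr_eq0 -lt0n.
have D z : cder (fun z : C => (1 + z) ^+ n) z (n%:R * (1 + z) ^+ n.-1).
  have := @cder_comp R (fun z => z ^+ n) (fun z => 1 + z) z _ 1 _ (cderXn n (1 + z)).
  by rewrite mulr1; apply; have := cderD (cder_cst 1 z) (cder_id z); rewrite add0r.
have [d d0 hd] : exists2 d : R, 0 < d & forall z : C, nm z < d ->
    nm (1 - (1 + z) ^+ n.-1) <= e.
  have D1 : cder (fun z : C => 1 + z) 0 1.
    by have := cderD (cder_cst 1 (0 : C)) (cder_id 0); rewrite add0r.
  have [d d0 hd] := cder_cont (cder_comp D1 (cderXn n.-1 (1 + 0))) e0.
  exists d => // z hz; have := hd z; rewrite subr0 addr0 expr1n nmBC => /(_ hz).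
  exact: ltW.
exists d => // x y hx hy.
have H : hol (fun z : C => z - (1 + z) ^+ n / n%:R) (fun z => 1 - (1 + z) ^+ n.-1) 0 d.
  move=> z _; apply: cderB; first exact: cder_id.
  have := cderZ n%:R^-1 (D z); rewrite mulrA mulVf// mul1r.
  by apply: cder_ext => w; rewrite mulrC.
have := @disk_lip R _ _ 0 d e x y H; rewrite !subr0.
move=> /(_ _ hx hy); rewrite (_ : _ - _ - (_ - _) =
  y - x - ((1 + y) ^+ n - (1 + x) ^+ n) / n%:R); last by field.
by apply => z; rewrite subr0; exact: hd.
Qed.

(* [t'] is found near [w * t], where [w] is a nontrivial n-th root of unity. *)
Lemma second_root n (al : C) (L rho : R) : (1 < n)%N -> al != 0 -> 0 <= L ->
  0 < rho -> exists2 d : R, 0 < d & forall A : C -> C, A 0 = al ->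
  (forall z w, nm z < rho -> nm w < rho -> nm (A z - A w) <= L * nm (z - w)) ->
  forall t : C, t != 0 -> nm t < d -> exists t' : C,
    [/\ t' != t, nm t' <= 2 * nm t & t' ^+ n * A t' = t ^+ n * A t].
Proof.
move=> n1 al0 L0 rho0.
have [w wn w1] := nontrivial_unity_root n1.
have n0 : (0 < n)%N by exact: ltn_trans n1.
have nw : nm w = 1.
  by apply/eqP; rewrite -(@pexpr_eq1 _ _ n)// ?nm_ge0// -nmX wn nm1.
pose th := nm (1 - w); have th0 : 0 < th by rewrite nm_gt0 subr_eq0 eq_sym.
have [d d0 hd] := power_sdiff n0 (divr_gt0 ltr01 (ltr0n R 8)).
have [e [e0 ed eth e1]] : exists e : R, [/\ 0 < e, e < d, e < th & e < 1].
  exists (Num.min d (Num.min th 1) / 2).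
  have : 0 < Num.min d (Num.min th 1) by rewrite !lt_min d0 th0 ltr01.
  have : Num.min d (Num.min th 1) <= d by rewrite ge_min lexx.
  have : Num.min d (Num.min th 1) <= th by rewrite !ge_min lexx !orbT.
  have : Num.min d (Num.min th 1) <= 1 by rewrite !ge_min lexx !orbT.
  by move=> *; split; lra.
have a0 : 0 < nm al by rewrite nm_gt0.
(* [W] makes [q] below, the relative variation of [A] at the scale of [t], at most
   [e / (32 * 2 ^ n)]. *)
pose W := 2 ^+ n * (1 + L) * 32 / nm al.
have p2 : 2 <= 2 ^+ n :> R by rewrite -[leLHS]expr1 ler_weXn2l// ler1n.
have W0 : 0 < W by rewrite divr_gt0// !mulr_gt0 ?exprn_gt0//; lra.
exists (Num.min (rho / 2) (e / W)); first by rewrite lt_min half_gt0//= divr_gt0.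
move=> A A0 HA t t0; rewrite lt_min (ltr_pdivlMr _ _ W0) => /andP[trho tW].
pose q := L * nm t / nm al.
have q0 : 0 <= q by rewrite divr_ge0 ?mulr_ge0 ?nm_ge0.
have q2 : 2 ^+ n * q * 32 <= e.
  apply: le_trans (ltW tW).
  have -> : nm t * W = 2 ^+ n * (nm t * (1 + L) / nm al) * 32 by rewrite /W; ring.
  rewrite ler_wpM2r// ler_wpM2l ?exprn_ge0// /q ler_wpM2r ?invr_ge0 ?nm_ge0//.
  by have := nm_ge0 t; lra.
have qe : q * 64 <= e by have := ler_wpM2r q0 p2; lra.
pose P (x : C) : C := (1 + x) ^+ n.
pose s (x : C) : C := w * t * (1 + x).
(* Newton's map with the derivative frozen at [n al], for the unknown [x] in [t' = w t (1 + x)];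
   since [w ^ n = 1], its fixed points solve the equation. *)
pose T (x : C) : C := x - (P x * A (s x) - A t) / (n%:R * al).
have nn0 : n%:R != 0 :> C by rewrite pnatr_eq0 -lt0n.
have n1R : 1 <= n%:R :> R by rewrite ler1n.
have s2 x : nm x <= e -> nm (s x) <= 2 * nm t.
  move=> hx; rewrite /s !nmM nw mul1r mulrC.
  by have := nmD 1 x; rewrite nm1; have := nm_ge0 t; nra.
have srho x : nm x <= e -> nm (s x) < rho by move=> /s2; lra.
have P2 x : nm x <= e -> nm (P x) <= 2 ^+ n.
  move=> hx; rewrite nmX lerXn2r ?nnegrE ?nm_ge0//.
  by have := nmD 1 x; rewrite nm1; lra.
have [||x hx Tx] := @contraction1 R T e (ltW e0).
- move=> x y hx hy.
  have -> : T y - T x = (y - x - (P y - P x) / n%:R) -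
     (P y - P x) / n%:R * ((A (s y) - al) / al) -
     P x / n%:R * ((A (s y) - A (s x)) / al).
    by rewrite /T; field; rewrite ?nn0 ?al0.
  have g1 := hd x y ltac:(lra) ltac:(lra).
  rewrite -/(P y) -/(P x) in g1.
  have g2 : nm ((P y - P x) / n%:R) <= 9 / 8 * nm (y - x).
    by have := nm_subl ((P y - P x) / n%:R) (y - x); rewrite [nm (_ / _ - _)]nmBC; lra.
  have g3 : nm ((A (s y) - al) / al) <= 1 / 16.
    rewrite nmM nmV -A0.
    have h := HA (s y) 0 (srho _ hy) ltac:(rewrite nm0; lra).
    rewrite subr0 in h; have := s2 _ hy => h2.
    apply: (@le_trans _ _ (2 * q)); last lra.
    rewrite A0 /q mulrA ler_wpM2r ?invr_ge0 ?nm_ge0// (le_trans _ (_ : L * (2 * nm t) <= _))//.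
      by rewrite -A0; apply: (le_trans h); rewrite ler_wpM2l.
    by rewrite mulrCA.
  have g4 : nm (P x / n%:R * ((A (s y) - A (s x)) / al)) <= 1 / 8 * nm (y - x).
    rewrite !nmM !nmV nm_natr.
    have h := HA (s y) (s x) (srho _ hy) (srho _ hx).
    have sE : s y - s x = w * t * (y - x) by rewrite /s; ring.
    rewrite sE !nmM nw mul1r in h.
    apply: (@le_trans _ _ (2 ^+ n * (q * nm (y - x)))); last first.
      by rewrite mulrA ler_wpM2r ?nm_ge0//; lra.
    apply: ler_pM; rewrite ?mulr_ge0 ?invr_ge0 ?nm_ge0 ?ler0n//.
      by rewrite ler_pdivrMr ?ltr0n// (le_trans (P2 _ hx))// ler_peMr// exprn_ge0.
    by rewrite /q mulrAC ler_wpM2r ?invr_ge0 ?nm_ge0// -mulrA.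
  apply: (le_trans (nmB _ _)); apply: (le_trans (lerD (nmB _ _) (lexx _))).
  rewrite [nm (_ / _ * (_ / al))]nmM.
  have := nm_ge0 ((A (s y) - al) / al); have := nm_ge0 ((P y - P x) / n%:R).
  have := nm_ge0 (y - x); nra.
- have -> : T 0 = (A t - A (w * t)) / (n%:R * al).
    by rewrite /T /P /s !addr0 expr1n !mulr1 mul1r; field; rewrite ?nn0 ?al0.
  have h := HA t (w * t) ltac:(lra) ltac:(rewrite nmM nw; lra).
  have hh : nm (t - w * t) <= 2 * nm t.
    by have := nmB t (w * t); rewrite nmM nw; lra.
  rewrite nmM nmV nmM nm_natr invfM mulrA mulrAC.
  apply: (@le_trans _ _ (2 * q)); last lra.
  rewrite ler_pdivrMr ?ltr0n//.
  apply: (@le_trans _ _ (2 * q * 1)); last by rewrite ler_wpM2l// mulr_ge0.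
  rewrite mulr1 /q mulrA ler_wpM2r ?invr_ge0 ?nm_ge0//.
  by apply: (le_trans h); rewrite mulrCA ler_wpM2l.
exists (s x); split.
(* Equality would give [nm (1 - w) = nm x <= e], against the choice of [e]. *)
- apply/eqP => st.
  have : w * (1 + x) = 1 by apply: (mulfI t0); rewrite mulr1 -[RHS]st /s; ring.
  move=> wx; have : 1 - w = w * x by rewrite -wx; ring.
  by move=> E; have := congr1 (@nm R) E; rewrite (nmM w x) nw mul1r -/th; lra.
- exact: s2.
have : (P x * A (s x) - A t) / (n%:R * al) = 0.
  by rewrite -[LHS](subKr x) -/(T x) Tx subrr.
move=> /eqP; rewrite mulf_eq0 invr_eq0 mulf_eq0 (negPf nn0) (negPf al0) !orbF subr_eq0.
move=> /eqP PA.
have -> : s x ^+ n = t ^+ n * P x by rewrite /s !exprMn wn mul1r.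
by rewrite -mulrA PA.
Qed.

End SecondRoot.

(** * Curves near the cusp locus *)

Section SlopeFacts.
Variable R : realType.
Local Notation C := R[i].

Lemma hol_exists (f : C -> C) a (rho : R) :
  (forall z, nm (z - a) < rho -> exists d, cder f z d) -> exists f', hol f f' a rho.
Proof.
move=> H; exists (fun z => xget 0 [set d | cder f z d]) => z /H[d hd].
by case: xgetP => [d' -> //|/(_ d)]; case.
Qed.

Lemma hol_lip_near (f f' : C -> C) (rho : R) : 0 < rho -> hol f f' 0 rho ->
  exists L r : R, [/\ 0 <= L, 0 < r & forall z w, nm z < r -> nm w < r ->
    nm (f z - f w) <= L * nm (z - w)].
Proof.
move=> rho0 H; have [|M [r [r0 rr HM]]] := hol_locally_bounded (z := 0) H.
  by rewrite subrr nm0.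
have Hr : hol f f' 0 (4 * r) by apply: (hol_sub H).
have M0 : 0 <= M by apply: le_trans (HM 0 _); rewrite ?nm_ge0// subrr nm0; lra.
exists (4 * M / r), (3 * r); split.
- by rewrite divr_ge0 ?mulr_ge0// ltW.
- by rewrite mulr_gt0.
move=> z w hz hw; have H3 : hol f f' 0 (3 * r).
  by apply: (hol_sub Hr); rewrite subrr nm0; lra.
apply: (disk_lip H3); rewrite ?subr0// => x; rewrite subr0 => hx.
by apply: (der_bound Hr) => //; rewrite subr0.
Qed.

Lemma intr_realC (p : int) : p%:~R = (p%:~R : R)%:C :> C.
Proof. by rewrite rmorph_int. Qed.

(** Imaginary parts eliminate [p]. Through this bound a non-real cusp shape keeps [K] bounded over
    all slopes. *)
Lemma slope_den_bound (tau : C) (p q : int) :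
  `|q%:~R : R| * `|complex.Im tau| <= nm (p%:~R + q%:~R * tau).
Proof.
rewrite -normrM; apply: le_trans (Im_le_nm _); rewrite Im_add !intr_realC.
by case: tau => a b /=; rewrite mul0r addr0 add0r.
Qed.

Lemma slope_den_neq0 (tau : C) (p q : int) : complex.Im tau != 0 ->
  (p, q) <> (0, 0) -> p%:~R + q%:~R * tau != 0.
Proof.
move=> im pq; apply/eqP => D0; apply: pq.
have := slope_den_bound tau p q; rewrite D0 nm0 -normrM normr_le0 mulf_eq0 (negPf im) orbF.
rewrite intr_eq0 => /eqP q0; move: D0; rewrite q0 mul0r addr0 => /eqP.
by rewrite intr_eq0 => /eqP ->.
Qed.

Lemma slope_ratio_bound (tau : C) (p q : int) : complex.Im tau != 0 ->
  (p, q) <> (0, 0) -> nm (q%:~R / (p%:~R + q%:~R * tau)) <= `|complex.Im tau|^-1.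
Proof.
move=> im pq; have nD : 0 < nm (p%:~R + q%:~R * tau) by rewrite nm_gt0 slope_den_neq0.
rewrite nmM nmV ler_pdivrMr// mulrC -ler_pdivrMr ?invr_gt0 ?normr_gt0// invrK.
by apply: le_trans (slope_den_bound tau p q); rewrite intr_realC nm_real.
Qed.

End SlopeFacts.

(** * The cusp curve and the filling equations *)

Section CuspPerturbation.
Variable R : realType.
Local Notation C := R[i].
Variables (u ux uy v vx vy g gx gy : C -> C -> C) (rho : R) (tau : C).
Hypothesis rho0 : 0 < rho.
Hypothesis Hu : hol2 u ux uy rho.
Hypothesis Hv : hol2 v vx vy rho.
Hypothesis Hg : hol2 g gx gy rho.
Hypothesis u00 : u 0 0 = 0.
Hypothesis g00 : g 0 0 = 0.
Hypothesis gx00 : gx 0 0 = 0.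
Hypothesis gy00 : gy 0 0 = 1.
Hypothesis HK : forall e : R, 0 < e -> exists2 d : R, 0 < d & forall x y,
  nm x < d -> nm y < d -> nm (v x y - tau * u x y) <= e * nm (u x y).
Hypothesis tauI : complex.Im tau != 0.

Lemma v00 : v 0 0 = 0.
Proof.
have [d d0 hd] := HK ltr01; apply: nm_small => e e0.
have := hd 0 0; rewrite nm0 u00 mulr0 subr0 nm0 mulr0 => /(_ d0 d0) h.
exact: le_trans h (ltW e0).
Qed.

(** The implicit function theorem for [g = 0], by inversion of [(x, g)], whose differential at the
    origin is the identity. *)
Lemma slice : exists (r : R) (Y : C -> C), [/\ 0 < r, r <= rho,
  forall z, nm z < r -> [/\ g z (Y z) = 0, nm (Y z) <= nm z & exists d, cder Y z d] &
  forall x y, nm x < r -> nm y < r -> g x y = 0 -> y = Y x].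
Proof.
have [d d0 hd] := hol2_sdiff rho0 Hg (half_gt0 ltr01).
pose r := Num.min d rho / 2.
have m0 : 0 < Num.min d rho by rewrite lt_min d0.
have md : Num.min d rho <= d by rewrite ge_min lexx.
have mr : Num.min d rho <= rho by rewrite ge_min lexx orbT.
have r0 : 0 < r by rewrite half_gt0.
have inb x y : nm x + nm y <= r -> [/\ nm x < d, nm y < d, nm x < rho & nm y < rho].
  by rewrite /r => h; have := nm_ge0 (x : C); have := nm_ge0 (y : C); split; lra.
have nid x y x' y' : nm x + nm y <= r -> nm x' + nm y' <= r ->
  nm (x' - x - (x' - x)) + nm (g x' y' - g x y - (y' - y)) <=
  (nm (x' - x) + nm (y' - y)) / 2.
  move=> /inb[h1 h2 _ _] /inb[h3 h4 _ _]; rewrite subrr nm0 add0r.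
  by have := hd x y x' y' h1 h2 h3 h4; rewrite gx00 gy00 mul0r subr0 mul1r; lra.
have [||||z hz|p [Y HY]] := @near_id_curve R (fun x _ => x) g r id (fun=> 0) (r / 4) r0 nid.
- by move=> x y _; exists 1, 0; exact: cder2_fst.
- move=> x y h; have [|h1 h2 h3 h4] := inb x y; first by move: r0 h; lra.
  by exists (gx x y), (gy x y); exact: Hg.
- by move=> z _; exists 1; exact: cder_id.
- by move=> z _; exists 0; exact: cder_cst.
- by rewrite sub0r g00 subrr nm0 addr0 nmN ltW.
have r40 : 0 < r / 4 by rewrite divr_gt0.
exists (r / 4), Y; split => //; first by rewrite /r; lra.
- move=> z hz; have [h1 h2 h3 _ h5] := HY z hz; rewrite h2 in h1 h3; split => //.
  have := @near_id_lip R (fun x _ => x) g r nid 0 0 z (Y z).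
  rewrite !subr0 h3 g00 subr0 nm0 !addr0 => /(_ (ltW r0)).
  by move=> /(_ ltac:(lra)); lra.
- move=> x y hx hy gxy; have [h1 h2 h3 _ h5] := HY x hx; rewrite h2 in h1 h3.
  have := @near_id_lip R (fun x _ => x) g r nid x y x (Y x).
  rewrite gxy h3 !subrr nm0 addr0 mulr0 add0r => /(_ ltac:(lra) ltac:(lra)) h.
  by apply/eqP; rewrite eq_sym -subr_eq0 -nm_eq0 eq_le nm_ge0 h.
Qed.

(* On the curve [g = 0], parametrized by [x], [u] is [x ^ n] times a unit, and so
   is [u p + v q], uniformly in the slope.  If [n > 1], [second_root] yields a
   second point of the filled locus. *)
Lemma nondegenerate (d0 : R) (c : C) : 0 < d0 -> c != 0 ->
  (forall x y, nm x < d0 -> nm y < d0 -> u x y = 0 -> g x y = 0 -> x = 0) ->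
  (forall d : R, 0 < d -> exists (p q : int) x y,
    [/\ (p, q) <> (0, 0), nm x < d, nm y < d,
        u x y *~ p + v x y *~ q = c /\ g x y = 0 &
        forall x' y', nm x' < d0 -> nm y' < d0 ->
          u x' y' *~ p + v x' y' *~ q = c -> g x' y' = 0 -> x' = x]) ->
  ux 0 0 != 0.
Proof.
move=> d00 c0 Hzero Huniq.
have [r [Y [r0 rrho HY Yuniq]]] := slice.
have z00 : nm (0 : C) < r by rewrite nm0.
have Yle z : nm z < r -> nm (Y z) <= nm z by move=> /HY[].
have gY z : nm z < r -> g z (Y z) = 0 by move=> /HY[].
have Y0 : Y 0 = 0.
  by apply/eqP; rewrite -nm_eq0 eq_le nm_ge0 andbT; have := Yle 0 z00; rewrite nm0.
have slice_der f fx fy : hol2 f fx fy rho -> forall z, nm z < r ->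
    exists d, cder (fun t => f t (Y t)) z d.
  move=> H z hz; have [_ Yz [d hd]] := HY z hz.
  have hf : cder2 f z (Y z) (fx z (Y z)) (fy z (Y z)) by apply: H; lra.
  eexists; exact: (cder2_curve (p := fun t => t) hf (cder_id z) hd).
have [U' HU] : exists U', hol (fun t => u t (Y t)) U' 0 r.
  by apply: hol_exists => z; rewrite subr0; exact: slice_der Hu z.
have [V' HV] : exists V', hol (fun t => v t (Y t)) V' 0 r.
  by apply: hol_exists => z; rewrite subr0; exact: slice_der Hv z.
have Unz t : t != 0 -> nm t < r -> nm t < d0 -> u t (Y t) != 0.
  move=> t0 tr td; apply/negP => /eqP ut; move/eqP: t0; apply.
  by apply: (Hzero _ (Y t)) => //; [have := Yle t tr; lra|exact: gY].
have [|n [a [a' [Ha Ua a0]]]] := hol_factor r0 HU.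
  move=> d dd; pose m := Num.min d (Num.min r d0).
  have m0 : 0 < m by rewrite !lt_min dd r0.
  have [m1 m2 m3] : [/\ m <= d, m <= r & m <= d0] by rewrite /m !ge_min !lexx !orbT.
  have nm2 : nm (m / 2)%:C = m / 2 by rewrite nm_real ger0_norm// ltW// half_gt0.
  exists (m / 2)%:C; first by rewrite nm2; lra.
  by apply: Unz; rewrite -?nm_gt0 nm2; lra.
have [La [ra [La0 ra0 lipa]]] := hol_lip_near r0 Ha.
have [dK dK0 hK] := HK ltr01.
(* Since [v] is [O(u)], it is divisible by the same power of [z] along the curve. *)
have [b [b' [Hb Vb]]] : exists b b', hol b b' 0 r /\
    forall z, v z (Y z) = z ^+ n * b z.
  pose m := Num.min (Num.min dK ra) (Num.min r 1).
  have m0 : 0 < m by rewrite !lt_min dK0 ra0 r0 ltr01.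
  have [[m1 m2] m3 m4] : [/\ m <= dK /\ m <= ra, m <= r & m <= 1].
    by rewrite /m; split; [split|..]; rewrite !ge_min !lexx ?orbT.
  apply: (hol_factor_le (K := (nm tau + 1) * (nm (a 0) + La)) r0 HV m0) => z hz.
  have hYz := Yle z ltac:(lra).
  have h1 := hK z (Y z) ltac:(lra) ltac:(lra).
  have h2 := nm_subl (v z (Y z)) (tau * u z (Y z)); rewrite nmM in h2.
  have h3 : nm (v z (Y z)) <= (nm tau + 1) * nm (u z (Y z)) by lra.
  apply: (le_trans h3); rewrite -mulrA ler_wpM2l//.
    by have := nm_ge0 tau; lra.
  rewrite Ua nmM nmX mulrC ler_wpM2r ?exprn_ge0 ?nm_ge0//.
  have h4 := lipa z 0 ltac:(lra) ltac:(rewrite nm0; lra); rewrite subr0 in h4.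
  by have := nm_subl (a z) (a 0); have := nm_ge0 z; nra.
(* The relation [v - tau u = o(u)] is divided by [t ^ n] and passed to the limit at 0. *)
have b0E : b 0 = tau * a 0.
  apply/eqP; rewrite -subr_eq0; apply/eqP; apply: nm_small => e e0.
  have na0 := nm_ge0 (a 0); have nt := nm_ge0 tau.
  have z0 : nm (0 - 0 : C) < r by rewrite subrr nm0.
  pose e1 := e / (4 * (1 + nm (a 0) + nm tau)).
  have e10 : 0 < e1 by rewrite divr_gt0//; lra.
  have [d1 d10 h1] := HK e10.
  pose e2 := Num.min 1 e1.
  have e20 : 0 < e2 by rewrite lt_min ltr01.
  have [d2 d20 h2] := cder_cont (Ha 0 z0) e20.
  have [d3 d30 h3] := cder_cont (Hb 0 z0) e10.
  pose m := Num.min (Num.min d1 d2) (Num.min d3 r).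
  have m0 : 0 < m by rewrite !lt_min d10 d20 d30.
  have [[m1 m2] m3 m4] : [/\ m <= d1 /\ m <= d2, m <= d3 & m <= r].
    by rewrite /m; split; [split|..]; rewrite !ge_min !lexx ?orbT.
  pose t : C := (m / 2)%:C.
  have nmt : nm t = m / 2 by rewrite nm_real ger0_norm// ltW// half_gt0.
  have t0 : t != 0 by rewrite -nm_gt0 nmt half_gt0.
  have tY := Yle t ltac:(lra).
  have := h1 t (Y t) ltac:(lra) ltac:(lra).
  rewrite Vb Ua mulrCA -mulrBr !nmM mulrCA ler_pM2l ?nm_gt0 ?expf_neq0// => k1.
  have := h2 t; rewrite subr0 => /(_ ltac:(lra)); rewrite lt_min => /andP[k2 k2'].
  have := h3 t; rewrite subr0 => /(_ ltac:(lra)) => k3.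
  have -> : b 0 - tau * a 0 = - (b t - b 0) + (b t - tau * a t) + tau * (a t - a 0) by ring.
  apply: (le_trans (nmD3 _ _ _)); rewrite nmN nmM.
  have k4 := nm_subl (a t) (a 0).
  have eE : e = e1 * (4 * (1 + nm (a 0) + nm tau)).
    by rewrite /e1 divfK// gt_eqF//; lra.
  rewrite eE; nra.
apply/negP => /eqP ux0.
(* The curve is tangent to the first axis, so the derivative of [u] along it is [ux 0 0]; if this is
   0, the order [n] is at least 2. *)
have U0 : cder (fun t => u t (Y t)) 0 0.
  have [_ _ [d hd]] := HY 0 z00.
  have hg : cder2 g 0 (Y 0) (gx 0 (Y 0)) (gy 0 (Y 0)) by rewrite Y0; apply: Hg; rewrite nm0.
  have hu : cder2 u 0 (Y 0) (ux 0 (Y 0)) (uy 0 (Y 0)) by rewrite Y0; apply: Hu; rewrite nm0.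
  have := cder2_curve (p := fun t => t) hg (cder_id 0) hd.
  rewrite Y0 gx00 gy00 mul0r add0r mul1r => dg.
  have dg0 : cder (fun t => g t (Y t)) 0 0.
    apply: (cder_eq _ (cder_cst 0 (0 : C))); exists r => // y; rewrite subr0 => hy.
    by rewrite gY.
  rewrite (cder_unique dg dg0) in hd.
  have := cder2_curve (p := fun t => t) hu (cder_id 0) hd.
  by rewrite Y0 ux0 mul0r mulr0 addr0.
have n2 : (1 < n)%N.
  case: n Ua U0 {Vb} => [|[|n]] Ua U0 //.
    by move: a0; rewrite -[a 0]mul1r -[1](expr0 (0 : C)) -Ua Y0 u00 eqxx.
  have Hz : nm (0 - 0 : C) < r by rewrite subrr nm0.
  have := cderM (cder_id 0) (Ha 0 Hz); rewrite mul0r addr0 mul1r => da.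
  have da' : cder (fun t => u t (Y t)) 0 (a 0).
    by apply: cder_ext da => t; rewrite Ua expr1.
  by move: a0; rewrite -(cder_unique U0 da') eqxx.
have [Lb [rb [Lb0 rb0 lipb]]] := hol_lip_near r0 Hb.
pose kap := `|complex.Im tau|^-1.
have kap0 : 0 <= kap by rewrite invr_ge0.
have ntau := nm_ge0 tau.
(* A Lipschitz constant of the unit [A] below, common to all [K] with [nm K <= kap]. *)
pose L := La + kap * (Lb + nm tau * La).
have L0 : 0 <= L by rewrite addr_ge0// mulr_ge0// addr_ge0// mulr_ge0.
pose rr := Num.min ra rb.
have rr0 : 0 < rr by rewrite lt_min ra0.
have [rra rrb] : rr <= ra /\ rr <= rb by rewrite /rr !ge_min !lexx orbT.
have [de de0 hde] := second_root n2 a0 L0 rr0.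
pose m := Num.min de (Num.min r d0).
have m0 : 0 < m by rewrite !lt_min de0 r0.
have [m1 m2 m3] : [/\ m <= de, m <= r & m <= d0] by rewrite /m !ge_min !lexx !orbT.
have [p [q [x [y [pq hx hy [Exy gxy] uniq]]]]] := Huniq (m / 2) (half_gt0 m0).
have yE : y = Y x by apply: Yuniq => //; lra.
have D0 := slope_den_neq0 tauI pq.
set D := p%:~R + q%:~R * tau in D0.
pose K := q%:~R / D.
have Kle : nm K <= kap by exact: slope_ratio_bound.
(* On the curve the left-hand side of the filling equation is [D t ^ n A t], and [A 0 = a 0]
   whatever the slope, as [second_root] requires. *)
pose A t := a t + K * (b t - tau * a t).
have AE t : u t (Y t) *~ p + v t (Y t) *~ q = D * (t ^+ n * A t).
  rewrite Ua Vb -[_ *~ p]mulrzl -[_ *~ q]mulrzl /A /K.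
  have -> : t ^+ n * (a t + q%:~R / D * (b t - tau * a t)) =
    t ^+ n * (D * a t + q%:~R * (b t - tau * a t)) / D by field.
  by rewrite [RHS]mulrC divfK// /D; ring.
have A0 : A 0 = a 0 by rewrite /A b0E subrr mulr0 addr0.
have lipA z w : nm z < rr -> nm w < rr -> nm (A z - A w) <= L * nm (z - w).
  move=> hz hw.
  have h1 := lipa z w ltac:(lra) ltac:(lra); have h2 := lipb z w ltac:(lra) ltac:(lra).
  have -> : A z - A w = a z - a w + K * ((b z - b w) - tau * (a z - a w)).
    by rewrite /A; ring.
  apply: (le_trans (nmD _ _)); rewrite nmM /L mulrDl lerD// -mulrA.
  apply: ler_pM; rewrite ?nm_ge0//; apply: (le_trans (nmB _ _)).
  by rewrite nmM mulrDl lerD// -mulrA ler_wpM2l.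
have x0 : x != 0.
  apply/eqP => x0; move: c0; rewrite -Exy yE x0 Y0 u00 v00 !mul0rz addr0 eqxx.
  by [].
have [x' [x'x x'2 Ax']] := hde A A0 lipA x x0 ltac:(lra).
move/eqP: x'x; apply; apply: (uniq x' (Y x')).
- by lra.
- by have := Yle x' ltac:(lra); lra.
- by rewrite AE Ax' -AE -yE.
- by apply: gY; lra.
Qed.

(** [u] is [O] of the distance to the origin, so a function that is [o(u)] has zero differential
    there. *)
Lemma relation_der0 : vx 0 0 - tau * ux 0 0 = 0 /\ vy 0 0 - tau * uy 0 0 = 0.
Proof.
have flat (f : C -> C) b : cder f 0 b -> f 0 = 0 ->
    (forall e : R, 0 < e -> exists2 d : R, 0 < d & forall h, nm h < d -> nm (f h) <= e * nm h) ->
    b = 0.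
  move=> fb f0 H; apply: (cder_unique fb) => e e0; have [d d0 hd] := H e e0.
  by exists d => // h hh; rewrite add0r f0 mul0r !subr0; exact: hd.
have n0 : nm (0 : C) < rho by rewrite nm0.
have lin (f : C -> C) b : cder f 0 b -> f 0 = 0 -> exists2 d : R, 0 < d &
    forall h, nm h < d -> nm (f h) <= (1 + nm b) * nm h.
  move=> fb f0; have [d d0 hd] := fb 1 ltr01; exists d => // h hh.
  have := hd h hh; rewrite add0r f0 subr0 => h1.
  by have := nm_subl (f h) (b * h); rewrite nmM; lra.
have small (e : R) (b : C) : 0 < e -> 0 < e / (1 + nm b).
  by move=> e0; rewrite divr_gt0//; have := nm_ge0 b; lra.
split.
- apply: (flat (fun x => v x 0 - tau * u x 0)).
  + by apply: cderB; [exact: cder2_x (Hv n0 n0)|apply: cderZ; exact: cder2_x (Hu n0 n0)].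
  + by rewrite v00 u00 mulr0 subrr.
  move=> e e0; have [d d0 hd] := HK (small e (ux 0 0) e0).
  have [d' d'0 hd'] := lin _ _ (cder2_x (Hu n0 n0)) u00.
  exists (Num.min d d'); first by rewrite lt_min d0.
  move=> h; rewrite lt_min => /andP[h1 h2].
  apply: (le_trans (hd h 0 h1 _)); first by rewrite nm0.
  have := hd' h h2 => h3; rewrite mulrAC ler_pdivrMr; last by have := nm_ge0 (ux 0 0); lra.
  by rewrite -mulrA ler_wpM2l ?(ltW e0)// mulrC.
- apply: (flat (fun y => v 0 y - tau * u 0 y)).
  + by apply: cderB; [exact: cder2_y (Hv n0 n0)|apply: cderZ; exact: cder2_y (Hu n0 n0)].
  + by rewrite v00 u00 mulr0 subrr.
  move=> e e0; have [d d0 hd] := HK (small e (uy 0 0) e0).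
  have [d' d'0 hd'] := lin _ _ (cder2_y (Hu n0 n0)) u00.
  exists (Num.min d d'); first by rewrite lt_min d0.
  move=> h; rewrite lt_min => /andP[h1 h2].
  apply: (le_trans (hd 0 h _ h1)); first by rewrite nm0.
  have := hd' h h2 => h3; rewrite mulrAC ler_pdivrMr; last by have := nm_ge0 (uy 0 0); lra.
  by rewrite -mulrA ler_wpM2l ?(ltW e0)// mulrC.
Qed.

(* With [K = q / (p + q tau)], the filling equation [u p + v q = c] becomes
   [pencil K x y = c / (p + q tau)]. *)
Definition pencil (K : C) x y := u x y + K * (v x y - tau * u x y).

(** By [relation_der0] the term with [K] has zero strict differential at the origin; for bounded [K]
    it is thus a perturbation as small as desired on one fixed neighbourhood. *)
Lemma uniform_inverse (kap : R) : ux 0 0 != 0 -> 0 <= kap ->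
  exists r r' L : R, [/\ 0 < r, r < rho, 0 < r', 0 <= L & forall K, nm K <= kap ->
  (forall x y x' y', nm x + nm y <= r -> nm x' + nm y' <= r ->
    nm (x' - x) + nm (y' - y) <=
      L * (nm (pencil K x' y' - pencil K x y) + nm (g x' y' - g x y))) /\
  (forall eta, nm eta < r' -> exists p q : C -> C, forall z, nm z < r' ->
    [/\ nm (p z) + nm (q z) <= r / 2, pencil K (p z) (q z) = eta, g (p z) (q z) = z,
      exists d, cder p z d & exists d, cder q z d])].
Proof.
move=> ux0 kap0.
pose al := ux 0 0; pose be := uy 0 0.
have nal : 0 < nm al by rewrite nm_gt0.
have nbe := nm_ge0 be.
(* [W] adds up the weights with which the errors of [u], [v - tau u] and [g] enter [F]. *)
pose W := 1 + kap + nm be.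
have W0 : 0 < W by rewrite /W; lra.
have [e [e0 e4 eW]] : exists e : R, [/\ 0 < e, e <= 1 / 4 & e * W <= nm al / 4].
  exists (Num.min (1 / 4) (nm al / 4 / W)); split.
  - by rewrite lt_min !divr_gt0.
  - by rewrite ge_min lexx.
  - by rewrite -ler_pdivlMr// ge_min lexx orbT.
have [d1 d10 h1] := hol2_sdiff rho0 Hu e0.
have [d2 d20 h2] := hol2_sdiff rho0 Hg e0.
have [d3 d30 h3] := sdiffD (hol2_sdiff rho0 Hv) (sdiffZ (- tau) (hol2_sdiff rho0 Hu)) e0.
have [wx wy] := relation_der0; rewrite !mulNr wx wy in h3.
rewrite -/al -/be in h1; rewrite gx00 gy00 in h2.
pose m := Num.min (Num.min d1 d2) (Num.min d3 rho).
have m0 : 0 < m by rewrite !lt_min d10 d20 d30.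
have [[m1 m2] m3 m4] : [/\ m <= d1 /\ m <= d2, m <= d3 & m <= rho].
  by rewrite /m; split; [split|..]; rewrite !ge_min !lexx ?orbT.
pose r := m / 2.
have r0 : 0 < r by exact: half_gt0.
have rm : r < m by rewrite /r; lra.
have inb x y : nm x + nm y <= r -> nm (x : C) < m /\ nm (y : C) < m.
  by move=> h; have := nm_ge0 x; have := nm_ge0 y; split; lra.
(* The linear change that turns the differential of [(pencil K, g)], with rows [(al, be)] and
   [(0, 1)], into the identity. *)
pose F K x y := (pencil K x y - be * g x y) / al.
have nid K : nm K <= kap -> forall x y x' y', nm x + nm y <= r -> nm x' + nm y' <= r ->
  nm (F K x' y' - F K x y - (x' - x)) + nm (g x' y' - g x y - (y' - y)) <=
  (nm (x' - x) + nm (y' - y)) / 2.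
  move=> hK x y x' y' /inb[a1 a2] /inb[a3 a4].
  have := h1 x y x' y' ltac:(lra) ltac:(lra) ltac:(lra) ltac:(lra).
  have := h2 x y x' y' ltac:(lra) ltac:(lra) ltac:(lra) ltac:(lra).
  have := h3 x y x' y' ltac:(lra) ltac:(lra) ltac:(lra) ltac:(lra).
  rewrite !mul0r !subr0 mul1r.
  set s3 := (X in nm X <= _ -> _); set s2 := (X in _ -> nm X <= _ -> _).
  set s1 := (X in _ -> _ -> nm X <= _ -> _); set N := nm _ + nm _ => g3 g2 g1.
  have -> : F K x' y' - F K x y - (x' - x) = (s1 + K * s3 - be * s2) / al.
    by rewrite /F /pencil /s1 /s2 /s3; field.
  have N0 : 0 <= N by rewrite addr_ge0 ?nm_ge0.
  have : nm ((s1 + K * s3 - be * s2) / al) <= N / 4.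
    rewrite nmM nmV ler_pdivrMr//.
    apply: (le_trans (nmB _ _)); apply: (le_trans (lerD (nmD _ _) (lexx _))); rewrite !nmM.
    have q1 : nm K * nm s3 <= kap * (e * N) by apply: ler_pM; rewrite ?nm_ge0.
    have q2 : nm be * nm s2 <= nm be * (e * N) by rewrite ler_wpM2l.
    have := ler_wpM2r N0 eW; rewrite /W; lra.
  have := ler_wpM2r N0 e4; lra.
have F0 K : F K 0 0 = 0.
  by rewrite /F /pencil u00 v00 g00 !mulr0 subrr mulr0 subr0 addr0 mul0r.
pose L := 2 * ((1 + nm be) / nm al + 1).
have q0 : 0 <= (1 + nm be) / nm al by rewrite divr_ge0 ?nm_ge0//; lra.
have L0 : 0 <= L by rewrite /L; lra.
pose r' := r / 4 / (1 + (1 + nm be) / nm al).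
have r'0 : 0 < r' by rewrite divr_gt0 ?divr_gt0//; lra.
exists r, r', L; split => //; first by lra.
move=> K hK; split.
  move=> x y x' y' hxy hxy'; have := near_id_lip (nid K hK) hxy hxy'.
  have -> : F K x' y' - F K x y =
     (pencil K x' y' - pencil K x y - be * (g x' y' - g x y)) / al.
    by rewrite /F; field.
  set P := pencil K x' y' - _; set G := g x' y' - _; rewrite nmM nmV.
  move=> h; apply: (le_trans h).
  have hP := nmB P (be * G); rewrite nmM in hP.
  have nP := nm_ge0 P; have nG := nm_ge0 G.
  have : nm (P - be * G) / nm al <= (1 + nm be) / nm al * (nm P + nm G).
    rewrite [leRHS]mulrAC ler_wpM2r ?invr_ge0 ?nm_ge0//; nra.
  by rewrite /L; nra.
move=> eta heta.
have [||||z hz|p [q H]] := @near_id_curve R (F K) g r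
  (fun z => (eta - be * z) / al) id r' r0 (nid K hK).
- move=> x y h; have [|b1 b2] := inb x y; first by move: r0 h; lra.
  have xr : nm x < rho by lra.
  have yr : nm y < rho by lra.
  have hw := cder2B (Hv xr yr) (cder2Z tau (Hu xr yr)).
  have hp := cder2D (Hu xr yr) (cder2Z K hw).
  have hf := cder2Z al^-1 (cder2B hp (cder2Z be (Hg xr yr))).
  do 2 eexists; move: hf; congr cder2.
  by apply/funext => x0; apply/funext => y0; rewrite mulrC.
- move=> x y h; have [|b1 b2] := inb x y; first by move: r0 h; lra.
  by exists (gx x y), (gy x y); apply: Hg; lra.
- move=> z _; eexists.
  have := cderZ al^-1 (cderB (cder_cst eta z) (cderZ be (cder_id z))).
  by apply: cder_ext => w; rewrite mulrC.
- by move=> z _; exists 1; exact: cder_id.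
- rewrite F0 g00 !sub0r !nmN nmM nmV.
  have hb := nmB eta (be * z); rewrite nmM in hb.
  have nz := nm_ge0 z.
  have h4 : nm (eta - be * z) / nm al <= (1 + nm be) / nm al * r'.
    rewrite [leRHS]mulrAC ler_wpM2r ?invr_ge0 ?nm_ge0//; nra.
  have : r' * (1 + (1 + nm be) / nm al) = r / 4 by rewrite divfK// gt_eqF//; lra.
  by lra.
exists p, q => z hz; have [k1 k2 k3 k4 k5] := H z hz; split => //.
have : F K (p z) (q z) * al + be * g (p z) (q z) = pencil K (p z) (q z).
  by rewrite /F divfK// subrK.
by move=> <-; rewrite k2 k3 divfK// subrK.
Qed.

End CuspPerturbation.

(** * Holonomy of the cusps *)

Section Paths.
Variables (nu : nat) (T : triangulation nu).
Implicit Types (t : 'I_nu) (u v w : word).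

Lemma foldl_nbr_rev t w : foldl (nbr T) (foldl (nbr T) t w) (rev_word T t w) = t.
Proof.
elim: w t => //= f w ih t.
by rewrite foldl_rcons ih nbrK.
Qed.

Lemma foldl_corner_step (c : 'I_nu * 'I_4) w :
  (foldl (corner_step T) c w).1 = foldl (nbr T) c.1 w.
Proof. by elim: w c => //= f w ih c; rewrite ih. Qed.

Lemma homotopic_context (S : Type) (step : S -> 'I_4 -> S) null s a b u v :
  homotopic step null (foldl step s a) u v ->
  homotopic step null s (a ++ u ++ b) (a ++ v ++ b).
Proof.
elim=> [{}u {}v [w1 [r [w2 [h -> ->]]]]|{}u|{}u {}v _ ih|x y z _ ih1 _ ih2].
- apply: rst_step; exists (a ++ w1), r, (w2 ++ b).
  by rewrite foldl_cat -!catA; split.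
- exact: rst_refl.
- exact: rst_sym.
- exact: rst_trans ih1 ih2.
Qed.

End Paths.

Section Homotopy.
Variables (nu k : nat) (M : dehn_filling nu k) (F : pred 'I_k).
Implicit Types (t : 'I_nu) (u v w : word).

Lemma null_fill_homotopic t r : null_tri M t r -> loop_homotopic M F t r [::].
Proof.
move=> h; apply: rst_step; exists [::], r, [::]; split => //; first by left.
by rewrite cats0.
Qed.

(** Each elementary move in the link is a move in the dual graph, once the vertex it keeps to is
    forgotten. *)
Lemma link_homotopic c u v : homotopic (corner_step M) (null_link M) c u v ->
  loop_homotopic M F c.1 u v.
Proof.
elim=> [{}u {}v [w1 [r [w2 [h -> ->]]]]|{}u|{}u {}v _ ih|x y z _ ih1 _ ih2].
- apply: rst_step; exists w1, r, w2; split => //; left.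
  rewrite -foldl_corner_step.
  case: h => [[f _ ->]|[a [b [n [[h1 h2 h3] [h4 h5]]]]]].
    by left; exists f.
  by right; exists a, b, n.
- exact: rst_refl.
- exact: rst_sym.
- exact: rst_trans ih1 ih2.
Qed.

Lemma homotopic_cat_rev t w : loop_homotopic M F t (w ++ rev_word M t w) [::].
Proof.
elim: w t => [|f w ih] t; first exact: rst_refl.
apply: (@rst_trans _ _ _ [:: f; glu M t f f]); last first.
  by apply: null_fill_homotopic; left; exists f.
have := @homotopic_context _ (nbr M) (null_fill M F) t [:: f] [:: glu M t f f] _ _ (ih (nbr M t f)).
by rewrite /= -cats1 catA.
Qed.

Lemma homotopic_rev_cat t w :
  loop_homotopic M F (foldl (nbr M) t w) (rev_word M t w ++ w) [::].
Proof.
elim: w t => [|f w ih] t; first exact: rst_refl.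
apply: rst_trans (ih (nbr M t f)).
set t' := nbr M t f.
have := @homotopic_context _ (nbr M) (null_fill M F) (foldl (nbr M) t' w)
  (rev_word M t' w) w [:: glu M t f f; f] [::].
rewrite foldl_nbr_rev /= -cats1 -catA /=; apply.
apply: null_fill_homotopic; left; exists (glu M t f f).
by rewrite gluK permK.
Qed.

End Homotopy.

(** * Commuting and parabolic 2 by 2 matrices *)

Section TwoByTwo.
Variable K : fieldType.
Implicit Types (X Y : 'M[K]_2) (e : 'cV[K]_2).

Lemma ord2E (i : 'I_2) : i = 0 \/ i = 1.
Proof.
by case: i => -[|[|//]] h; [left|right]; apply/val_inj.
Qed.

Lemma big2 (f : 'I_2 -> K) : \sum_i f i = f 0 + f 1.
Proof.
by rewrite !big_ord_recl big_ord0 addr0; congr (_ + f _); apply/val_inj.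
Qed.

Lemma mx2_eq X Y : X 0 0 = Y 0 0 -> X 0 1 = Y 0 1 -> X 1 0 = Y 1 0 ->
  X 1 1 = Y 1 1 -> X = Y.
Proof.
move=> h1 h2 h3 h4; apply/matrixP => i j.
by case: (ord2E i) => ->; case: (ord2E j) => ->.
Qed.

Lemma mul2E n m (X : 'M[K]_(n, 2)) (Y : 'M[K]_(2, m)) i j :
  (X *m Y) i j = X i 0 * Y 0 j + X i 1 * Y 1 j.
Proof. by rewrite mxE big2. Qed.

Lemma tr2E X : \tr X = X 0 0 + X 1 1.
Proof. by rewrite /mxtrace big2. Qed.

Lemma det2E X : \det X = X 0 0 * X 1 1 - X 0 1 * X 1 0.
Proof.
rewrite (expand_det_row _ 0) big2 /cofactor !det_mx11 !mxE /=.
rewrite expr0 expr1 mul1r mulN1r mulrN.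
by congr (_ * X _ _ - _ * X _ _); apply/val_inj.
Qed.

Lemma eigen_trace X e m : \det X = 1 -> e != 0 -> X *m e = m *: e ->
  m != 0 /\ \tr X = m + m^-1.
Proof.
move=> dX e0 Xe.
have E i : X i 0 * e 0 0 + X i 1 * e 1 0 = m * e i 0.
  by have := congr1 (fun A : 'cV[K]_2 => A i 0) Xe; rewrite mul2E mxE.
have E0 := E 0; have E1 := E 1; move: dX; rewrite det2E => dX.
have ch : m ^+ 2 - \tr X * m + 1 = 0.
  have [e00|e00] := eqVneq (e 0 0) 0.
    have e10 : e 1 0 != 0.
      apply: contra e0 => /eqP e10; apply/eqP/matrixP => i j; rewrite ord1 !mxE.
      by case: (ord2E i) => ->.
    apply: (mulIf e10); rewrite mul0r tr2E -dX.
    have -> : (m ^+ 2 - (X 0 0 + X 1 1) * m + (X 0 0 * X 1 1 - X 0 1 * X 1 0)) * e 1 0 =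
      (m - X 0 0) * (m * e 1 0 - X 1 1 * e 1 0) - X 1 0 * (X 0 1 * e 1 0) by ring.
    have -> : X 0 1 * e 1 0 = m * e 0 0 - X 0 0 * e 0 0 by rewrite -E0; ring.
    by rewrite -E1; ring.
  apply: (mulIf e00); rewrite mul0r tr2E -dX.
  have -> : (m ^+ 2 - (X 0 0 + X 1 1) * m + (X 0 0 * X 1 1 - X 0 1 * X 1 0)) * e 0 0 =
    (m - X 1 1) * (m * e 0 0 - X 0 0 * e 0 0) - X 0 1 * (X 1 0 * e 0 0) by ring.
  have -> : X 1 0 * e 0 0 = m * e 1 0 - X 1 1 * e 1 0 by rewrite -E1; ring.
  by rewrite -E0; ring.
have m0 : m != 0.
  by apply/eqP => m0; move: ch; rewrite m0 mulr0 subr0 expr0n add0r => /eqP; rewrite oner_eq0.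
split => //; apply: (mulIf m0); rewrite mulrDl mulVf//; apply/eqP.
by rewrite eq_sym -subr_eq0 -[X in _ == X]ch; apply/eqP; ring.
Qed.

(** The centralizer of a non-scalar matrix is spanned by 1 and the matrix. Reading the coefficient
    off an off-diagonal entry makes it depend continuously on [X] and [Y]. *)
Lemma commuting_pencil X Y i j : i != j -> X i j != 0 -> X *m Y = Y *m X ->
  exists a, Y = a%:M + (Y i j / X i j) *: X.
Proof.
move=> ij Xij XY.
have E i' j' : X i' 0 * Y 0 j' + X i' 1 * Y 1 j' = Y i' 0 * X 0 j' + Y i' 1 * X 1 j'.
  by have := congr1 (fun A : 'M[K]_2 => A i' j') XY; rewrite !mul2E.
have E00 := E 0 0; have E01 := E 0 1; have E10 := E 1 0; have E11 := E 1 1.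
exists (Y 0 0 - Y i j / X i j * X 0 0).
have key a b : Y i j * a = X i j * b -> b = Y i j / X i j * a.
  by move=> h; apply: (mulfI Xij); rewrite -h; field.
apply: mx2_eq; rewrite !mxE /= ?mulr1n ?mulr0n ?add0r.
- by rewrite subrK.
- apply: key; case: (ord2E i) (ord2E j) ij => -> [] -> //= _; first by rewrite mulrC.
  have : X 0 0 * Y 0 0 + X 0 1 * Y 1 0 - (Y 0 0 * X 0 0 + Y 0 1 * X 1 0) = 0.
    by rewrite E00 subrr.
  by move=> h; apply/eqP; rewrite -subr_eq0 -[X in _ == X]h; apply/eqP; ring.
- apply: key; case: (ord2E i) (ord2E j) ij => -> [] -> //= _; last by rewrite mulrC.
  have : X 0 0 * Y 0 0 + X 0 1 * Y 1 0 - (Y 0 0 * X 0 0 + Y 0 1 * X 1 0) = 0.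
    by rewrite E00 subrr.
  by move=> h; apply/eqP; rewrite eq_sym -subr_eq0 -[X in _ == X]h; apply/eqP; ring.
- have k2 : Y 0 0 - Y 1 1 = Y i j / X i j * (X 0 0 - X 1 1).
    apply: key; apply/eqP; rewrite -subr_eq0.
    case: (ord2E i) (ord2E j) ij => -> [] -> //= _; apply/eqP.
      transitivity (X 0 0 * Y 0 1 + X 0 1 * Y 1 1 - (Y 0 0 * X 0 1 + Y 0 1 * X 1 1)); first by ring.
      by rewrite E01 subrr.
    transitivity (Y 1 0 * X 0 0 + Y 1 1 * X 1 0 - (X 1 0 * Y 0 0 + X 1 1 * Y 1 0)); first by ring.
    by rewrite E10 subrr.
  have -> : Y 0 0 - Y i j / X i j * X 0 0 + Y i j / X i j * X 1 1 =
     Y 0 0 - Y i j / X i j * (X 0 0 - X 1 1) by ring.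
  by rewrite -k2; ring.
Qed.

(** Comparing traces gives [l^-1 = a + b * m^-1] even when [m = m^-1], where a second eigenvector
    may be lacking. *)
Lemma pencil_eigen X Y a b e m l : \det X = 1 -> \det Y = 1 ->
  Y = a%:M + b *: X -> e != 0 -> X *m e = m *: e -> Y *m e = l *: e ->
  l = a + b * m /\ l - l^-1 = b * (m - m^-1).
Proof.
move=> dX dY YE e0 Xe Ye.
have lE : l = a + b * m.
  have : (l - (a + b * m)) *: e = 0.
    rewrite scalerBl scalerDl -scalerA -Xe -Ye YE mulmxDl mul_scalar_mx -scalemxAl.
    by rewrite subrr.
  by move=> /eqP; rewrite scaler_eq0 (negPf e0) orbF subr_eq0 => /eqP.
have [_ tX] := eigen_trace dX e0 Xe; have [_ tY] := eigen_trace dY e0 Ye.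
split=> //; have : \tr Y = a + a + b * \tr X.
  by rewrite YE !tr2E !mxE /= !mulr1n; ring.
rewrite tX tY => h.
have -> : l^-1 = a + a + b * (m + m^-1) - l by rewrite -h; ring.
by rewrite lE; ring.
Qed.

Lemma parabolic_eigen X e m : \det X = 1 -> \tr X ^+ 2 = 4 -> e != 0 ->
  X *m e = m *: e -> m ^+ 2 = 1.
Proof.
move=> dX tX e0 Xe; have [m0 tE] := eigen_trace dX e0 Xe.
have : (m - m^-1) ^+ 2 = 0.
  by rewrite -[RHS](subrr (4 : K)) -{1}tX tE; field.
move=> /eqP; rewrite expf_eq0 /= subr_eq0 => /eqP h.
by rewrite expr2 {1}h mulVf.
Qed.

(** As [m = m^-1], both eigenvalues of [m X] are 1, so [m X - 1] has square 0. *)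
Lemma unipotent_part X e m : \det X = 1 -> \tr X ^+ 2 = 4 -> e != 0 ->
  X *m e = m *: e -> exists N : 'M[K]_2, N *m N = 0 /\ X = m *: (1%:M + N).
Proof.
move=> dX tX e0 Xe; have m2 := parabolic_eigen dX tX e0 Xe.
have [m0 tE] := eigen_trace dX e0 Xe.
have mV : m^-1 = m by apply: (mulfI m0); rewrite mulfV// -expr2.
exists (m *: X - 1%:M); split; last first.
  by rewrite addrC subrK scalerA -expr2 m2 scale1r.
move: dX tE; rewrite det2E tr2E mV => dX tE.
have X11 : X 1 1 = m + m - X 0 0 by rewrite -tE; ring.
have X01 : X 0 1 * X 1 0 = X 0 0 * (m + m - X 0 0) - 1 by rewrite -dX -X11; ring.
have mm : m * m = 1 by rewrite -expr2.
apply: mx2_eq; rewrite mul2E !mxE /= ?mulr1n ?mulr0n ?subr0 ?X11.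
- transitivity (m * m * (X 0 1 * X 1 0) + (m * X 0 0 - 1) ^+ 2); first by ring.
  by rewrite X01 mm; transitivity ((m * m - 1) * X 0 0 ^+ 2); [ring|rewrite mm; ring].
- transitivity (2 * (m * m - 1) * (m * X 0 1)); first by ring.
  by rewrite mm; ring.
- transitivity (2 * (m * m - 1) * (m * X 1 0)); first by ring.
  by rewrite mm; ring.
- transitivity (m * m * (X 0 1 * X 1 0) + (m * (m + m - X 0 0) - 1) ^+ 2); first by ring.
  rewrite X01 mm.
  transitivity ((m * m - 1) * (4 * m * m + X 0 0 ^+ 2 - 4 * m * X 0 0)); last by rewrite mm; ring.
  by ring.
Qed.

(** A projective transformation of the line with three fixed points is trivial. *)
Lemma three_eigenlines X (e1 e2 e3 : 'cV[K]_2) c1 c2 c3 :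
  X *m e1 = c1 *: e1 -> X *m e2 = c2 *: e2 -> X *m e3 = c3 *: e3 ->
  e1 0 0 * e2 1 0 - e1 1 0 * e2 0 0 != 0 ->
  e1 0 0 * e3 1 0 - e1 1 0 * e3 0 0 != 0 ->
  e3 0 0 * e2 1 0 - e3 1 0 * e2 0 0 != 0 -> X = c1%:M.
Proof.
move=> X1 X2 X3 D12 D13 D32.
have E i (e : 'cV[K]_2) c : X *m e = c *: e -> X i 0 * e 0 0 + X i 1 * e 1 0 = c * e i 0.
  by move=> h; have := congr1 (fun A : 'cV[K]_2 => A i 0) h; rewrite mul2E mxE.
have c12 : c1 = c2.
  (* [X] minus [c3] is applied to the linear relation between the three vectors, whose coefficients
     are the 2 by 2 determinants. *)
  have h i : (c1 - c3) * (e3 0 0 * e2 1 0 - e3 1 0 * e2 0 0) * e1 i 0 +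
      (c2 - c3) * (e1 0 0 * e3 1 0 - e1 1 0 * e3 0 0) * e2 i 0 = 0.
    have := E i _ _ X1; have := E i _ _ X2; have := E i _ _ X3 => h3 h2 h1.
    transitivity ((e3 0 0 * e2 1 0 - e3 1 0 * e2 0 0) * (c1 * e1 i 0) +
       (e1 0 0 * e3 1 0 - e1 1 0 * e3 0 0) * (c2 * e2 i 0) -
       (e1 0 0 * e2 1 0 - e1 1 0 * e2 0 0) * (c3 * e3 i 0)).
      by case: (ord2E i) => ->; ring.
    by rewrite -h1 -h2 -h3; ring.
  have h13 : c1 = c3.
    have : (c1 - c3) * (e3 0 0 * e2 1 0 - e3 1 0 * e2 0 0) *
       (e1 0 0 * e2 1 0 - e1 1 0 * e2 0 0) = 0.
      transitivity (((c1 - c3) * (e3 0 0 * e2 1 0 - e3 1 0 * e2 0 0) * e1 0 0 +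
      (c2 - c3) * (e1 0 0 * e3 1 0 - e1 1 0 * e3 0 0) * e2 0 0) * e2 1 0 -
      ((c1 - c3) * (e3 0 0 * e2 1 0 - e3 1 0 * e2 0 0) * e1 1 0 +
      (c2 - c3) * (e1 0 0 * e3 1 0 - e1 1 0 * e3 0 0) * e2 1 0) * e2 0 0); first by ring.
      by rewrite !h; ring.
    by move=> /eqP; rewrite !mulf_eq0 (negPf D12) (negPf D32) !orbF subr_eq0 => /eqP.
  have h23 : c2 = c3.
    have : (c2 - c3) * (e1 0 0 * e3 1 0 - e1 1 0 * e3 0 0) *
       (e1 0 0 * e2 1 0 - e1 1 0 * e2 0 0) = 0.
      transitivity (((c1 - c3) * (e3 0 0 * e2 1 0 - e3 1 0 * e2 0 0) * e1 1 0 +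
      (c2 - c3) * (e1 0 0 * e3 1 0 - e1 1 0 * e3 0 0) * e2 1 0) * e1 0 0 -
      ((c1 - c3) * (e3 0 0 * e2 1 0 - e3 1 0 * e2 0 0) * e1 0 0 +
      (c2 - c3) * (e1 0 0 * e3 1 0 - e1 1 0 * e3 0 0) * e2 0 0) * e1 1 0); first by ring.
      by rewrite !h; ring.
    by move=> /eqP; rewrite !mulf_eq0 (negPf D12) (negPf D13) !orbF subr_eq0 => /eqP.
  by rewrite h13 h23.
subst c2.
have row i : (X i 0 = c1 * (i == 0)%:R) /\ X i 1 = c1 * (i == 1)%:R.
  have := E i _ _ X1; have := E i _ _ X2 => h2 h1.
  split; apply: (mulIf D12).
    transitivity (e2 1 0 * (c1 * e1 i 0) - e1 1 0 * (c1 * e2 i 0)).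
      by rewrite -h1 -h2; ring.
    by case: (ord2E i) => -> /=; ring.
  transitivity (e1 0 0 * (c1 * e2 i 0) - e2 0 0 * (c1 * e1 i 0)).
    by rewrite -h1 -h2; ring.
  by case: (ord2E i) => -> /=; ring.
apply: mx2_eq; rewrite !mxE.
- by rewrite (row 0).1 mulr1 mulr1n.
- by rewrite (row 0).2 mulr0 mulr0n.
- by rewrite (row 1).1 mulr0 mulr0n.
- by rewrite (row 1).2 mulr1 mulr1n.
Qed.

End TwoByTwo.

(** * Holonomy of paths, up to sign *)

Section HolonomyFacts.
Variables (R : realType) (nu k : nat) (M : dehn_filling nu k).
Local Notation C := (R[i]^o).
Implicit Types (t : 'I_nu) (u v w : word) (g : 'M[C]_2) (z : 'rV[C]_nu).

Lemma trivial_pslN g : trivial_psl g -> trivial_psl (- g).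
Proof. by case=> ->; [right|left]; rewrite ?opprK. Qed.

Lemma trivial_psl_det g : trivial_psl g -> \det g = 1.
Proof.
case=> ->; first by rewrite det1.
by rewrite -scaleN1r detZ det1 mulr1 expr2 mulrNN mulr1.
Qed.

Lemma trivial_psl_mulr g g' : trivial_psl g -> g *m g' = g' \/ g *m g' = - g'.
Proof. by case=> ->; [left|right]; rewrite ?mulNmx mul1mx. Qed.

Lemma ideal_vertex_det (s : C) (v w : 'I_4) : s != 0 -> s != 1 -> v != w ->
  ideal_vertex s v 0 0 * ideal_vertex s w 1 0 -
  ideal_vertex s v 1 0 * ideal_vertex s w 0 0 != 0.
Proof.
move=> s0 s1; rewrite !mxE.
case: v => -[|[|[|[|//]]]] hv; case: w => -[|[|[|[|//]]]] hw //= _;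
  rewrite ?mul0r ?mulr0 ?mul1r ?mulr1 ?subr0 ?sub0r ?oppr_eq0 ?oner_eq0 ?subr_eq0 //.
by rewrite eq_sym.
Qed.

Lemma three_others (f : 'I_4) : exists v1 v2 v3 : 'I_4,
  [/\ v1 != f, v2 != f & v3 != f] /\ [/\ v1 != v2, v1 != v3 & v3 != v2].
Proof.
have h0 : (0 < 4)%N by []. have h1 : (1 < 4)%N by [].
have h2 : (2 < 4)%N by []. have h3 : (3 < 4)%N by [].
case: f => -[|[|[|[|//]]]] hf.
- by exists (Ordinal h1), (Ordinal h2), (Ordinal h3).
- by exists (Ordinal h0), (Ordinal h2), (Ordinal h3).
- by exists (Ordinal h0), (Ordinal h1), (Ordinal h3).
- by exists (Ordinal h0), (Ordinal h1), (Ordinal h2).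
Qed.

Variable z : 'rV[C]_nu.
Hypothesis z01 : forall t, z 0 t != 0 /\ z 0 t != 1.

(** The product fixes the three ideal vertices of the common face, and determinant 1 leaves only the
    scalars 1 and -1. *)
Lemma face_pairing_inverse t f g1 g2 : face_pairing M z t f g1 ->
  face_pairing M z (nbr M t f) (glu M t f f) g2 -> trivial_psl (g1 *m g2).
Proof.
move=> [d1 H1] [d2 H2].
have E (v : 'I_4) : v != f -> exists c, (g1 *m g2) *m ideal_vertex (z 0 t) v = c *: ideal_vertex (z 0 t) v.
  move=> vf; have [c hc] := H1 v vf.
  have v'f : glu M t f v != glu M t f f by rewrite (inj_eq perm_inj).
  have [c' hc'] := H2 _ v'f; exists (c' * c).
  move: hc'; rewrite nbrK gluK permK => hc'.
  by rewrite -mulmxA hc' -scalemxAr hc scalerA.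
have [v1 [v2 [v3 [[f1 f2 f3] [n12 n13 n32]]]]] := three_others f.
have [c1 h1] := E _ f1; have [c2 h2] := E _ f2; have [c3 h3] := E _ f3.
have [z0 z1] := z01 t.
have gE := three_eigenlines h1 h2 h3 (ideal_vertex_det z0 z1 n12)
  (ideal_vertex_det z0 z1 n13) (ideal_vertex_det z0 z1 n32).
have : \det (g1 *m g2) = 1 by rewrite det_mulmx d1 d2 mulr1.
rewrite gE det_scalar => /eqP; rewrite sqrf_eq1 => /orP[] /eqP ->; [by left|right].
by rewrite raddfN.
Qed.

Lemma holonomy_det t w g : holonomy M z t w g -> \det g = 1.
Proof.
elim: w t g => [|f w ih] t g /=; first exact: trivial_psl_det.
by move=> [g1 [g2 [[d1 _] /ih d2 ->]]]; rewrite det_mulmx d1 d2 mulr1.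
Qed.

Lemma holonomyN t w g : holonomy M z t w g -> holonomy M z t w (- g).
Proof.
elim: w t g => [|f w ih] t g /=; first exact: trivial_pslN.
by move=> [g1 [g2 [h1 /ih h2 ->]]]; exists g1, (- g2); rewrite mulmxN.
Qed.

Lemma holonomy_cat t u v g : holonomy M z t (u ++ v) g -> exists g1 g2,
  [/\ holonomy M z t u g1, holonomy M z (foldl (nbr M) t u) v g2 & g = g1 *m g2].
Proof.
elim: u t g => [|f u ih] t g /=.
  by move=> h; exists 1%:M, g; rewrite mul1mx; split => //; left.
move=> [g1 [g2 [h1 /ih[g3 [g4 [h3 h4 ->]]] ->]]].
by exists (g1 *m g3), g4; split => //; [exists g1, g3|rewrite mulmxA].
Qed.

Lemma holonomy_rev t w g1 g2 : holonomy M z t w g1 ->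
  holonomy M z (foldl (nbr M) t w) (rev_word M t w) g2 -> trivial_psl (g1 *m g2).
Proof.
elim: w t g1 g2 => [|f w ih] t g1 g2 /=.
  by case=> -> [] ->; rewrite ?mulNmx ?mul1mx ?opprK; [left|right|right|left].
move=> [a [b [ha hb ->]]]; rewrite -cats1 => /holonomy_cat [b' [a' [hb' + ->]]].
rewrite foldl_nbr_rev => -[a1 [a2 [ha1 ha2 ->]]].
have h1 := ih _ _ _ hb hb'; have h2 := face_pairing_inverse ha ha1.
have -> : a *m b *m (b' *m (a1 *m a2)) = a *m ((b *m b') *m a1) *m a2 by rewrite !mulmxA.
have [->|->] := trivial_psl_mulr a1 h1.
  by case: ha2 => ->; rewrite ?mulmxN mulmx1 //; exact: trivial_pslN.
rewrite mulmxN mulNmx; apply: trivial_pslN.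
by case: ha2 => ->; rewrite ?mulmxN mulmx1 //; exact: trivial_pslN.
Qed.

(** Going along [p] and back contributes 1 or -1; the sign is absorbed in the choice of the lift
    [g']. *)
Lemma holonomy_conj t p w g : foldl (nbr M) (foldl (nbr M) t p) w = foldl (nbr M) t p ->
  holonomy M z t (based_loop M t p w) g -> exists h g',
  [/\ h \in unitmx, holonomy M z (foldl (nbr M) t p) w g' & g *m h = h *m g'].
Proof.
move=> wl /holonomy_cat [h [g1 [hh /holonomy_cat [g' [h2 [hg']]]]]].
rewrite wl => hh2 -> ->.
have hu : h \in unitmx by rewrite unitmxE (holonomy_det hh) unitr1.
have h21 : h2 *m h = 1%:M \/ h2 *m h = - 1%:M.
  case: (holonomy_rev hh hh2) => E; [left|right].
    by rewrite -(mulKmx hu (h2 *m h)) mulmxA mulmxA -[_ *m h *m h2]mulmxA E mulmx1 mulVmx.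
  rewrite -(mulKmx hu (h2 *m h)) mulmxA mulmxA -[_ *m h *m h2]mulmxA E mulmxN mulmx1 mulNmx.
  by rewrite mulVmx.
case: h21 => E.
  by exists h, g'; split => //; rewrite -!mulmxA E mulmx1.
exists h, (- g'); split => //; first exact: holonomyN.
by rewrite -!mulmxA E !mulmxN mulmx1.
Qed.

End HolonomyFacts.

Section MatrixTopology.
Variable R : realType.
Local Notation C := (R[i]^o).

Lemma near_mxP n m (x : 'M[C]_(n, m)) (P : 'M[C]_(n, m) -> Prop) :
  (\forall y \near x, P y) <->
  exists2 d : R, 0 < d & forall y : 'M[C]_(n, m), (forall i j, nm (y i j - x i j) < d) -> P y.
Proof.
split=> [/nbhs_ballP [[d dI] /=]|[d d0 h]].
  rewrite ltcE /= => /andP[/eqP -> d0] h; exists d => // y xy; apply: h; split=> [|i j].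
    by rewrite ltcE /= eqxx.
  by rewrite /ball /= normE nmBC ltcR.
apply/nbhs_ballP; exists d%:C => /=; first by rewrite ltcR.
move=> y [_ xy]; apply: h => i j; have := xy i j.
by rewrite /ball /= normE nmBC ltcR.
Qed.

Lemma continuous_within_mx n m n' m' (A : set 'M[C]_(n, m))
    (f : 'M[C]_(n, m) -> 'M[C]_(n', m')) x : A x -> {within A, continuous f} ->
  forall e : R, 0 < e -> \forall y \near (x : 'M[C]_(n, m)), A y -> forall i j, nm (f y i j - f x i j) < e.
Proof.
move=> Ax /subspace_continuousP /(_ x Ax) H e e0.
have : \forall y \near f x, forall i j, nm ((y : 'M[C]_(n', m')) i j - f x i j) < e.
  by apply/near_mxP; exists e.
by move=> /H.
Qed.

End MatrixTopology.

(** * Small integer combinations *)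

Section Dirichlet.
Variable R : realType.

(** A Euclidean algorithm with nearest-integer quotients: each step at least halves the remainder.
    The nonzero determinant carried along keeps the pair [(a, b)] nonzero. *)
Lemma small_integer_combination (r e : R) : 0 < e ->
  exists a b : int, (a, b) <> (0, 0) /\ `|a%:~R + b%:~R * r| < e.
Proof.
move=> e0.
have [n hn] : exists n, 1 / 2 ^+ n < e.
  exists (Num.bound e^-1); rewrite ltr_pdivrMr ?exprn_gt0// mulrC -ltr_pdivrMr//.
  rewrite mul1r; apply: lt_trans (_ : (Num.bound e^-1)%:R < _).
    by apply: archi_boundP; rewrite invr_ge0 ltW.
  by rewrite -natrX ltr_nat; exact: ltn_expl.
suff [a [b [c [d [det h]]]]] : exists a b c d : int, a * d - b * c != 0 /\
    `|a%:~R + b%:~R * r| <= 1 / 2 ^+ n.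
  exists a, b; split; last exact: le_lt_trans hn.
  by move=> [a0 b0]; move: det; rewrite a0 b0 !mul0r subrr eqxx.
elim: n {hn} => [|n [a [b [c [d [det h]]]]]].
  by exists 1, 0, 0, 1; split => //; rewrite mulr0z mul0r addr0 normr1 expr0 divr1.
have [x0|x0] := eqVneq (a%:~R + b%:~R * r) 0.
  exists a, b, c, d; split => //; rewrite x0 normr0.
  by rewrite divr_ge0// exprn_ge0.
set x := a%:~R + _ in h x0; pose y := c%:~R + d%:~R * r.
(* The nearest integer to [y / x]. *)
pose q := Num.floor (y / x + 1 / 2).
exists (c - q * a), (d - q * b), a, b; split.
  by rewrite -oppr_eq0; move: det; congr (_ != 0); ring.
rewrite !rmorphB !rmorphM /=.
have -> : c%:~R - q%:~R * a%:~R + (d%:~R - q%:~R * b%:~R) * r = (y / x - q%:~R) * x.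
  by rewrite [RHS]mulrBl divfK// /y /x; ring.
have -> : 1 / 2 ^+ n.+1 = 1 / 2 * (1 / 2 ^+ n) :> R.
  by rewrite exprS; field; rewrite expf_neq0.
rewrite normrM.
have hq : `|y / x - q%:~R| <= 1 / 2.
  have /andP[q1 q2] := floor_itv (y / x + 1 / 2); rewrite -/q in q1 q2.
  by move: q2; rewrite rmorphD /= ler_norml => q2; lra.
by apply: ler_pM.
Qed.

End Dirichlet.

Section Unipotent.
Variable K : fieldType.
Variable N : 'M[K]_2.
Hypothesis N2 : N *m N = 0.
Implicit Types a b c s : K.

Definition unip c : 'M[K]_2 := 1%:M + c *: N.

Lemma unipD a b : unip a *m unip b = unip (a + b).
Proof.
rewrite /unip mulmxDl mul1mx mulmxDr mulmx1 -scalemxAl -scalemxAr N2 !scaler0 addr0.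
by rewrite -addrA scalerDl [a *: N + _]addrC.
Qed.

Lemma unip0 : unip 0 = 1%:M.
Proof. by rewrite /unip scale0r addr0. Qed.

Lemma unip_inv s c (X Y : 'M[K]_2) : s ^+ 2 = 1 -> X = s *: unip c ->
  X *m Y = 1%:M -> Y = s *: unip (- c).
Proof.
move=> s2 -> XY; have := congr1 (mulmx (s *: unip (- c))) XY.
rewrite mulmxA mulmx1 -scalemxAl -scalemxAr unipD addNr unip0 scalerA -expr2 s2.
by rewrite scale1r mul1mx.
Qed.

End Unipotent.

(** * The peripheral representation and the cusp shape *)

Section CuspRepresentation.
Variables (R : realType) (nu k : nat) (M : dehn_filling nu k) (F : pred 'I_k).
Local Notation C := (R[i]^o).
Variables (z : 'rV[C]_nu) (t0 : 'I_nu) (r : word -> 'M[C]_2).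
Hypothesis hr : holonomy_lift M F z t0 r.
Variables (e : 'I_2 + 'I_k) (p : word).
Hypothesis hp : foldl (nbr M) t0 p = (corner (ends M e)).1.

Let c1 := (corner (ends M e)).1.
Let X := mer (ends M e).
Let Y := lon (ends M e).

Definition based (w : word) := r (based_loop M t0 p w).

Lemma based_loop_loop w : foldl (nbr M) c1 w = c1 -> loop M t0 (based_loop M t0 p w).
Proof.
by move=> wl; rewrite /loop /based_loop !foldl_cat hp -/c1 wl /c1 -hp foldl_nbr_rev.
Qed.

Lemma based_cat u v : foldl (nbr M) c1 u = c1 -> foldl (nbr M) c1 v = c1 ->
  based (u ++ v) = based u *m based v.
Proof.
move=> ul vl; have [H1 H2 _] := hr.
have uvl : foldl (nbr M) c1 (u ++ v) = c1 by rewrite foldl_cat ul.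
rewrite /based -H1; [|exact: based_loop_loop|exact: based_loop_loop].
apply: H2; first exact: based_loop_loop.
  by rewrite /loop foldl_cat !based_loop_loop.
apply: rst_sym; rewrite /based_loop -!catA.
have := @homotopic_context _ (nbr M) (null_fill M F) t0 (p ++ u) (v ++ rev_word M t0 p)
  (rev_word M t0 p ++ p) [::].
rewrite -!catA /=; apply.
rewrite foldl_cat hp -/c1 ul /c1 -hp.
exact: homotopic_rev_cat.
Qed.

Lemma based_nil : based [::] = 1%:M.
Proof.
have [H1 H2 H3] := hr.
have n0 : loop M t0 [::] by [].
have -> : based [::] = r [::].
  apply: H2 => //; first exact: based_loop_loop.
  exact: homotopic_cat_rev.
have rr : r [::] = r [::] *m r [::] by rewrite -H1.
(* [r [::]] is idempotent and equal to 1 or -1. *)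
have := H3 _ n0 => -[//|] E.
by rewrite rr E mulmxN mulNmx opprK mul1mx.
Qed.

Lemma based_homotopic u v : foldl (nbr M) c1 u = c1 -> foldl (nbr M) c1 v = c1 ->
  loop_homotopic M F c1 u v -> based u = based v.
Proof.
move=> ul vl uv; have [_ H2 _] := hr; apply: H2; [exact: based_loop_loop..|].
by apply: homotopic_context; rewrite hp.
Qed.

Lemma loop_rev w : foldl (nbr M) c1 w = c1 -> foldl (nbr M) c1 (rev_word M c1 w) = c1.
Proof. by move=> wl; rewrite -{1}wl foldl_nbr_rev. Qed.

Lemma based_rev w : foldl (nbr M) c1 w = c1 -> based w *m based (rev_word M c1 w) = 1%:M.
Proof.
move=> wl; rewrite -based_cat//; last exact: loop_rev.
rewrite -based_nil; apply: based_homotopic => //.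
  by rewrite foldl_cat wl loop_rev.
exact: homotopic_cat_rev.
Qed.

Lemma loop_pow w n : foldl (nbr M) c1 w = c1 -> foldl (nbr M) c1 (flatten (nseq n w)) = c1.
Proof. by move=> wl; elim: n => //= n ih; rewrite foldl_cat wl. Qed.

Lemma loop_word_exp w n : foldl (nbr M) c1 w = c1 ->
  foldl (nbr M) c1 (word_exp M c1 w n) = c1.
Proof.
by move=> wl; case: n => n; rewrite /word_exp; apply: loop_pow => //; exact: loop_rev.
Qed.

Lemma loop_mer : foldl (nbr M) c1 X = c1.
Proof.
have [[_ h] _ _ _ _] := ends_torus M e.
by have := congr1 fst h; rewrite foldl_corner_step.
Qed.

Lemma loop_lon : foldl (nbr M) c1 Y = c1.
Proof.
have [_ [_ h] _ _ _] := ends_torus M e.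
by have := congr1 fst h; rewrite foldl_corner_step.
Qed.

Lemma based_mer_lon : based X *m based Y = based Y *m based X.
Proof.
have [_ _ h _ _] := ends_torus M e; have lX := loop_mer; have lY := loop_lon.
rewrite -!based_cat//; apply: based_homotopic; rewrite ?foldl_cat ?lX ?lY//.
exact: link_homotopic h.
Qed.

Lemma based_holonomy w : foldl (nbr M) c1 w = c1 ->
  holonomy M z t0 (based_loop M t0 p w) (based w).
Proof. by move=> wl; have [_ _ H3] := hr; apply: H3; exact: based_loop_loop. Qed.

Lemma based_det w : foldl (nbr M) c1 w = c1 -> \det (based w) = 1.
Proof. by move=> wl; exact: holonomy_det (based_holonomy wl). Qed.

Lemma based_pow (N : 'M[C]_2) s c w n : N *m N = 0 -> s ^+ 2 = 1 ->
  foldl (nbr M) c1 w = c1 -> based w = s *: unip N c ->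
  exists2 s', s' ^+ 2 = 1 & based (flatten (nseq n w)) = s' *: unip N (n%:R * c).
Proof.
move=> N2 s2 wl bw; elim: n => [|n [s' s'2 ih]].
  exists 1; first exact: expr1n.
  have -> : 0%:R * c = 0 :> C by exact: mul0r.
  by rewrite unip0 scale1r; exact: based_nil.
exists (s * s'); first by rewrite exprMn s2 s'2 mulr1.
rewrite [flatten _]/(w ++ flatten (nseq n w)) (based_cat wl (loop_pow n wl)).
have -> : n.+1%:R * c = c + n%:R * c by rewrite -add1n natrD mulrDl mul1r.
by rewrite -(unipD N2) bw ih -scalemxAl -scalemxAr scalerA.
Qed.

Lemma based_word_exp (N : 'M[C]_2) s c w (n : int) : N *m N = 0 -> s ^+ 2 = 1 ->
  foldl (nbr M) c1 w = c1 -> based w = s *: unip N c ->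
  exists2 s', s' ^+ 2 = 1 & based (word_exp M c1 w n) = s' *: unip N (n%:~R * c).
Proof.
move=> N2 s2 wl bw; case: n => n; rewrite /word_exp.
  by have := based_pow n N2 s2 wl bw.
have := unip_inv N2 s2 bw (based_rev wl) => bw'.
have [s' s'2 h] := based_pow n.+1 N2 s2 (loop_rev wl) bw'.
exists s'; first exact: s'2.
have -> : (Negz n)%:~R * c = n.+1%:R * - c by rewrite NegzE mulrNz mulNr mulrN.
exact: h.
Qed.

Lemma based_slope (N : 'M[C]_2) s c s' c' (a b : int) : N *m N = 0 ->
  s ^+ 2 = 1 -> s' ^+ 2 = 1 -> based X = s *: unip N c -> based Y = s' *: unip N c' ->
  exists2 s'', s'' ^+ 2 = 1 &
    based (slope_word M (ends M e) a b) = s'' *: unip N (a%:~R * c + b%:~R * c').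
Proof.
move=> N2 s2 s'2 bX bY.
have [s1 s12 h1] := based_word_exp a N2 s2 loop_mer bX.
have [s3 s32 h3] := based_word_exp b N2 s'2 loop_lon bY.
exists (s1 * s3); first by rewrite exprMn s12 s32 mulr1.
have L : based (slope_word M (ends M e) a b) =
    based (word_exp M c1 X a) *m based (word_exp M c1 Y b).
  by apply: based_cat; apply: loop_word_exp; [exact: loop_mer|exact: loop_lon].
rewrite L h1 h3 -scalemxAl -scalemxAr (unipD N2) scalerA; reflexivity.
Qed.

Hypothesis hz : complete_structure M F z t0.
Hypothesis he : unfilled F e.

Lemma shapes_nondegenerate t : z 0 t != 0 /\ z 0 t != 1.
Proof. by have [[h _ _] _ _ _ _] := hz; exact: h. Qed.

Lemma loop_slope a b : foldl (nbr M) c1 (slope_word M (ends M e) a b) = c1.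
Proof.
by rewrite /slope_word foldl_cat !loop_word_exp//; [exact: loop_lon|exact: loop_mer].
Qed.

(** The completeness condition concerns holonomies based at the cusp; conjugation along [p] carries
    it to [t0]. *)
Lemma based_parabolic a b : (a, b) <> (0, 0) ->
  parabolic (based (slope_word M (ends M e) a b)).
Proof.
move=> ab; have [_ _ _ _ H5] := hz.
have wl := loop_slope a b.
have [|h [g' [hu hg' E]]] := holonomy_conj shapes_nondegenerate (p := p) _ (based_holonomy wl).
  by rewrite hp.
rewrite hp in hg'.
have [nt tr] := H5 _ _ _ _ he ab hg'.
have gE : based (slope_word M (ends M e) a b) = h *m g' *m invmx h by rewrite -E mulmxK.
split.
  move=> tg; apply: nt.
  have -> : g' = invmx h *m (based (slope_word M (ends M e) a b) *m h) by rewrite E mulKmx.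
  by case: tg => ->; rewrite ?mulNmx mul1mx ?mulmxN mulVmx//; [left|right].
by rewrite gE mxtrace_mulC mulmxA mulVmx// mul1mx.
Qed.

Lemma based_mer_parabolic : parabolic (based X).
Proof.
have := @based_parabolic 1 0; rewrite /slope_word /word_exp /= !cats0; apply.
by case.
Qed.

Lemma based_lon_parabolic : parabolic (based Y).
Proof.
have := @based_parabolic 0 1; rewrite /slope_word /word_exp /= !cats0; apply.
by case.
Qed.

Variables (m l : C) (v : 'cV[C]_2).
Hypothesis v0 : v != 0.
Hypothesis hm : based X *m v = m *: v.
Hypothesis hl : based Y *m v = l *: v.

(* The cusp shape is not real: otherwise the peripheral group would contain
   nontrivial elements arbitrarily close to the identity. *)
Lemma cusp_shape : [/\ m ^+ 2 = 1, l ^+ 2 = 1 & exists i j : 'I_2,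
  [/\ i != j, based X i j != 0 &
      complex.Im (based Y i j / based X i j * m * l : R[i]) != 0]].
Proof.
have dX := based_det loop_mer; have dY := based_det loop_lon.
have [ntX trX] := based_mer_parabolic; have [ntY trY] := based_lon_parabolic.
have m2 := parabolic_eigen dX trX v0 hm; have l2 := parabolic_eigen dY trY v0 hl.
have mm : m * m = 1 by rewrite -expr2.
have ll : l * l = 1 by rewrite -expr2.
split => //.
have [N [N2 XN]] := unipotent_part dX trX v0 hm.
have m0 : m != 0 by apply: contra_eq_neq m2 => ->; rewrite expr0n /= eq_sym oner_neq0.
have XNu : based X = m *: unip N 1 by rewrite /unip scale1r.
have N0 : N != 0.
  apply/eqP => N0; apply: ntX; rewrite XN N0 addr0.
  by move/eqP: m2; rewrite sqrf_eq1 => /orP[] /eqP ->; [left|right];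
    rewrite ?scale1r ?scaleN1r.
(* A nonzero matrix of square 0 has a nonzero off-diagonal entry. *)
have [i [j [ij Nij]]] : exists i j : 'I_2, i != j /\ N i j != 0.
  apply: contrapT => h.
  have N01 : N 0 1 = 0 by apply/eqP; apply: contraT => n; exfalso; apply: h; exists 0, 1.
  have N10 : N 1 0 = 0 by apply/eqP; apply: contraT => n; exfalso; apply: h; exists 1, 0.
  have N00 : N 0 0 = 0.
    have := congr1 (fun A : 'M[C]_2 => A 0 0) N2; rewrite mul2E N01 mul0r addr0 mxE.
    by move=> /eqP; rewrite mulf_eq0 orbb => /eqP.
  have N11 : N 1 1 = 0.
    have := congr1 (fun A : 'M[C]_2 => A 1 1) N2; rewrite mul2E N10 mul0r add0r mxE.
    by move=> /eqP; rewrite mulf_eq0 orbb => /eqP.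
  by move/eqP: N0; apply; apply: mx2_eq; rewrite !mxE.
have Xij : based X i j = m * N i j by rewrite XN !mxE (negPf ij) mulr0n add0r.
have X0 : based X i j != 0 by rewrite Xij mulf_neq0.
exists i, j; split => //.
have [a YE] := commuting_pencil ij X0 based_mer_lon.
set be := _ / _ in YE *.
have [lE _] := pencil_eigen dX dY YE v0 hm hl.
(* The meridian is [m (1 + N)] and the longitude will be [l (1 + tau N)]: [tau] is the ratio of the
   two translations. *)
pose tau := be * m * l.
have YNu : based Y = l *: unip N tau.
  have hl2 : l * tau = be * m.
    by transitivity ((l * l) * (be * m)); [rewrite /tau; ring|rewrite ll mul1r].
  apply/matrixP => i' j'; rewrite YE XN /unip !mxE [l * (_ + _)]mulrDr.
  rewrite [l * (tau * _)]mulrA hl2 {1}lE.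
  by case: (i' == j'); rewrite ?mulr1n ?mulr0n; ring.
apply/eqP => im0.
have tauE : tau = (complex.Re (tau : R[i]))%:C.
  by rewrite /tau; move: im0; case: (be * m * l : R[i]) => x y /= ->.
set rr := complex.Re _ in tauE.
have [_ _ [disc _] _ _] := hz.
have [d d0 hd] := proj1 (near_mxP _ _) disc.
have nN : 0 < 1 + nm (N 0 0) + nm (N 0 1) + nm (N 1 0) + nm (N 1 1).
  have := nm_ge0 (N 0 0); have := nm_ge0 (N 0 1); have := nm_ge0 (N 1 0).
  by have := nm_ge0 (N 1 1); lra.
(* [S] dominates every entry of [N], so that [cc *: N] stays within the distance [d] given by
   discreteness. *)
set S := _ + nm (N 1 1) in nN.
have [x [y [xy hxy]]] := small_integer_combination rr (divr_gt0 d0 nN).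
have [s s2 E] := based_slope x y N2 m2 l2 XNu YNu.
have wl := loop_slope x y.
have [ntw _] := based_parabolic xy.
have cE : x%:~R * 1 + y%:~R * tau = (x%:~R + y%:~R * rr)%:C.
  by rewrite mulr1 tauE rmorphD rmorphM /= !rmorph_int.
rewrite cE in E; set cc := (_)%:C in E.
have hU : holonomy_group M z t0 (unip N cc).
  exists (based_loop M t0 p (slope_word M (ends M e) x y)).
    exact: based_loop_loop.
  have := based_holonomy wl; rewrite E.
  move/eqP: s2; rewrite sqrf_eq1 => /orP[] /eqP ->; first by rewrite scale1r.
  by rewrite scaleN1r => /holonomyN; rewrite opprK.
have U1 : unip N cc = 1%:M.
  apply: (hd _ _ hU) => i' j'.
  have -> : unip N cc i' j' - (1%:M : 'M[C]_2) i' j' = cc * N i' j' by rewrite !mxE; ring.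
  rewrite nmM /cc nm_real.
  have nS : nm (N i' j') < S.
    rewrite /S; have := nm_ge0 (N 0 0); have := nm_ge0 (N 0 1).
    have := nm_ge0 (N 1 0); have := nm_ge0 (N 1 1).
    by case: (ord2E i') => ->; case: (ord2E j') => ->; lra.
  move: hxy; rewrite ltr_pdivlMr// => hxy.
  apply: le_lt_trans hxy; rewrite ler_wpM2l// ltW//.
apply: ntw; rewrite E U1.
by move/eqP: s2; rewrite sqrf_eq1 => /orP[] /eqP ->; [left|right];
  rewrite ?scale1r ?scaleN1r.
Qed.

End CuspRepresentation.

(** * Logarithms of the eigenvalues *)

Section Logarithm.
Variable R : realType.
Local Notation C := R[i].

(** Equal sines and cosines make the half-difference of the arguments a zero of the sine, and it
    lies strictly between [- pi] and [pi]. *)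
Lemma cexp_inj (a b : C) : - pi < complex.Im a <= pi -> - pi < complex.Im b <= pi ->
  cexp a = cexp b -> a = b.
Proof.
case: a => a1 a2; case: b => b1 b2 /= ha hb E.
have ab1 : a1 = b1.
  by apply: expR_inj; have := congr1 (@nm R) E; rewrite !nm_cexp.
have [c s] : cos a2 = cos b2 /\ sin a2 = sin b2.
  have e0 : expR a1 != 0 by rewrite gt_eqF// expR_gt0.
  move: E; rewrite /cexp /= -ab1 => -[]; rewrite !mul0r !subr0 !addr0.
  by move=> /(mulfI e0) -> /(mulfI e0) ->.
suff d0 : (a2 - b2) / 2 = 0 by rewrite ab1; congr Complex; lra.
have sd : sin ((a2 - b2) / 2) = 0.
  have : cos ((a2 - b2) / 2 *+ 2) = 1.
    have -> : (a2 - b2) / 2 *+ 2 = a2 - b2 by rewrite mulr2n; lra.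
    by rewrite cosB c s -!expr2 cos2Dsin2.
  rewrite cos_mulr2n => h; have h2 := cos2Dsin2 ((a2 - b2) / 2).
  by apply/eqP; rewrite -sqrf_eq0; apply/eqP; move: h; rewrite mulr2n; lra.
set d := (a2 - b2) / 2 in sd *.
have dI : - pi < d < pi by rewrite /d; lra.
have [|h|//] := ltgtP d 0 => [h|].
  have := @sin_gt0_pi R (- d); rewrite sinN sd oppr0 ltxx.
  by move=> /(_ ltac:(lra)).
by have := @sin_gt0_pi R d; rewrite sd ltxx => /(_ ltac:(lra)).
Qed.

Lemma cexp_near (e : R) : 0 < e -> exists2 d : R, 0 < d & forall x y : C,
  nm x < d -> nm y < d -> nm (cexp y - cexp x - (y - x)) <= e * nm (y - x).
Proof.
move=> e0; have [d d0 hd] := cder_cont (cder_cexp (0 : C)) e0.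
exists d => // x y hx hy.
have H : hol (fun z : C => cexp z - z) (fun z => cexp z - 1) 0 d.
  by move=> z _; apply: cderB; [exact: cder_cexp|exact: cder_id].
have := @disk_lip R _ _ 0 d e x y H; rewrite !subr0 => /(_ _ hx hy).
rewrite (_ : _ - _ - (_ - _) = cexp y - cexp x - (y - x)); last by ring.
by apply => z; rewrite subr0 => hz; have := hd z; rewrite subr0 cexp0 => /(_ hz)/ltW.
Qed.

(** Inversion of [cexp - 1] near 0 by [near_id_curve], with an idle second coordinate. *)
Lemma local_log : exists (rho : R) (Log : C -> C), [/\ 0 < rho,
  forall w, nm (w - 1) < rho ->
    [/\ cexp (Log w) = w, - pi < complex.Im (Log w) <= pi & exists d, cder Log w d] &
  Log 1 = 0].
Proof.
have [d d0 hd] := cexp_near (half_gt0 ltr01).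
pose r := Num.min d 1 / 2.
have m0 : 0 < Num.min d 1 by rewrite lt_min d0 ltr01.
have md : Num.min d 1 <= d by rewrite ge_min lexx.
have m1 : Num.min d 1 <= 1 by rewrite ge_min lexx orbT.
have r0 : 0 < r by rewrite half_gt0.
have nid (x y x' y' : C) : nm x + nm y <= r -> nm x' + nm y' <= r ->
  nm ((cexp x' - 1) - (cexp x - 1) - (x' - x)) + nm (y' - y - (y' - y)) <=
  (nm (x' - x) + nm (y' - y)) / 2.
  rewrite /r => h h'; rewrite [y' - y - _]subrr nm0 addr0.
  have n1 := nm_ge0 y; have n2 := nm_ge0 y'; have n3 := nm_ge0 (y' - y).
  have := hd x x' ltac:(lra) ltac:(lra).
  have -> : cexp x' - 1 - (cexp x - 1) - (x' - x) = cexp x' - cexp x - (x' - x) by ring.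
  by lra.
have [||||z hz|p [q H]] := @near_id_curve R (fun x _ => cexp x - 1) (fun _ y => y) r
  id (fun=> 0) (r / 4) r0 nid.
- move=> x y _; exists (cexp x * 1 - 0), (cexp x * 0 - 0).
  apply: cder2B; last exact: cder2_cst.
  by apply: (cder2_comp (f := fun x _ => x)); [exact: cder2_fst|exact: cder_cexp].
- by move=> x y _; exists 0, 1; exact: cder2_snd.
- by move=> z _; exists 1; exact: cder_id.
- by move=> z _; exists 0; exact: cder_cst.
- by rewrite cexp0 !subrr sub0r nmN nm0 addr0 ltW.
have r40 : 0 < r / 4 by rewrite divr_gt0.
(* Small values of [p] thus lie in the principal strip. *)
have pi1 : 1 < pi :> R by have := pi_ge2 R; lra.
exists (r / 4), (fun w => p (w - 1)); split => //.
  move=> w hw; have [h1 h2 h3 [e he] _] := H _ hw; split.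
  - by apply: (addIr (- 1)).
  - have := Im_le_nm (p (w - 1)); have := nm_ge0 (q (w - 1)).
    by rewrite ler_norml; rewrite /r in h1; lra.
  - exists (e * 1); apply: (cder_comp (g := fun w => w - 1)) he.
    by have := cderB (cder_id w) (cder_cst 1 w); rewrite subr0.
have n0 : nm (1 - 1 : C) < r / 4 by rewrite subrr nm0.
have [h1 h2 _ _ _] := H _ n0.
apply: cexp_inj; first last.
- by rewrite cexp0; apply: (addIr (- 1)); rewrite h2.
- by rewrite /=; lra.
have := Im_le_nm (p (1 - 1)); have := nm_ge0 (q (1 - 1)).
by rewrite ler_norml; rewrite /r in h1; lra.
Qed.

Lemma sinh_near (e : R) : 0 < e -> exists2 d : R, 0 < d & forall x : C,
  nm x < d -> nm (cexp x - cexp (- x) - 2 * x) <= e * nm x.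
Proof.
move=> e0; have [d d0 hd] := cexp_near (half_gt0 e0).
exists d => // x hx; have := hd (- x) x; rewrite nmN => /(_ hx hx).
have -> : x - - x = 2 * x by ring.
by rewrite nmM nm_natr; lra.
Qed.

(** As [m0] and [l0] are their own inverses, the relation reads [sinh v = be m0 l0 sinh u], and
    [sinh x] is [x] to first order. *)
Lemma log_relation (m0 l0 be0 : C) (e : R) : m0 ^+ 2 = 1 -> l0 ^+ 2 = 1 -> 0 < e ->
  exists2 d : R, 0 < d & forall u v m l be, nm u < d -> nm v < d -> nm (be - be0) < d ->
    m = m0 * cexp u -> l = l0 * cexp v -> l - l^-1 = be * (m - m^-1) ->
    nm (v - be0 * m0 * l0 * u) <= e * nm u.
Proof.
move=> m2 l2 e0.
have nm1' (x : C) : x ^+ 2 = 1 -> x != 0 /\ x^-1 = x /\ nm x = 1.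
  move=> x2; have x0 : x != 0.
    by apply/eqP => x0; move: x2; rewrite x0 expr0n /= => /eqP; rewrite eq_sym oner_eq0.
  split => //; split; first by apply: (mulfI x0); rewrite mulfV// -expr2.
  by apply/eqP; rewrite -(@pexpr_eq1 _ _ 2)// ?nm_ge0// -nmX x2 nm1.
have [m00 [mV nm0']] := nm1' _ m2; have [l00 [lV nl0]] := nm1' _ l2.
set tau := be0 * m0 * l0.
have nt := nm_ge0 tau.
pose W := 4 * (2 + nm tau).
have W0 : 0 < W by rewrite /W; lra.
have [e1 [e10 e11 e1W]] : exists e1 : R, [/\ 0 < e1, e1 <= 1 & e1 * W <= e].
  exists (Num.min 1 (e / W)); split.
  - by rewrite lt_min ltr01 divr_gt0.
  - by rewrite ge_min lexx.
  - by rewrite -ler_pdivlMr// ge_min lexx orbT.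
have [d d0 hd] := sinh_near e10.
exists (Num.min d e1); first by rewrite lt_min d0.
move=> u v m l be; rewrite !lt_min => /andP[hu _] /andP[hv _] /andP[_ hbe] -> ->.
have cE (x : C) : (cexp x : C)^-1 = cexp (- x) := esym (cexpN x).
rewrite (invfM l0) (invfM m0) !cE mV lV -!mulrBr => E.
pose be' := be * m0 * l0.
have E' : cexp v - cexp (- v) = be' * (cexp u - cexp (- u)).
  apply: (mulfI l00); rewrite E /be'.
  have ll : l0 * l0 = 1 by rewrite -expr2.
  transitivity ((l0 * l0) * (be * m0 * (cexp u - cexp (- u)))); last by ring.
  by rewrite ll; ring.
have hb : nm (be' - tau) <= e1.
  have -> : be' - tau = (be - be0) * (m0 * l0) by rewrite /be' /tau; ring.
  by rewrite !nmM nm0' nl0 !mulr1 ltW.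
have b1 := hd _ hv; have b2 := hd _ hu.
move: b1 b2; rewrite E'; set su := cexp u - cexp (- u).
set r1 := (X in nm X <= _ -> _); set r2 := (X in _ -> nm X <= _ -> _) => b1 b2.
have X2 : 2 * (v - tau * u) = - r1 + be' * r2 + 2 * ((be' - tau) * u).
  by rewrite /r1 /r2; ring.
have := congr1 (@nm R) X2; rewrite nmM nm_natr => X3.
have := nmD3 (- r1) (be' * r2) (2 * ((be' - tau) * u)).
rewrite -X3 nmN (nmM be') (nmM 2) (nmM (be' - tau)) nm_natr.
have nbe : nm be' <= nm tau + 1 by have := nm_subl be' tau; lra.
have vle := nm_subl v (tau * u); rewrite nmM in vle.
have nu := nm_ge0 u; have nD := nm_ge0 (v - tau * u); have nv := nm_ge0 v.
have p1 : nm be' * nm r2 <= (nm tau + 1) * (e1 * nm u) by apply: ler_pM; rewrite ?nm_ge0.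
have p2 : nm (be' - tau) * nm u <= e1 * nm u by rewrite ler_wpM2r.
have p3 : e1 * nm v <= e1 * (nm tau * nm u + nm (v - tau * u)) by rewrite ler_wpM2l// ltW.
(* This part of the bound is absorbed by the left-hand side, which is twice [nm (v - tau * u)]. *)
have p4 : e1 * nm (v - tau * u) <= nm (v - tau * u) by rewrite ler_piMl.
have p5 := ler_wpM2r nu e1W; rewrite /W in p5.
have p6 : 0 <= e1 * nm u by rewrite mulr_ge0// ltW.
by have p8 := mulr_ge0 nt p6; lra.
Qed.

End Logarithm.

(** * Real-valued norms and differentials *)

Section RealNorm.
Variable R : realType.
Local Notation C := (R[i]^o).

Section Generic.
Variable V : normedModType R[i].
Implicit Types x y : V.

(* The norm as a real number, as for [nm]. *)
Definition rn x : R := complex.Re `|x|.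

Lemma rnE x : `|x| = (rn x)%:C.
Proof.
have := normr_ge0 x; rewrite /rn lecE /=; case: `|x| => a b /= /andP[/eqP -> _].
by [].
Qed.

Lemma rn_ge0 x : 0 <= rn x.
Proof. by rewrite -lecR -rnE normr_ge0. Qed.

Lemma rnD x y : rn (x + y) <= rn x + rn y.
Proof. by have := ler_normD x y; rewrite !rnE -rmorphD lecR. Qed.

Lemma rnN x : rn (- x) = rn x.
Proof. by rewrite /rn normrN. Qed.

Lemma rn0 : rn 0 = 0.
Proof. by rewrite /rn normr0. Qed.

Lemma rn_eq0 x : (rn x == 0) = (x == 0).
Proof.
by apply/eqP/eqP => [h|->]; [apply: normr0_eq0; rewrite rnE h|exact: rn0].
Qed.

Lemma rnZ (a : R[i]) x : rn (a *: x) = nm a * rn x.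
Proof. by have := normrZ a x; rewrite normE !rnE -rmorphM => /complexI. Qed.

Lemma near_rnP x (P : V -> Prop) : (\forall y \near x, P y) <->
  exists2 d : R, 0 < d & forall y, rn (y - x) < d -> P y.
Proof.
split=> [/nbhs_ballP [[d dI] /=]|[d d0 h]].
  rewrite ltcE /= => /andP[/eqP -> d0] h; exists d => // y xy; apply: h.
  by rewrite -ball_normE /= distrC rnE ltcR.
apply/nbhs_ballP; exists d%:C => /=; first by rewrite ltcR.
by move=> y; rewrite -ball_normE /= distrC rnE ltcR => xy; apply: h.
Qed.

End Generic.

Lemma rn_nm (z : C) : rn z = nm z.
Proof. by []. Qed.

Variables V W : normedModType R[i].

Lemma differentiable_rn (f : V -> W) x : differentiable f x ->
  forall e : R, 0 < e -> exists2 d : R, 0 < d & forall h, rn h < d ->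
    rn (f (x + h) - f x - 'd f x h) <= e * rn h.
Proof.
move=> /diff_locally /eqaddoP H e e0.
have eC : 0 < e%:C by rewrite ltcR.
have := H _ eC => /near_rnP [d d0 hd]; exists d => // h hh.
have := hd h; rewrite subr0 => /(_ hh).
rewrite !rnE -rmorphM lecR; congr (rn _ <= _).
by rewrite !fctE /= [h + x]addrC opprD addrA.
Qed.

Lemma diff_rn_bound (f : V -> W) x : differentiable f x ->
  exists2 K : R, 0 <= K & forall h, rn ('d f x h) <= K * rn h.
Proof.
move=> df; have [c _] := proj1 (diff_locallyP _ _) df.
have [[K KI] K0 hK] := linear_lipschitz c.
move: K0; rewrite ltcE /= => /andP[/eqP KE K0]; rewrite KE in hK.
exists K; first exact: ltW.
by move=> h; have := hK h; rewrite !rnE -[_ +i* 0]/(K%:C) -rmorphM lecR.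
Qed.

Lemma differentiable_lip (f : V -> W) x : differentiable f x ->
  exists K d : R, [/\ 0 <= K, 0 < d & forall h, rn h < d -> rn (f (x + h) - f x) <= K * rn h].
Proof.
move=> df; have [K K0 hK] := diff_rn_bound df.
have [d d0 hd] := differentiable_rn df ltr01.
exists (1 + K), d; split => //; first by lra.
move=> h hh; have := hd h hh; have := hK h.
have := rnD (f (x + h) - f x - 'd f x h) ('d f x h); rewrite subrK; lra.
Qed.

End RealNorm.

(** * Convergence of the expansions *)

Section Bridges.
Variable R : realType.
Local Notation C := (R[i]^o).

Lemma cder2_of_diff (f : 'rV[C]_2 -> C) (P E D : 'rV[C]_2) (t y : R[i]) :
  differentiable f (P + t *: E + y *: D) ->
  cder2 (fun t y : R[i] => f (P + t *: E + y *: D) : R[i]) t y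
    ('d f (P + t *: E + y *: D) E) ('d f (P + t *: E + y *: D) D).
Proof.
set Q := P + t *: E + y *: D => df e e0.
have nE := rn_ge0 E; have nD := rn_ge0 D.
pose K := 1 + rn E + rn D.
have K0 : 0 < K by rewrite /K; lra.
have [d d0 hd] := differentiable_rn df (divr_gt0 e0 K0).
exists (d / K / 2); first by rewrite half_gt0 ?divr_gt0.
move=> h k hh hk.
have hle : rn (h *: E + k *: D) <= nm h * rn E + nm k * rn D.
  by apply: (le_trans (rnD _ _)); rewrite !rnZ.
have nh := nm_ge0 h; have nk := nm_ge0 k.
have dK : d = d / K * K by rewrite divfK// gt_eqF.
have small : rn (h *: E + k *: D) < d.
  by apply: (le_lt_trans hle); rewrite dK; set q := d / K in hh hk *; rewrite /K; nra.
have := hd _ small.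
have -> : Q + (h *: E + k *: D) = P + (t + h) *: E + (y + k) *: D.
  by rewrite /Q !scalerDl !addrA; congr (_ + _); rewrite -!addrA; congr (_ + (_ + _)); rewrite addrC.
move=> H; rewrite linearD !linearZ /= opprD addrA in H.
have ZE (a b : C) : b *: a = a * b by exact: mulrC.
rewrite !ZE rn_nm in H; apply: (le_trans H).
apply: (@le_trans _ _ (e / K * (nm h * rn E + nm k * rn D))).
  by rewrite ler_wpM2l// divr_ge0// ltW.
have -> : e * (nm h + nm k) = e / K * (K * (nm h + nm k)).
  by rewrite mulrA divfK// gt_eqF.
rewrite ler_wpM2l//; first by rewrite divr_ge0// ltW.
by rewrite /K; nra.
Qed.

(** Homogeneity turns the comparison of two bases of neighbourhoods of 0 into an inequality. *)
Lemma coord_bound n m : exists2 K : R, 0 <= K & forall (h : 'M[C]_(n, m)) i j,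
  nm (h i j) <= K * rn h.
Proof.
have : \forall y \near (0 : 'M[C]_(n, m)),
    forall i j, nm ((y : 'M[C]_(n, m)) i j - (0 : 'M[C]_(n, m)) i j) < 1.
  by apply/near_mxP; exists 1.
move=> /near_rnP [d d0 hd]; exists (2 / d); first by rewrite divr_ge0// ltW.
move=> h i j; have [->|h0] := eqVneq h 0; first by rewrite mxE nm0 rn0 mulr0.
have rh : 0 < rn h by rewrite lt_def rn_eq0 h0 rn_ge0.
pose c : R[i] := (d / 2 / rn h)%:C.
have c0 : 0 < d / 2 / rn h by rewrite !divr_gt0.
have nc : nm c = d / 2 / rn h by rewrite nm_real ger0_norm// ltW.
have := hd (c *: h); rewrite subr0 rnZ nc divfK ?gt_eqF// => /(_ ltac:(lra) i j).
rewrite !mxE subr0 nmM nc.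
have E : 2 / d * rn h = (d / 2 / rn h)^-1 by rewrite !invfM !invrK; ring.
by rewrite E -ltr_pdivlMl// mulr1 => /ltW.
Qed.

Lemma rv2E (h : 'rV[C]_2) : h = h 0 0 *: delta_mx 0 0 + h 0 1 *: delta_mx 0 1.
Proof.
apply/matrixP => i j; rewrite ord1 !mxE /=.
by case: (ord2E j) => -> /=; rewrite mulr1 mulr0 ?addr0 ?add0r.
Qed.

(** Coordinates in which [L] is the second projection and [T] the first. *)
Lemma kernel_basis (L : {linear 'rV[C]_2 -> C}) : (exists h, L h != 0) ->
  exists (E D : 'rV[C]_2) (T : 'rV[C]_2 -> C) (K : R), [/\ L E = 0, L D = 1,
    forall h, h = T h *: E + L h *: D, forall h, nm (T h) <= K * rn h &
    forall t y, T (t *: E + y *: D) = t].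
Proof.
move=> [h0 Lh0].
have [K K0 hK] := coord_bound 1 2.
pose e0 : 'rV[C]_2 := delta_mx 0 0; pose e1 : 'rV[C]_2 := delta_mx 0 1.
have LE h : L h = h 0 0 * L e0 + h 0 1 * L e1.
  by rewrite {1}(rv2E h) linearD; congr (_ + _); exact: linearZ.
have [L0|L0] := eqVneq (L e0) 0.
  have L1 : L e1 != 0.
    by apply: contra Lh0 => /eqP L1; rewrite LE L0 L1 !mulr0 addr0.
  exists e0, ((L e1)^-1 *: e1), (fun h => h 0 0), K; split => //.
  - by transitivity ((L e1)^-1 * L e1); [exact: linearZ|exact: mulVf].
  - by move=> h; rewrite LE L0 mulr0 add0r scalerA mulfK// -rv2E.
  - by move=> t y; rewrite !mxE /= mulr1 !mulr0 addr0.
exists (e1 - (L e1 / L e0) *: e0), ((L e0)^-1 *: e0), (fun h => h 0 1), K; split => //.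
- by rewrite linearB; apply/eqP; rewrite subr_eq0 eq_sym; apply/eqP; transitivity (L e1 / L e0 * L e0); [exact: linearZ|exact: divfK].
- by transitivity ((L e0)^-1 * L e0); [exact: linearZ|exact: mulVf].
- move=> h; rewrite {1}(rv2E h) -/e0 -/e1 (LE h) scalerBr !scalerA addrC -addrA.
  congr (_ + _); rewrite -scaleNr -scalerDl; congr (_ *: _).
  by field.
- by move=> t y; rewrite !mxE /= !mulr0 subr0 mulr1 addr0.
Qed.

(** The matrix of an injective map has a one-sided inverse, whose entries give the bound. *)
Lemma injective_lower nu (L : {linear 'rV[C]_2 -> 'rV[C]_nu}) : injective L ->
  exists2 K : R, 0 <= K & forall h, rn h <= K * rn (L h).
Proof.
move=> Linj; pose B := lin1_mx L.
have BE h : h *m B = L h by rewrite mul_rV_lin1.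
have /row_freeP [Cm BC] : row_free B.
  rewrite -kermx_eq0; apply/rowV0P => v /sub_kermxP; rewrite BE => Lv.
  by apply: Linj; rewrite Lv linear0.
have [K K0 hK] := coord_bound 1 nu.
have hE (h : 'rV[C]_2) j : h 0 j = \sum_i (L h) 0 i * Cm i j.
  have {1}-> : h = L h *m Cm by rewrite -BE -mulmxA BC mulmx1.
  by rewrite mxE.
have bd j : exists2 S : R, 0 <= S & forall h, nm ((h : 'rV[C]_2) 0 j) <= S * rn (L h).
  exists (\sum_i K * nm (Cm i j)).
    by apply: sumr_ge0 => i _; rewrite mulr_ge0 ?nm_ge0.
  move=> h; rewrite hE mulr_suml.
  elim/big_ind2: _ => [|x1 x2 y1 y2 h1 h2|i _]; first by rewrite nm0.
    by apply: (le_trans (nmD _ _)); exact: lerD.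
  by rewrite nmM mulrAC ler_wpM2r ?nm_ge0.
have [S0 S00 h0] := bd 0; have [S1 S10 h1] := bd 1.
exists (S0 * rn (delta_mx 0 0 : 'rV[C]_2) + S1 * rn (delta_mx 0 1 : 'rV[C]_2)).
  by rewrite addr_ge0// mulr_ge0 ?rn_ge0.
move=> h; rewrite {1}(rv2E h); apply: (le_trans (rnD _ _)); rewrite !rnZ mulrDl.
by rewrite lerD// mulrAC ler_wpM2r ?rn_ge0.
Qed.

End Bridges.

(** * Derivatives of nearby holomorphic functions *)

Section DerivativesAtPoint.
Variable R : realType.
Local Notation C := (R[i]^o).
Implicit Types (f g : C -> C) (x : C).

Lemma derive1_near f g x : (\forall y \near x, f y = g y) -> (derive1 f) x = (derive1 g) x.
Proof. by move=> H; rewrite !derive1E; apply: near_eq_derive. Qed.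

Lemma derive1n_near f g x n : (\forall y \near x, f y = g y) -> (derive1n n f) x = (derive1n n g) x.
Proof.
move=> H; suff : \forall y \near x, (derive1n n f) y = (derive1n n g) y by exact: nbhs_singleton.
elim: n => [//|n ih]; rewrite !derive1nS.
move: ih => /near_nmP [d d0 hd]; apply/near_nmP; exists (d / 2); first exact: half_gt0.
move=> y hy; apply: derive1_near; apply/near_nmP; exists (d / 2); first exact: half_gt0.
move=> w hw; apply: hd; have -> : w - x = (w - y) + (y - x) by rewrite addrA subrK.
by have := nmD (w - y) (y - x); lra.
Qed.

Lemma cder_derive1 f x (a : C) : cder f x a -> (derive1 f) x = a.
Proof. by move=> /cderP [_ <-]; rewrite derive1E. Qed.

Lemma hol_derive1 f f' x (rho : R) : hol f f' x rho -> hol f (derive1 f) x rho.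
Proof. by move=> H z hz; rewrite (cder_derive1 (H z hz)); exact: H. Qed.

(** [d] is chosen before the functions: by Cauchy estimates, uniform closeness on a disk controls
    every derivative at its centre. Each derivation costs half of the radius. *)
Lemma derive1n_close x n (rho e : R) : 0 < rho -> 0 < e -> exists2 d : R, 0 < d &
  forall f f' g g', hol f f' x rho -> hol g g' x rho ->
    (forall z, nm (z - x) < rho -> nm (f z - g z) <= d) ->
    nm ((derive1n n f) x - (derive1n n g) x) <= e.
Proof.
move=> rho0 e0; elim: n rho rho0 => [|n ih] rho rho0.
  by exists e => // f f' g g' _ _ H; apply: H; rewrite subrr nm0.
have [d d0 hd] := ih (rho / 2) (half_gt0 rho0).
(* Chosen so that the Cauchy bound with radius [rho / 4] returns exactly [d]. *)
exists (d * (rho / 4) / 2); first by rewrite half_gt0 ?mulr_gt0 ?divr_gt0.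
move=> f f' g g' Hf Hg fg; rewrite !derive1Sn.
have Hf1 := hol_derive1 Hf; have Hg1 := hol_derive1 Hg.
have [f'' Hf2] := hol_der Hf1; have [g'' Hg2] := hol_der Hg1.
have sub h h' : hol h h' x rho -> hol h h' x (rho / 2).
  by move=> H; apply: (hol_sub H); rewrite subrr nm0; lra.
apply: (hd _ _ _ _ (sub _ _ Hf2) (sub _ _ Hg2)) => z hz.
have Hz : hol (fun w => f w - g w) (fun w => (derive1 f) w - (derive1 g) w) z (rho / 2).
  by apply: (hol_sub (holB Hf1 Hg1)); lra.
have := @cauchy_bound _ _ _ z (rho / 2) (d * (rho / 4) / 2) (rho / 4) Hz.
have -> : 2 * (d * (rho / 4) / 2) / (rho / 4) = d by field; lra.
apply; last by rewrite divr_gt0//; lra.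
move=> w hw; apply: fg; have -> : w - x = (w - z) + (z - x) by rewrite addrA subrK.
by have := nmD (w - z) (z - x); lra.
Qed.

End DerivativesAtPoint.

(** * The eigenvalue relation near the complete structure *)

Section CuspFacts.
Variables (R : realType) (nu k : nat) (M : dehn_filling nu k) (t0 : 'I_nu).
Local Notation C := (R[i]^o).

Lemma quotient_close (X0 Y0 : R[i]) (d : R) : X0 != 0 -> 0 < d ->
  exists2 e : R, 0 < e & forall X Y, nm (X - X0) < e -> nm (Y - Y0) < e ->
    X != 0 /\ nm (Y / X - Y0 / X0) < d.
Proof.
move=> X00 d0; have n0 : 0 < nm X0 by rewrite nm_gt0.
have nY := nm_ge0 Y0.
pose S := 2 * (1 + nm X0 + nm Y0).
have S0 : 0 < S by rewrite /S; lra.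
exists (Num.min (nm X0 / 2) (d * nm X0 ^+ 2 / S)).
  by rewrite lt_min half_gt0//= divr_gt0// mulr_gt0// exprn_gt0.
move=> X Y; rewrite !lt_min !(ltr_pdivlMr _ _ S0) => /andP[h1 h2] /andP[_ h3].
have hX : nm X0 / 2 < nm X by have := nm_subl X0 X; rewrite nmBC; lra.
have X0' : X != 0 by rewrite -nm_gt0; lra.
split => //.
have -> : Y / X - Y0 / X0 = ((Y - Y0) * X0 - Y0 * (X - X0)) / (X * X0).
  by field; rewrite X00 X0'.
rewrite nmM nmV nmM ltr_pdivrMr ?mulr_gt0//; last by lra.
apply: (le_lt_trans (nmB _ _)); rewrite !nmM.
apply: (@lt_le_trans _ _ (d * nm X0 ^+ 2 / 2)); last first.
  by rewrite expr2 -!mulrA ler_pM2l//; nra.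
move: h2 h3; rewrite /S.
have := nm_ge0 (X - X0); have := nm_ge0 (Y - Y0); nra.
Qed.

Variables (z0 : 'rV[C]_nu) (calV : set 'rV[C]_nu).
Variable rho : 'rV[C]_nu -> word -> 'M[C]_2.
Hypothesis hz0 : complete_structure M predT z0 t0.
Hypothesis calVz0 : calV z0.
Hypothesis hrho : forall z, calV z -> holonomy_lift M predT z t0 (rho z).
Hypothesis crho : forall u, loop M t0 u -> {within calV, continuous (rho ^~ u)}.
Variables (i : 'I_2) (p : word).
Hypothesis hp : foldl (nbr M) t0 p = (corner (ends M (inl i))).1.
Variables m l : 'rV[C]_nu -> C.
Hypothesis heig : forall z, calV z -> exists2 e : 'cV[C]_2, e != 0 &
     rho z (based_loop M t0 p (mer (ends M (inl i)))) *m e = m z *: e /\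
     rho z (based_loop M t0 p (lon (ends M (inl i)))) *m e = l z *: e.

(** [be] is a quotient of entries of the longitude and of the meridian at one fixed off-diagonal
    position; it is close to [be0] because the entry of the meridian does not vanish at [z0]. *)
Lemma cusp_facts : [/\ m z0 ^+ 2 = 1, l z0 ^+ 2 = 1 & exists be0 : R[i],
  complex.Im (be0 * m z0 * l z0) != 0 /\
  forall d : R, 0 < d -> \forall z \near z0, calV z ->
    exists2 be : R[i], nm (be - be0) < d & l z - (l z)^-1 = be * (m z - (m z)^-1)].
Proof.
have [e e0 [em el]] := heig calVz0.
have uf : unfilled predT (inl i : 'I_2 + 'I_k) by [].
have [m2 l2 [a [b [ab X0 im]]]] := cusp_shape (hrho calVz0) hp hz0 uf e0 em el.
split => //.
pose wX := based_loop M t0 p (mer (ends M (inl i))).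
pose wY := based_loop M t0 p (lon (ends M (inl i))).
exists (rho z0 wY a b / rho z0 wX a b); split; first exact: im.
move=> d d0; have [e1 e10 he] := quotient_close (rho z0 wY a b) X0 d0.
have loopX : loop M t0 wX by apply: (based_loop_loop hp); exact: loop_mer.
have loopY : loop M t0 wY by apply: (based_loop_loop hp); exact: loop_lon.
have nX := continuous_within_mx calVz0 (crho loopX) e10.
have nY := continuous_within_mx calVz0 (crho loopY) e10.
apply: filterS2 nX nY => z nX nY hz.
have [X0' hbe] := he _ _ (nX hz a b) (nY hz a b).
have [e' e'0 [em' el']] := heig hz.
exists (rho z wY a b / rho z wX a b) => //.
have dX := based_det (hrho hz) hp (loop_mer M (inl i)).
have dY := based_det (hrho hz) hp (loop_lon M (inl i)).
have XY := based_mer_lon (hrho hz) hp.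
have [c YE] := commuting_pencil ab X0' XY.
by have [_ ->] := pencil_eigen dX dY YE e'0 em' el'.
Qed.

End CuspFacts.

(** * Coordinates on the deformation space adapted to one eigenvalue *)

Section Chart.
Variables (R : realType) (nu : nat).
Local Notation C := (R[i]^o).
Variables (V : set 'rV[C]_2) (iota : 'rV[C]_2 -> 'rV[C]_nu) (calV : set 'rV[C]_nu).
Hypothesis hiota : holomorphic_embedding V iota.
Hypothesis hV : iota @` V = calV.
Variables (P0 : 'rV[C]_2) (z0 : 'rV[C]_nu).
Hypothesis VP0 : V P0.
Hypothesis iP0 : iota P0 = z0.

Lemma chart_open : exists2 d : R, 0 < d & forall h, rn h < d -> V (P0 + h).
Proof.
have [oV _ _ _ _] := hiota.
have : \forall y \near P0, V y by apply: open_nbhs_nbhs; split.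
move=> /near_rnP [d d0 hd]; exists d => // h hh; apply: hd.
by rewrite addrAC subrr add0r.
Qed.

Lemma chart_continuous (e : R) : 0 < e -> exists2 d : R, 0 < d &
  forall h, rn h < d -> rn (iota (P0 + h) - z0) < e.
Proof.
move=> e0; have [_ df _ _ _] := hiota.
have [K [d [K0 d0 hd]]] := differentiable_lip (df _ VP0); rewrite iP0 in hd.
have K1 : 0 < 1 + K by lra.
exists (Num.min d (e / (1 + K))); first by rewrite lt_min d0 divr_gt0.
move=> h; rewrite lt_min ltr_pdivlMr// => /andP[h1 h2].
by apply: le_lt_trans (hd _ h1) _; have := rn_ge0 h; nra.
Qed.

Lemma chart_inverse_continuous (e : R) : 0 < e -> exists2 d : R, 0 < d &
  forall Q, V Q -> rn (iota Q - z0) < d -> rn (Q - P0) < e.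
Proof.
move=> e0; have [_ _ _ _ H] := hiota.
have nA : nbhs P0 [set Q | rn (Q - P0) < e].
  by apply: (proj2 (near_rnP P0 (fun Q => rn (Q - P0) < e))); exists e.
have [B nB hB] := H _ _ VP0 nA; rewrite iP0 in nB.
have [d d0 hd] := proj1 (near_rnP z0 B) nB.
by exists d => // Q VQ hQ; apply: hB => //; exact: hd.
Qed.

Lemma chart_lower : exists K d : R, [/\ 0 <= K, 0 < d &
  forall h, rn h < d -> rn h <= K * rn (iota (P0 + h) - z0)].
Proof.
have [_ df inj _ _] := hiota.
have [K K0 hK] := injective_lower (inj _ VP0).
have e0 : 0 < 1 / (2 * (1 + K)) by rewrite divr_gt0//; lra.
have [d d0 hd] := differentiable_rn (df _ VP0) e0; rewrite iP0 in hd.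
exists (2 * K), d; split => //; first by lra.
move=> h hh; have h1 := hd h hh; have h2 := hK h.
have h3 := rnD (iota (P0 + h) - z0) (- (iota (P0 + h) - z0 - 'd iota P0 h)).
rewrite rnN opprB addrC subrK in h3.
have E : K * (1 / (2 * (1 + K)) * rn h) <= rn h / 2.
  have -> : K * (1 / (2 * (1 + K)) * rn h) = K / (1 + K) * (rn h / 2) by field; lra.
  rewrite -[leRHS]mul1r ler_wpM2r ?divr_ge0 ?rn_ge0// ler_pdivrMr; lra.
have h4 : K * rn ('d iota P0 h) <=
    K * (rn (iota (P0 + h) - z0) + 1 / (2 * (1 + K)) * rn h).
  by rewrite ler_wpM2l//; lra.
lra.
Qed.

Variables (f : 'rV[C]_nu -> C) (gam : C -> 'rV[C]_nu).
Hypothesis df : differentiable (f \o iota) P0.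
Hypothesis gam0 : gam (f z0) = z0.
Hypothesis dgam : differentiable gam (f z0).
Hypothesis hgam : \forall x \near (f z0 : C), calV (gam x) /\ f (gam x) = x.

(** Otherwise [f] would vary along [gam] by [o] of the distance to [P0] in the chart, which is
    [O(x)] by [chart_lower], whereas [f (gam (f z0 + x)) - f z0 = x]. *)
Lemma parameter_diff_neq0 : exists h, 'd (f \o iota) P0 h != 0.
Proof.
apply: contrapT => h0.
have L0 h : 'd (f \o iota) P0 h = 0.
  by apply/eqP; apply: contraT => n; exfalso; apply: h0; exists h.
have [Kl [dl [Kl0 dl0 hl]]] := chart_lower.
have [Kg [dg [Kg0 dg0 hg]]] := differentiable_lip dgam; rewrite gam0 in hg.
have [db db0 hb] := proj1 (near_nmP _ _) hgam.
pose e := 1 / (2 * (1 + Kl * Kg)).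
have KK : 0 <= Kl * Kg by rewrite mulr_ge0.
have e0 : 0 < e by rewrite divr_gt0//; lra.
have [d d0 hd] := differentiable_rn df e0.
pose m := Num.min d dl.
have m0 : 0 < m by rewrite lt_min d0.
have [md mdl] : m <= d /\ m <= dl by rewrite /m !ge_min !lexx orbT.
have [di di0 hi] := chart_inverse_continuous m0.
pose x := Num.min (Num.min dg db) (di / (1 + Kg)) / 2.
have Kg1 : 0 < 1 + Kg by lra.
have mx0 : 0 < Num.min (Num.min dg db) (di / (1 + Kg)) by rewrite !lt_min dg0 db0 divr_gt0.
have [x1 x2 x3] : [/\ Num.min (Num.min dg db) (di / (1 + Kg)) <= dg,
  Num.min (Num.min dg db) (di / (1 + Kg)) <= db &
  Num.min (Num.min dg db) (di / (1 + Kg)) <= di / (1 + Kg)].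
  by rewrite !ge_min !lexx !orbT.
have x0 : 0 < x by exact: half_gt0.
pose h : C := x%:C.
have nh : nm h = x by rewrite nm_real ger0_norm// ltW.
have g1 : rn (gam (f z0 + h) - z0) <= Kg * x.
  by rewrite -nh -rn_nm; apply: hg; rewrite rn_nm nh /x; lra.
have [|cg fg] := hb (f z0 + h).
  by rewrite addrAC subrr add0r nh /x; lra.
move: cg; rewrite -hV => -[Q VQ iQ].
have hx3 : x * (1 + Kg) < di by rewrite -ltr_pdivlMr// /x; lra.
have QP : rn (Q - P0) < m.
  by apply: hi => //; rewrite iQ; apply: (le_lt_trans g1); nra.
have PQ : P0 + (Q - P0) = Q by rewrite addrC subrK.
have h1 := hl (Q - P0) ltac:(lra); rewrite PQ iQ in h1.
have := hd (Q - P0) ltac:(lra).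
rewrite PQ L0 subr0 /= iQ iP0 fg addrAC subrr add0r rn_nm nh => h2.
have h3 : rn (Q - P0) <= Kl * (Kg * x) by apply: (le_trans h1); rewrite ler_wpM2l.
have h4 : x <= e * (Kl * (Kg * x)) by apply: (le_trans h2); rewrite ler_wpM2l// ltW.
have : e * (Kl * (Kg * x)) <= x / 2.
  have -> : e * (Kl * (Kg * x)) = Kl * Kg / (1 + Kl * Kg) * (x / 2) by rewrite /e; field; lra.
  by rewrite -[leRHS]mul1r ler_wpM2r// ?ler_pdivrMr; lra.
lra.
Qed.

(** [E] spans the kernel of the differential and [D] is normalized against it, so [y] agrees with
    [f - f z0] to first order; this is the normalization [gx 0 0 = 0], [gy 0 0 = 1] used for [g]. *)
Lemma chart_coordinates : exists E D : 'rV[C]_2,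
  let Q (t y : R[i]) := P0 + t *: E + y *: D in
  [/\ 'd (f \o iota) P0 E = 0 /\ 'd (f \o iota) P0 D = 1,
    forall e : R, 0 < e -> exists2 d : R, 0 < d & forall t y, nm t < d -> nm y < d ->
      V (Q t y) /\ rn (iota (Q t y) - z0) < e,
    forall e : R, 0 < e -> exists2 d : R, 0 < d & forall z, calV z -> rn (z - z0) < d ->
      exists t y, [/\ nm t < e, nm y < e, V (Q t y) & z = iota (Q t y)] &
    forall t y t' y', V (Q t y) -> V (Q t' y') -> iota (Q t y) = iota (Q t' y') -> t = t'].
Proof.
have [E [D [T [K [LE LD hED hT hTE]]]]] := kernel_basis parameter_diff_neq0.
exists E, D => Q.
have nE := rn_ge0 E; have nD := rn_ge0 D.
have small (e : R) : 0 < e -> exists2 d : R, 0 < d & forall t y : R[i], nm t < d -> nm y < d ->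
    rn (t *: E + y *: D) < e.
  move=> e0; have S0 : 0 < 1 + rn E + rn D by lra.
  exists (e / (1 + rn E + rn D)); first by rewrite divr_gt0.
  move=> t y; rewrite !ltr_pdivlMr// => ht hy.
  apply: (le_lt_trans (rnD _ _)); rewrite !rnZ.
  have := nm_ge0 t; have := nm_ge0 y; nra.
split => //.
- move=> e e0; have [d1 d10 h1] := chart_open; have [d2 d20 h2] := chart_continuous e0.
  have [|d d0 hd] := small (Num.min d1 d2); first by rewrite lt_min d10.
  exists d => // t y ht hy; have := hd t y ht hy; rewrite lt_min => /andP[k1 k2].
  by rewrite /Q -addrA; split; [exact: h1|exact: h2].
- move=> e e0.
  have [KL KL0 hKL] := diff_rn_bound df.
  have nK : 0 <= `|K| by [].
  pose S := 1 + `|K| + KL.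
  have S0 : 0 < S by rewrite /S; lra.
  have [d d0 hd] := chart_inverse_continuous (divr_gt0 e0 S0).
  exists d => // z; rewrite -hV => -[P VP <-] hz.
  have := hd _ VP hz; rewrite ltr_pdivlMr// => hP.
  have nP := rn_ge0 (P - P0).
  exists (T (P - P0)), ('d (f \o iota) P0 (P - P0)).
  have QE : Q (T (P - P0)) ('d (f \o iota) P0 (P - P0)) = P.
    by rewrite /Q -addrA -hED addrC subrK.
  rewrite QE; split => //.
    have := hT (P - P0); have := ler_norm K; rewrite /S in hP; nra.
  by have := hKL (P - P0); rewrite rn_nm; rewrite /S in hP; nra.
- move=> t y t' y' VQ VQ' iE; have [_ _ _ inj _] := hiota.
  have QE : Q t y = Q t' y' by apply: inj => //; exact/mem_set.
  move: QE; rewrite /Q -!addrA => /addrI /(congr1 T).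
  by rewrite !hTE.
Qed.

End Chart.

(** * Slopes tending to infinity *)

Section SlopeLimit.
Variable R : realType.

Lemma coprime_infty_neq0 : \forall s \near coprime_infty, s <> (0, 0).
Proof. by exists 1%N => p q _ h [p0 q0]; move: h; rewrite p0 q0. Qed.

(** Both [q] and [p] are bounded by multiples of the modulus of [p + q tau], the first through the
    imaginary part; [S] is the sum of the two constants. *)
Lemma slope_den_large (tau : R[i]) (B : R) : complex.Im tau != 0 ->
  \forall s \near coprime_infty, B < nm (s.1%:~R + s.2%:~R * tau).
Proof.
move=> im; have i0 : 0 < `|complex.Im tau| by rewrite normr_gt0.
have nt := nm_ge0 tau.
pose S := 1 + (1 + nm tau) / `|complex.Im tau|.
have S0 : 0 < S by rewrite /S ltr_wpDr// divr_ge0//; lra.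
exists (Num.bound `|B * S|) => p q _ hN /=.
set D := nm _.
have nq := slope_den_bound tau p q; rewrite -/D in nq.
have nqle : `|q%:~R : R| <= D / `|complex.Im tau| by rewrite ler_pdivlMr.
have np : `|p%:~R : R| <= D + `|q%:~R : R| * nm tau.
  have := nm_subl (p%:~R : R[i]) (p%:~R + q%:~R * tau); rewrite -/D.
  rewrite opprD addNKr nmN nmM !intr_realC !nm_real; lra.
have sum : (`|p|%N + `|q|%N)%:R <= D * S.
  rewrite natrD !natr_absz !intr_norm /S.
  have : `|q%:~R : R| * nm tau <= D / `|complex.Im tau| * nm tau by rewrite ler_wpM2r.
  lra.
have : B * S < D * S.
  apply: lt_le_trans sum; apply: le_lt_trans (ler_norm _) _.
  apply: (lt_le_trans (archi_boundP (normr_ge0 _))).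
  by rewrite ler_nat.
by rewrite ltr_pM2r.
Qed.

End SlopeLimit.

(** * Convergence of the filled curves to the cusp curve *)

Section FilledCurves.
Variable R : realType.
Local Notation C := R[i].
Variables (u ux uy v vx vy g gx gy w wx wy : C -> C -> C) (rho : R) (tau c : C).
Hypothesis rho0 : 0 < rho.
Hypothesis Hu : hol2 u ux uy rho.
Hypothesis Hv : hol2 v vx vy rho.
Hypothesis Hg : hol2 g gx gy rho.
Hypothesis Hw : hol2 w wx wy rho.
Hypothesis u00 : u 0 0 = 0.
Hypothesis g00 : g 0 0 = 0.
Hypothesis gx00 : gx 0 0 = 0.
Hypothesis gy00 : gy 0 0 = 1.
Hypothesis HK : forall e : R, 0 < e -> exists2 d : R, 0 < d & forall x y,
  nm x < d -> nm y < d -> nm (v x y - tau * u x y) <= e * nm (u x y).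
Hypothesis tauI : complex.Im tau != 0.
Hypothesis ux0 : ux 0 0 != 0.

Lemma curve_hol (p q : C -> C) (x0 : C) (r : R) :
  (forall z, nm z < r -> [/\ nm (p z) < rho, nm (q z) < rho,
     exists d, cder p z d & exists d, cder q z d]) ->
  exists psi', hol (fun x => w (p (x - x0)) (q (x - x0))) psi' x0 r.
Proof.
move=> H; apply: hol_exists => x /H[hp hq [a ha] [b hb]].
have sh : cder (fun x : C => x - x0) x 1.
  by have := cderB (cder_id x) (cder_cst x0 x); rewrite subr0.
eexists; exact: (cder2_curve (p := fun x => p (x - x0)) (q := fun x => q (x - x0))
  (Hw hp hq) (cder_comp sh ha) (cder_comp sh hb)).
Qed.

Lemma filled_curves : exists (r : R) (p0 q0 : C -> C),
  [/\ 0 < r,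
      forall z, nm z < r ->
        [/\ nm (p0 z) < rho, nm (q0 z) < rho, u (p0 z) (q0 z) = 0, g (p0 z) (q0 z) = z &
            (exists d, cder p0 z d) /\ exists d, cder q0 z d] &
      forall (n : nat) (x0 : C) (e : R), 0 < e ->
        \forall s \near (@coprime_infty), exists p q : C -> C,
        (forall z, nm z < r ->
          [/\ nm (p z) < rho, nm (q z) < rho,
              u (p z) (q z) *~ s.1 + v (p z) (q z) *~ s.2 = c, g (p z) (q z) = z &
              (exists d, cder p z d) /\ exists d, cder q z d]) /\
        nm (derive1n n (fun x : C^o => w (p0 (x - x0)) (q0 (x - x0)) : C^o) x0 -
            derive1n n (fun x : C^o => w (p (x - x0)) (q (x - x0)) : C^o) x0) <= e].
Proof.
pose kap := `|complex.Im tau|^-1.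
have kap0 : 0 <= kap by rewrite invr_ge0.
have [d6 d60 hd6] := hol2_sdiff rho0 Hw ltr01.
have [dK dK0 hK] := HK ltr01.
(* On this smaller disk [w] is Lipschitz, and [u = 0] forces [v = 0]. *)
pose rho1 := Num.min rho (Num.min d6 dK).
have rho10 : 0 < rho1 by rewrite !lt_min rho0 d60.
have inb (x : C) : nm x < rho1 -> [/\ nm x < rho, nm x < d6 & nm x < dK].
  by rewrite !lt_min => /and3P[].
have restrict f fx fy : hol2 f fx fy rho -> hol2 f fx fy rho1.
  by move=> H x y /inb[hx _ _] /inb[hy _ _]; exact: H.
have [r1 [r' [L [r10 r1rho r'0 L0 HI]]]] :=
  uniform_inverse rho10 (restrict _ _ _ Hu) (restrict _ _ _ Hv) (restrict _ _ _ Hg)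
    u00 g00 gx00 gy00 HK ux0 kap0.
have small (x y : C) : nm x + nm y <= r1 / 2 ->
    [/\ nm x + nm y <= r1, nm x < rho1 & nm y < rho1].
  by move=> h; have := nm_ge0 x; have := nm_ge0 y; split; lra.
have uv0 x y : nm x < dK -> nm y < dK -> u x y = 0 -> v x y = 0.
  move=> hx hy ut; have := hK x y hx hy; rewrite ut mulr0 subr0 nm0 mulr0 => h.
  by apply/eqP; rewrite -nm_eq0 eq_le h nm_ge0.
have n0r' : nm (0 : C) < r' by rewrite nm0.
(* [K = 0] and [eta = 0] give the curve [u = 0], the cusp locus. *)
have [_ sol0] := HI 0 ltac:(by rewrite nm0).
have [p0 [q0 H0]] := sol0 0 n0r'.
have H0' z : nm z < r' -> [/\ nm (p0 z) < rho1, nm (q0 z) < rho1,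
    u (p0 z) (q0 z) = 0, g (p0 z) (q0 z) = z & nm (p0 z) + nm (q0 z) <= r1].
  move=> /H0[h1 h2 h3 _ _]; have [h4 h5 h6] := small _ _ h1.
  by split => //; move: h2; rewrite /pencil mul0r addr0.
exists r', p0, q0; split => //.
  move=> z hz; have [/inb[? _ _] /inb[? _ _] ? ? _] := H0' z hz.
  by have [_ _ _ ? ?] := H0 z hz; split.
move=> n x0 e e0.
have [psi0' Hpsi0] : exists psi', hol (fun x => w (p0 (x - x0)) (q0 (x - x0))) psi' x0 r'.
  apply: curve_hol => z hz; have [/inb[? _ _] /inb[? _ _] _ _ _] := H0' z hz.
  by have [_ _ _ ? ?] := H0 z hz; split.
have [e1 e10 he1] := derive1n_close x0 n r'0 e0.
pose Kw := 1 + nm (wx 0 0) + nm (wy 0 0).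
have Kw0 : 0 < Kw by rewrite /Kw; have := nm_ge0 (wx 0 0); have := nm_ge0 (wy 0 0); lra.
have nc := nm_ge0 c.
(* Thresholds for the modulus of [p + q tau]: [B1] puts [eta] in the range of [uniform_inverse], and
   [B2] brings the values of [w] on the two curves within [e1]. *)
pose B1 := nm c / r'; pose B2 := Kw * (1 + L) * nm c / e1.
have B10 : 0 <= B1 by rewrite divr_ge0// ltW.
have B20 : 0 <= B2.
  by apply: divr_ge0 (ltW e10); apply: mulr_ge0 nc; apply: mulr_ge0 (ltW Kw0) _; lra.
apply: filterS2 (slope_den_large (B1 + B2) tauI) coprime_infty_neq0 => -[p q] /= hB nz.
set Dn := p%:~R + q%:~R * tau in hB.
have Dn0 : Dn != 0 by apply: slope_den_neq0.
have nD : 0 < nm Dn by rewrite nm_gt0.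
pose K := q%:~R / Dn; pose eta := c / Dn.
have Kle : nm K <= kap by exact: slope_ratio_bound.
have neta : nm eta = nm c / nm Dn by rewrite nmM nmV.
have eta1 : nm eta < r'.
  rewrite neta ltr_pdivrMr// -ltr_pdivrMl// mulrC; apply: le_lt_trans hB.
  by rewrite -/B1; lra.
have eta2 : Kw * (L * nm eta) <= e1.
  apply: (@le_trans _ _ (Kw * (1 + L) * nm c / nm Dn)).
    rewrite neta -!mulrA ler_wpM2l ?(ltW Kw0)// ler_wpM2r ?divr_ge0 ?(ltW nD)//; lra.
  rewrite ler_pdivrMr// [e1 * _]mulrC -ler_pdivrMr//; apply: le_trans (ltW hB).
  by rewrite -/B2; lra.
have [lipK solK] := HI K Kle.
have [ps [qs Hs]] := solK eta eta1.
have Hs' z : nm z < r' -> [/\ nm (ps z) < rho1, nm (qs z) < rho1 & nm (ps z) + nm (qs z) <= r1].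
  by move=> /Hs[h1 _ _ _ _]; have [h4 h5 h6] := small _ _ h1.
exists ps, qs; split.
  move=> z hz; have [/inb[? _ _] /inb[? _ _] _] := Hs' z hz.
  have [_ h2 h3 h4 h5] := Hs z hz; split => //; move: h2; rewrite /pencil /K /eta => h.
  have := congr1 ( *%R Dn) h; rewrite [X in _ = X]mulrC divfK// => <-.
  rewrite -[u _ _ *~ p]mulrzl -[v _ _ *~ q]mulrzl mulrDr.
  set U := u _ _; set V := v _ _.
  have -> : Dn * (q%:~R / Dn * (V - tau * U)) = q%:~R * (V - tau * U).
    by rewrite mulrA [Dn * _]mulrC divfK.
  by rewrite /Dn; ring.
have [psi' Hpsi] : exists psi', hol (fun x => w (ps (x - x0)) (qs (x - x0))) psi' x0 r'.
  apply: curve_hol => z hz; have [/inb[? _ _] /inb[? _ _] _] := Hs' z hz.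
  by have [_ _ _ ? ?] := Hs z hz; split.
apply: (he1 _ _ _ _ Hpsi0 Hpsi) => x hx.
have [/inb[_ a1 a2] /inb[_ b1 b2] ut gt ht] := H0' _ hx.
have [/inb[_ c1 c2] /inb[_ d1 d2] hs] := Hs' _ hx.
have [_ k2 k3 _ _] := Hs _ hx.
set t := p0 _ in a1 a2 ut gt ht *; set y := q0 _ in b1 b2 ut gt ht *.
set t' := ps _ in c1 c2 hs k2 k3 *; set y' := qs _ in d1 d2 hs k2 k3 *.
(* On the cusp curve [u] and [v] both vanish, so it solves [pencil K = 0] for every [K]; the common
   Lipschitz bound then compares it with the solution of [pencil K = eta]. *)
have P0E : pencil u v tau K t y = 0.
  by rewrite /pencil ut (uv0 _ _ a2 b2 ut) mulr0 subr0 mulr0 addr0.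
have := lipK t' y' t y hs ht.
rewrite P0E k2 sub0r nmN gt k3 subrr nm0 addr0 => hN.
have := hd6 t' y' t y c1 d1 a1 b1; rewrite mul1r => hl6.
have f1 := nm_subl (w t y - w t' y') (wx 0 0 * (t - t') + wy 0 0 * (y - y')).
rewrite opprD addrA in f1.
have f2 := nmD (wx 0 0 * (t - t')) (wy 0 0 * (y - y')); rewrite !nmM in f2.
have n1 := nm_ge0 (t - t'); have n2 := nm_ge0 (y - y').
have n3 := nm_ge0 (wx 0 0); have n4 := nm_ge0 (wy 0 0).
apply: le_trans eta2; apply: (@le_trans _ _ (Kw * (nm (t - t') + nm (y - y')))).
  by rewrite /Kw; nra.
by rewrite ler_wpM2l// ltW.
Qed.

End FilledCurves.

Lemma hol2_exists (R : realType) (f : R[i] -> R[i] -> R[i]) (rho : R) :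
  (forall x y, nm x < rho -> nm y < rho -> exists a b, cder2 f x y a b) ->
  exists fx fy, hol2 f fx fy rho.
Proof.
move=> H.
exists (fun x y => (xget (0, 0) [set ab | cder2 f x y ab.1 ab.2]).1).
exists (fun x y => (xget (0, 0) [set ab | cder2 f x y ab.1 ab.2]).2) => x y hx hy.
have [a [b hab]] := H x y hx hy.
by case: xgetP => [ab -> //|/(_ (a, b))]; case.
Qed.

Lemma sqr1_neq0 (R : realType) (z : R[i]) : z ^+ 2 = 1 -> z != 0 /\ nm z = 1.
Proof.
move=> z2; split.
  by apply/eqP => z0; move: z2; rewrite z0 expr0n /= => /eqP; rewrite eq_sym oner_eq0.
by apply/eqP; rewrite -(@pexpr_eq1 _ _ 2)// ?nm_ge0// -nmX z2 nm1.
Qed.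

Section LogCoordinates.
Variables (R : realType) (nu : nat) (J : R[i] -> R[i] -> 'rV[R[i]^o]_nu).
Variables (z0 : 'rV[R[i]^o]_nu) (d1 : R).
Hypothesis J00 : J 0 0 = z0.
Hypothesis d10 : 0 < d1.

Definition smooth_on (f : 'rV[R[i]^o]_nu -> R[i]) := forall t y, nm t < d1 -> nm y < d1 ->
  exists a b, cder2 (fun t y => f (J t y)) t y a b.

Lemma smooth_on_close f (e : R) : smooth_on f -> 0 < e -> exists2 d : R, 0 < d &
  forall t y : R[i], nm t < d -> nm y < d -> nm (f (J t y) - f z0) < e.
Proof.
move=> hf e0; have n0 : nm (0 : R[i]) < d1 by rewrite nm0.
have [a [b ab]] := hf 0 0 n0 n0.
have [d d0 hd] := cder2_cont ab e0; exists d => // t y ht hy.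
by have := hd t y; rewrite !subr0 J00; apply.
Qed.

Lemma log_coordinate f : smooth_on f -> f z0 ^+ 2 = 1 ->
  exists (lg : R[i] -> R[i] -> R[i]) (d : R), [/\ 0 < d, lg 0 0 = 0 &
    forall t y : R[i], nm t < d -> nm y < d ->
      [/\ cexp (lg t y) = f (J t y) / f z0,
          - pi < complex.Im (lg t y) <= pi & exists a b, cder2 lg t y a b]].
Proof.
move=> hf f2; have [f0 nf] := sqr1_neq0 f2.
have [rL [Log [rL0 hLog Log1]]] := local_log R.
have [d d0 hd] := smooth_on_close hf rL0.
exists (fun t y => Log (f (J t y) / f z0)), (Num.min d d1).
split; [by rewrite lt_min d0|by rewrite J00 divff|].
move=> t y; rewrite !lt_min => /andP[t1 t2] /andP[y1 y2].
have w1 : nm (f (J t y) / f z0 - 1) < rL.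
  have -> : f (J t y) / f z0 - 1 = (f (J t y) - f z0) / f z0 by rewrite mulrBl divff.
  by rewrite nmM nmV nf invr1 mulr1; exact: hd.
have [h1 h2 [c hc]] := hLog _ w1; split => //.
have [a [b ab]] := hf t y t2 y2.
exists (c * ((f z0)^-1 * a)), (c * ((f z0)^-1 * b)).
apply: (cder2_comp (f := fun t y => f (J t y) / f z0)) hc.
have := cder2Z (f z0)^-1 ab; congr cder2.
by apply/funext => t'; apply/funext => y'; rewrite mulrC.
Qed.

Lemma log_coordinates_tangent (f1 f2 : 'rV[R[i]^o]_nu -> R[i]) (u v : R[i] -> R[i] -> R[i])
    (be0 : R[i]) (d2 : R) : f1 z0 ^+ 2 = 1 -> f2 z0 ^+ 2 = 1 ->
  0 < d2 -> u 0 0 = 0 -> v 0 0 = 0 ->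
  (forall t y : R[i], nm t < d2 -> nm y < d2 ->
      [/\ cexp (u t y) = f1 (J t y) / f1 z0, cexp (v t y) = f2 (J t y) / f2 z0,
          exists a b, cder2 u t y a b & exists a b, cder2 v t y a b]) ->
  (forall e : R, 0 < e -> exists2 d : R, 0 < d & forall t y : R[i], nm t < d -> nm y < d ->
    exists2 be : R[i], nm (be - be0) < e &
      f2 (J t y) - (f2 (J t y))^-1 = be * (f1 (J t y) - (f1 (J t y))^-1)) ->
  forall e : R, 0 < e -> exists2 d : R, 0 < d & forall t y : R[i], nm t < d -> nm y < d ->
    nm (v t y - be0 * f1 z0 * f2 z0 * u t y) <= e * nm (u t y).
Proof.
move=> h1 h2 d20 u00 v00 huv hrel e e0.
have [m00 _] := sqr1_neq0 h1; have [l00 _] := sqr1_neq0 h2.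
have [d d0 hd] := log_relation be0 h1 h2 e0.
have n0 : nm (0 : R[i]) < d2 by rewrite nm0.
have [_ _ [a [b ab]] [a' [b' ab']]] := huv 0 0 n0 n0.
have [da da0 hda] := cder2_cont ab d0.
have [db db0 hdb] := cder2_cont ab' d0.
have [dc dc0 hdc] := hrel d d0.
exists (Num.min (Num.min da db) (Num.min dc d2)).
  by rewrite !lt_min da0 db0 dc0.
move=> t y; rewrite !lt_min.
move=> /andP[/andP[t1 t2] /andP[t3 t4]] /andP[/andP[y1 y2] /andP[y3 y4]].
have [be hbe rel] := hdc t y t3 y3.
have [eu ev _ _] := huv t y t4 y4.
apply: (hd _ _ (f1 (J t y)) (f2 (J t y)) be) => //.
- by have := hda t y; rewrite !subr0 u00 subr0; apply.
- by have := hdb t y; rewrite !subr0 v00 subr0; apply.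
- by rewrite eu mulrC divfK.
- by rewrite ev mulrC divfK.
Qed.

End LogCoordinates.

(** * The expansion read on a parametrized curve *)

Section Germ.
Variables (R : realType) (nu : nat) (V : set 'rV[R[i]^o]_2).
Variables (iota : 'rV[R[i]^o]_2 -> 'rV[R[i]^o]_nu) (P0 E D : 'rV[R[i]^o]_2).

(** Near [zb] a point of [S] is determined by its value of [m]; hence any curve of [S] through [zb]
    that is parametrized by [m] computes [phi]. *)
Lemma local_expansion_germ (S : set 'rV[R[i]^o]_nu) (m l : 'rV[R[i]^o]_nu -> R[i]^o)
    (zb : 'rV[R[i]^o]_nu) (phi : R[i]^o -> R[i]^o) (p q : R[i] -> R[i]) (r : R) (dp dq : R[i]) :
  let curve z := iota (P0 + p z *: E + q z *: D) in
  differentiable iota (P0 + p 0 *: E + q 0 *: D) ->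
  0 < r -> cder p 0 dp -> cder q 0 dq -> curve 0 = zb ->
  (forall z, nm z < r -> S (curve z) /\ m (curve z) = m zb + z) ->
  local_expansion S m l zb phi ->
  \forall x \near (m zb : R[i]^o), phi x = l (curve (x - m zb)).
Proof.
move=> curve dio r0 ha hb base HS [_ [gam [_ _ hgs gsS]]].
have [d8 d80 hd8] := proj1 (near_rnP _ _) gsS.
have [d9 d90 hd9] := proj1 (near_nmP _ _) hgs.
have [Ki [di [Ki0 di0 hdi]]] := differentiable_lip dio.
have nE := rn_ge0 E; have nDD := rn_ge0 D.
pose T := 1 + rn E + rn D.
have T0 : 0 < T by rewrite /T; lra.
pose d10' := Num.min (di / T) (d8 / (1 + Ki) / T).
have d100 : 0 < d10' by rewrite lt_min !divr_gt0//; lra.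
have [da da0 hda] := cder_cont ha d100.
have [db db0 hdb] := cder_cont hb d100.
apply/near_nmP; exists (Num.min (Num.min da db) (Num.min r d9)).
  by rewrite !lt_min da0 db0 r0.
move=> x; rewrite !lt_min => /andP[/andP[x1 x2] /andP[x3 x4]].
set z := x - m zb in x1 x2 x3 *.
have zE : m zb + z = x by rewrite /z addrC subrK.
have [Sz mz] := HS z x3.
have := hda z; rewrite subr0 => /(_ x1); rewrite lt_min !ltr_pdivlMr//; last by lra.
move=> /andP[k1 k2].
have := hdb z; rewrite subr0 => /(_ x2); rewrite lt_min !ltr_pdivlMr//; last by lra.
move=> /andP[k3 k4].
pose hh := (p z - p 0) *: E + (q z - q 0) *: D.
have hhle : rn hh <= nm (p z - p 0) * rn E + nm (q z - q 0) * rn D.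
  by apply: (le_trans (rnD _ _)); rewrite !rnZ.
have na := nm_ge0 (p z - p 0); have nb := nm_ge0 (q z - q 0).
have hh1 : rn hh < di by apply: (le_lt_trans hhle); rewrite /T in k1 k3; nra.
have hh2 : rn hh * (1 + Ki) < d8.
  apply: (@le_lt_trans _ _ ((nm (p z - p 0) * rn E + nm (q z - q 0) * rn D) * (1 + Ki))).
    by rewrite ler_wpM2r//; lra.
  move: k2 k4; rewrite /T; set A1 := nm (p z - p 0) in na *.
  set A2 := nm (q z - q 0) in nb *; nra.
have JE : curve z = iota (P0 + p 0 *: E + q 0 *: D + hh).
  rewrite /curve /hh !scalerBl; congr iota.
  by apply/matrixP => a1 b1; rewrite !mxE; ring.
have Jn : rn (curve z - zb) < d8.
  rewrite JE -base; apply: (le_lt_trans (hdi _ hh1)).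
  by have := rn_ge0 hh; nra.
have -> := hd8 _ Jn Sz; rewrite mz zE.
by have [_ _ ->] := hd9 x x4.
Qed.

End Germ.

(** * Limit of the Taylor coefficients *)

Section ExpansionLimit.
Variables (R : realType) (nu : nat).
Local Notation C := (R[i]^o).
Variables (z0 : 'rV[C]_nu) (calV : set 'rV[C]_nu) (V : set 'rV[C]_2).
Variables (iota : 'rV[C]_2 -> 'rV[C]_nu).
Hypothesis hiota : holomorphic_embedding V iota.
Hypothesis hV : iota @` V = calV.
Hypothesis cz0 : calV z0.
Variables (m1 l1 m2 l2 : 'rV[C]_nu -> C).
Hypothesis hm1 : forall x, V x -> differentiable (m1 \o iota) x.
Hypothesis hl1 : forall x, V x -> differentiable (l1 \o iota) x.
Hypothesis hm2 : forall x, V x -> differentiable (m2 \o iota) x.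
Hypothesis hl2 : forall x, V x -> differentiable (l2 \o iota) x.
Hypothesis m1sq : m1 z0 ^+ 2 = 1.
Hypothesis l1sq : l1 z0 ^+ 2 = 1.
Hypothesis m2sq : m2 z0 ^+ 2 = 1.
Hypothesis l2sq : l2 z0 ^+ 2 = 1.
Variable be0 : R[i].
Hypothesis be0I : complex.Im (be0 * m1 z0 * l1 z0) != 0.
Hypothesis rel1 : forall d : R, 0 < d -> \forall z \near z0, calV z ->
  exists2 be : R[i], nm (be - be0) < d & l1 z - (l1 z)^-1 = be * (m1 z - (m1 z)^-1).
Hypothesis rel2 : \forall z \near z0, calV z ->
  exists be : R[i], l2 z - (l2 z)^-1 = be * (m2 z - (m2 z)^-1).
Variable phi : C -> C.
Hypothesis hphi : local_expansion (cusp_locus calV m1 l1 z0) m2 l2 z0 phi.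
Variable zpq : int -> int -> 'rV[C]_nu.
Hypothesis hzpq : (fun s => zpq s.1 s.2) @ coprime_infty --> z0.
Hypothesis zpq_unique : exists2 U, nbhs z0 U &
  \forall s \near coprime_infty, forall z,
    U z /\ [/\ filled_locus calV m1 l1 z0 s.1 s.2 z, m2 z = m2 z0 & l2 z = l2 z0] <->
    z = zpq s.1 s.2.
Variable phipq : int -> int -> C -> C.
Hypothesis hphipq : \forall s \near coprime_infty,
  local_expansion (filled_locus calV m1 l1 z0 s.1 s.2) m2 l2 (zpq s.1 s.2) (phipq s.1 s.2).

(** Where [m2 = m2 z0], which is its own inverse, [l2] is its own inverse too, so it is 1 or -1;
    closeness to [l2 z0] decides the sign. *)
Lemma l2_determined : \forall z \near z0, calV z -> nm (l2 z - l2 z0) < 1 ->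
  m2 z = m2 z0 -> l2 z = l2 z0.
Proof.
apply: filterS rel2 => z h /h[be] + hL gt; rewrite gt.
have [m0 _] := sqr1_neq0 m2sq; have [l0 nl0] := sqr1_neq0 l2sq.
have -> : (m2 z0)^-1 = m2 z0 by apply: (mulfI m0); rewrite mulfV// -expr2.
rewrite subrr mulr0 => /eqP; rewrite subr_eq0 => /eqP lV.
have L0 : l2 z != 0 by apply/eqP => L0; move: hL; rewrite L0 sub0r nmN nl0 ltxx.
have L2 : l2 z ^+ 2 = l2 z0 ^+ 2 by rewrite l2sq expr2 {1}lV mulVf.
move/eqP: L2; rewrite eqf_sqr => /orP[/eqP //|/eqP LN].
move: hL; rewrite LN -opprD nmN -mulr2n -mulr_natr nmM nm_natr nl0 mul1r.
by move=> /ltW; rewrite (_ : 1 = 1%:R)// ler_nat.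
Qed.

Theorem expansion_limit (n : nat) :
  (fun s => derive1n n (phipq s.1 s.2) (m2 z0)) @ coprime_infty --> derive1n n phi (m2 z0).
Proof.
have [P0 VP0 iP0] : exists2 P0, V P0 & iota P0 = z0 by move: cz0; rewrite -hV.
have [_ [gam [gam0 dgam hgam gamS]]] := hphi.
have hgam' : \forall x \near (m2 z0 : C), calV (gam x) /\ m2 (gam x) = x.
  by apply: filterS hgam => x [[? _ _] ? _].
have [E [D /= [[LE LD] C1 C2 C3]]] := chart_coordinates hiota hV VP0 iP0
  (hm2 VP0) gam0 (nbhs_singleton dgam) hgam'.
pose J (t y : R[i]) := iota (P0 + t *: E + y *: D).
have J00 : J 0 0 = z0 by rewrite /J !scale0r !addr0.
have calJ t y : V (P0 + t *: E + y *: D) -> calV (J t y).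
  by move=> h; rewrite -hV; exists (P0 + t *: E + y *: D).
have [U nU uniqU] := zpq_unique.
have [dz dz0 hdz] : exists2 d : R, 0 < d & forall z, rn (z - z0) < d ->
    [/\ cusp_locus calV m1 l1 z0 z -> z = gam (m2 z), U z &
        calV z -> nm (l2 z - l2 z0) < 1 -> m2 z = m2 z0 -> l2 z = l2 z0].
  by apply/near_rnP; apply: filterS3 gamS nU l2_determined => z.
have [d1 d10 hd1] := C1 dz dz0.
have smooth (f : 'rV[C]_nu -> C) :
    (forall x, V x -> differentiable (f \o iota) x) -> smooth_on J d1 f.
  by move=> hf t y /hd1 h /h[Q _]; do 2 eexists; exact: (cder2_of_diff (hf _ Q)).
have [u [du [du0 u00 hdu]]] := log_coordinate J00 d10 (smooth _ hm1) m1sq.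
have [v [dv [dv0 v00' hdv]]] := log_coordinate J00 d10 (smooth _ hl1) l1sq.
pose g (t y : R[i]) : R[i] := m2 (J t y) - m2 z0.
have g00 : g 0 0 = 0 by rewrite /g J00 subrr.
pose tau := be0 * m1 z0 * l1 z0.
have HK (e : R) : 0 < e -> exists2 d : R, 0 < d & forall x y,
    nm x < d -> nm y < d -> nm (v x y - tau * u x y) <= e * nm (u x y).
  have duv : 0 < Num.min du dv by rewrite lt_min du0.
  apply: (log_coordinates_tangent (J := J) m1sq l1sq duv u00 v00') => [t y|e' e'0].
    rewrite !lt_min => /andP[t1 t2] /andP[y1 y2].
    by have [? _ ?] := hdu t y t1 y1; have [? _ ?] := hdv t y t2 y2.
  have [dr dr0 hdr] := proj1 (near_rnP _ _) (rel1 e'0).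
  have [dc dc0 hdc] := C1 dr dr0; exists dc => // t y ht hy.
  by have [VQ Jz] := hdc t y ht hy; exact: (hdr _ Jz (calJ t y VQ)).
have [dK dK0 hK] := HK 1 ltr01.
have [dl dl0 hdl] := smooth_on_close J00 d10 (smooth _ hl2) ltr01.
have [d5 d50 hd5] := proj1 (near_nmP _ _) hgam.
have [lx [ly Hl]] := hol2_exists (smooth _ hl2).
pose rho0 := Num.min (Num.min d1 du) (Num.min (Num.min dv dK) dl).
have rho00 : 0 < rho0 by rewrite !lt_min d10 du0 dv0 dK0 dl0.
have inb (t : R[i]) : nm t < rho0 -> [/\ nm t < d1, nm t < du & nm t < dv] /\
    nm t < dK /\ nm t < dl.
  by rewrite !lt_min => /andP[/andP[? ?] /andP[/andP[? ?] ?]].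
have restrict f fx fy : hol2 f fx fy d1 -> hol2 f fx fy rho0.
  by move=> H x y /inb[[hx _ _] _] /inb[[hy _ _] _]; exact: H.
have [ux [uy Hu]] : exists fx fy, hol2 u fx fy rho0.
  apply: hol2_exists => t y /inb[[_ ht _] _] /inb[[_ hy _] _].
  by have [_ _ h] := hdu t y ht hy.
have [vx [vy Hv]] : exists fx fy, hol2 v fx fy rho0.
  apply: hol2_exists => t y /inb[[_ _ ht] _] /inb[[_ _ hy] _].
  by have [_ _ h] := hdv t y ht hy.
pose gx (t y : R[i]) : R[i] := 'd (m2 \o iota) (P0 + t *: E + y *: D) E - 0.
pose gy (t y : R[i]) : R[i] := 'd (m2 \o iota) (P0 + t *: E + y *: D) D - 0.
have inD t y : nm t < rho0 -> nm y < rho0 -> V (P0 + t *: E + y *: D) /\ rn (J t y - z0) < dz.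
  by move=> /inb[[ht _ _] _] /inb[[hy _ _] _]; exact: hd1.
have Hg : hol2 g gx gy rho0.
  move=> t y ht hy; have [VQ _] := inD t y ht hy.
  by apply: cder2B (cder2_cst _ _ _); exact: cder2_of_diff (hm2 VQ).
have gx00 : gx 0 0 = 0 by rewrite /gx !scale0r !addr0 subr0.
have gy00 : gy 0 0 = 1 by rewrite /gy !scale0r !addr0 subr0.
have cuspE t y : nm t < rho0 -> nm y < rho0 -> u t y = 0 ->
    cusp_locus calV m1 l1 z0 (J t y).
  move=> ht hy ut; have [VQ _] := inD t y ht hy.
  have [[_ t1 t2] [t3 _]] := inb t ht; have [[_ y1 y2] [y3 _]] := inb y hy.
  have [e1 _ _] := hdu t y t1 y1; have [e2 _ _] := hdv t y t2 y2.
  have vt : v t y = 0.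
    have := hK t y t3 y3; rewrite ut mulr0 subr0 nm0 mulr0 => h.
    by apply/eqP; rewrite -nm_eq0 eq_le h nm_ge0.
  have [m0 _] := sqr1_neq0 m1sq; have [l0 _] := sqr1_neq0 l1sq.
  split; first exact: calJ.
    by move: e1; rewrite ut cexp0 => /(congr1 ( *%R^~ (m1 z0))); rewrite mul1r divfK.
  by move: e2; rewrite vt cexp0 => /(congr1 ( *%R^~ (l1 z0))); rewrite mul1r divfK.
have l2E t y : nm t < rho0 -> nm y < rho0 -> g t y = 0 -> l2 (J t y) = l2 z0.
  move=> ht hy /eqP; rewrite /g subr_eq0 => /eqP gt.
  have [VQ Jz] := inD t y ht hy; have [_ _ h] := hdz _ Jz.
  have [_ [_ t1]] := inb t ht; have [_ [_ y1]] := inb y hy.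
  exact: h (calJ t y VQ) (hdl t y t1 y1) gt.
(* Principal logarithms are unique, so those provided by [filled_locus] are [u] and [v]. *)
have fillE p q t y : nm t < rho0 -> nm y < rho0 ->
    filled_locus calV m1 l1 z0 p q (J t y) <-> u t y *~ p + v t y *~ q = 0 +i* pi.
  move=> ht hy; have [[_ t1 t2] _] := inb t ht; have [[_ y1 y2] _] := inb y hy.
  have [eu iu _] := hdu t y t1 y1; have [ev iv _] := hdv t y t2 y2.
  split=> [[_ [u' [v' [[eu' iu'] [ev' iv'] h]]]]|h].
    have -> : u t y = u' by apply: cexp_inj => //; rewrite eu eu'.
    have -> : v t y = v' by apply: cexp_inj => //; rewrite ev ev'.
    exact: h.
  split; first by apply: calJ; case: (inD t y ht hy).
  by exists (u t y), (v t y); split.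
have Jinj t y t' y' : nm t < rho0 -> nm y < rho0 -> nm t' < rho0 -> nm y' < rho0 ->
    J t y = J t' y' -> t = t'.
  by move=> h1 h2 h3 h4; apply: C3; [case: (inD t y h1 h2)|case: (inD t' y' h3 h4)].
have pi0 : (0 +i* pi : R[i]) != 0.
  by rewrite -nm_gt0; apply: lt_le_trans (Im_le_nm _); rewrite /= normr_gt0 gt_eqF// pi_gt0.
have zpqP p q t y : nm t < rho0 -> nm y < rho0 ->
    (forall z, U z /\ [/\ filled_locus calV m1 l1 z0 p q z, m2 z = m2 z0 & l2 z = l2 z0]
       <-> z = zpq p q) ->
    u t y *~ p + v t y *~ q = 0 +i* pi -> g t y = 0 -> J t y = zpq p q.
  move=> ht hy hz huv gt; apply/hz; have [_ Jz] := inD t y ht hy.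
  have [_ Uz _] := hdz _ Jz; split => //; split; first exact/fillE.
    by move: gt; rewrite /g => /eqP; rewrite subr_eq0 => /eqP.
  exact: l2E.
(* The cusp locus meets [g = 0] only at [z0], being parametrized by [m2]; for a suitable slope [zpq]
   is close to [z0] and is, by uniqueness, the only nearby point of the filled locus on [g = 0]. *)
have ux0 : ux 0 0 != 0.
  apply: (nondegenerate rho00 Hu Hv Hg u00 g00 gx00 gy00 HK be0I rho00 pi0).
    move=> t y ht hy ut gt; apply: (Jinj t y 0 0) => //; rewrite ?nm0//.
    have [VQ Jz] := inD t y ht hy; have [h _ _] := hdz _ Jz.
    move/eqP: gt; rewrite /g subr_eq0 => /eqP gt.
    by rewrite (h (cuspE t y ht hy ut)) gt gam0 J00.
  move=> d d0; pose dd := Num.min d rho0.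
  have dd0 : 0 < dd by rewrite lt_min d0.
  have [e e0 he] := C2 dd dd0.
  have nearz : \forall s \near (@coprime_infty), rn (zpq s.1 s.2 - z0) < e.
    have : \forall z \near z0, rn (z - z0) < e by apply/near_rnP; exists e.
    by move=> /hzpq.
  have [[p q] [/= hz1 [hz2 hz3]]] := filter_ex (filterI nearz (filterI coprime_infty_neq0 uniqU)).
  have [Uz [fz mz lz]] := proj2 (hz3 (zpq p q)) erefl.
  have [t [y [ht hy VQ zE]]] := he _ fz.1 hz1.
  have [ht1 ht2] : nm t < d /\ nm t < rho0 by apply/andP; rewrite -lt_min.
  have [hy1 hy2] : nm y < d /\ nm y < rho0 by apply/andP; rewrite -lt_min.
  exists p, q, t, y; split => //.
    split; first by apply: (proj1 (fillE p q t y ht2 hy2)); rewrite /J -zE.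
    by rewrite /g /J -zE mz subrr.
  move=> t' y' ht' hy' eq' gt'.
  apply: (Jinj t' y' t y) => //.
  by rewrite (zpqP p q t' y') // zE.
have [r [p0 [q0 [r0 H0 Hlim]]]] := filled_curves (0 +i* pi) rho00 Hu Hv Hg (restrict _ _ _ Hl)
  u00 g00 gx00 gy00 HK be0I ux0.
have n0r : nm (0 : R[i]) < r by rewrite nm0.
have mJ t y z : g t y = z -> m2 (J t y) = m2 z0 + z by move=> <-; rewrite /g addrC subrK.
(* Both expansions are compared through germs at the same point [m2 z0], since [m2] takes this value
   at [zpq p q] too. *)
have germ0 : \forall x \near (m2 z0 : C), phi x = l2 (J (p0 (x - m2 z0)) (q0 (x - m2 z0))).
  have [h1 h2 h3 h4 [[a ha] [b hb]]] := H0 0 n0r; have [VQ Jz] := inD _ _ h1 h2.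
  have [_ dio _ _ _] := hiota.
  apply: (local_expansion_germ (dio _ VQ) r0 ha hb _ _ hphi).
    have [h _ _] := hdz _ Jz; rewrite -/(J _ _) (h (cuspE _ _ h1 h2 h3)).
    by rewrite (mJ _ _ _ h4) addr0 gam0.
  move=> z /H0[k1 k2 k3 k4 _]; rewrite -/(J _ _); split; first exact: cuspE.
  exact: mJ.
apply/cvgrPdist_le => -[e eI]; rewrite ltcE /= => /andP[/eqP -> e0].
apply: filterS3 (Hlim n (m2 z0) e e0) uniqU hphipq => -[p q] /= [ps [qs [Hs close]]] hz hexp.
have [h1 h2 h3 h4 [[a ha] [b hb]]] := Hs 0 n0r; have [VQ Jz] := inD _ _ h1 h2.
have base : J (ps 0) (qs 0) = zpq p q by exact: zpqP.
have [_ [_ mz _]] := proj2 (hz (zpq p q)) erefl.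
have germ : \forall x \near (m2 z0 : C),
    phipq p q x = l2 (J (ps (x - m2 z0)) (qs (x - m2 z0))).
  have [_ dio _ _ _] := hiota.
  rewrite -mz; apply: (local_expansion_germ (dio _ VQ) r0 ha hb base _ hexp).
  move=> z /Hs[k1 k2 k3 k4 _]; rewrite -/(J _ _) mz; split; last exact: mJ.
  exact/fillE.
rewrite (derive1n_near n germ0) (derive1n_near n germ) normE lecR.
exact: close.
Qed.

End ExpansionLimit.

Theorem theorem3p4 (R : realType) (nu k : nat) (M : dehn_filling nu k)
  (t0 : 'I_nu)
  (* the triangulated manifold is hyperbolic, with positively oriented ideal
     tetrahedra *)
  (hN : exists w : 'rV[R[i]^o]_nu,
     (forall t, 0 < complex.Im (w 0 t)) /\ complete_structure M pred0 w t0)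
  (* z0 is the complete structure of M *)
  (z0 : 'rV[R[i]^o]_nu) (hz0 : complete_structure M predT z0 t0)
  (* the deformation space calV near z0 *)
  (calV : set 'rV[R[i]^o]_nu)
  (hcalV : exists2 W, open_nbhs z0 W & calV = W `&` gluing_variety M predT)
  (V : set 'rV[R[i]^o]_2) (iota : 'rV[R[i]^o]_2 -> 'rV[R[i]^o]_nu)
  (hiota : holomorphic_embedding V iota) (hV : iota @` V = calV)
  (* lifts of the holonomies, depending continuously on the shape *)
  (rho : 'rV[R[i]^o]_nu -> word -> 'M[R[i]^o]_2)
  (hrho : forall z, calV z -> holonomy_lift M predT z t0 (rho z))
  (crho : forall u, loop M t0 u -> {within calV, continuous (rho ^~ u)})
  (* paths from t0 to the two cusps *)
  (tail : 'I_2 -> word)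
  (htail : forall i, foldl (nbr M) t0 (tail i) = (corner (ends M (inl i))).1)
  (* common eigenvalues of the meridians and longitudes *)
  (m l : 'I_2 -> 'rV[R[i]^o]_nu -> R[i]^o)
  (hm : forall i x, V x -> differentiable (m i \o iota) x)
  (hl : forall i x, V x -> differentiable (l i \o iota) x)
  (heig : forall i z, calV z -> exists2 e : 'cV[R[i]^o]_2, e != 0 &
     rho z (based_loop M t0 (tail i) (mer (ends M (inl i)))) *m e
       = m i z *: e /\
     rho z (based_loop M t0 (tail i) (lon (ends M (inl i)))) *m e
       = l i z *: e)
  (* the first end remains a cusp *)
  (phi : R[i]^o -> R[i]^o)
  (hphi : local_expansion (cusp_locus calV (m 0) (l 0) z0) (m 1) (l 1) z0 phi)
  (* zpq p q is, for |p| + |q| large, the unique point close to z0 of the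
     filled locus at which (m_2, l_2) has its value at z0 *)
  (zpq : int -> int -> 'rV[R[i]^o]_nu)
  (hzpq : (fun s => zpq s.1 s.2) @ coprime_infty --> z0)
  (hzpq_unique : exists2 U, nbhs z0 U &
     \forall s \near coprime_infty, forall z,
       U z /\ [/\ filled_locus calV (m 0) (l 0) z0 s.1 s.2 z,
                 m 1 z = m 1 z0 & l 1 z = l 1 z0] <->
       z = zpq s.1 s.2)
  (* the first end is filled along the slope (p, q) *)
  (phipq : int -> int -> R[i]^o -> R[i]^o)
  (hphipq : \forall s \near coprime_infty,
     local_expansion (filled_locus calV (m 0) (l 0) z0 s.1 s.2)
       (m 1) (l 1) (zpq s.1 s.2) (phipq s.1 s.2)) :
  forall i : nat, (1 <= i <= 3)%N ->
    (fun s => derive1n i (phipq s.1 s.2) (m 1 z0))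
      @ coprime_infty --> derive1n i phi (m 1 z0).

Proof.
move=> i _.
have cz0 : calV z0 by case: hcalV => W [_ Wz0] ->; split=> //; case: hz0.
have [m1sq l1sq [be [beI rel1]]] := cusp_facts hz0 cz0 hrho crho (htail 0) (heig 0).
have [m2sq l2sq [be' [_ rel2]]] := cusp_facts hz0 cz0 hrho crho (htail 1) (heig 1).
apply: (expansion_limit hiota hV cz0 (hm 0) (hl 0) (hm 1) (hl 1) m1sq l1sq m2sq l2sq
  beI rel1 _ hphi hzpq hzpq_unique hphipq).
by apply: filterS (rel2 1 ltr01) => z h /h[b _ bE]; exists b.
Qed.
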